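(* Let $(X,\|\cdot\|)$ be a Banach space and let $\mathcal{S}:D(\mathcal{S})\subset X\to X$ be a one-to-one operator that generates a bounded analytic semigroup $e^{t\mathcal{S}}$ on $X$. Let $s\in(0,2)$ and $T\in(0,\infty]$. Let $\dot{B}^{s}=\dot{B}_{X,1}^{s,\mathcal{S}}$ and $\dot{B}^{-s}=\dot{B}_{X,1}^{-s,\mathcal{S}}$, and let $\mathcal{G}_{s}$, $\mathcal{G}_{-s}$ be the generators of the semigroups $\mathcal{T}_s(t)$, $\mathcal{T}_{-s}(t)$ on $\dot{B}^{s}$, $\dot{B}^{-s}$ (all defined in the context). There exists a constant $C=C(s)$ such that: (i) For any $x\in\dot{B}^{s}$ and $f\in L^1((0,T);\dot{B}^{s})$, the equation $u'(t)-\mathcal{G}_{s}u(t)=f(t)$, $u(0)=x$, has a unique strong solution $u\in C([0,T);\dot{B}^{s})$ satisfying $$\|u\|_{L^\infty((0,T);\dot{B}^{s})}+\|u'\|_{L^1((0,T);\dot{B}^{s})}+\|\mathcal{G}_su\|_{L^1((0,T);\dot{B}^{s})}\le C\|x\|_{\dot{B}^{s}}+C\|f\|_{L^1((0,T);\dot{B}^{s})}.$$ (ii) For any $x\in\dot{B}^{-s}$ and $f\in L^1((0,T);\dot{B}^{-s})$, the equation $u'(t)-\mathcal{G}_{-s}u(t)=f(t)$, $u(0)=x$, has a unique strong solution $u\in C([0,T);\dot{B}^{-s})$ satisfying $$\|u\|_{L^\infty((0,T);\dot{B}^{-s})}+\|u'\|_{L^1((0,T);\dot{B}^{-s})}+\|\mathcal{G}_{-s}u\|_{L^1((0,T);\dot{B}^{-s})}\le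 C\|x\|_{\dot{B}^{-s}}+C\|f\|_{L^1((0,T);\dot{B}^{-s})}.$$
   Context: All Banach spaces are real. A bounded analytic semigroup on $X$ is a $C_0$ semigroup $\{\mathcal{T}(t)\}_{t\ge0}$ with $\sup_{t\ge 0}\|\mathcal{T}(t)\|<\infty$ whose generator $\mathcal{A}$ satisfies $\mathcal{T}(t)x\in D(\mathcal{A})$ for all $x\in X$, $t>0$, and $\sup_{t>0}\|t\mathcal{A}\mathcal{T}(t)x\|\le C\|x\|$ for all $x\in X$. For $s\in(0,2)$ define $\|x\|_{\dot{B}_{X,1}^{s,\mathcal{S}}}=\int_0^\infty t^{-s/2}\|t\mathcal{S}e^{t\mathcal{S}}x\|\frac{dt}{t}$ and $\|x\|_{\dot{B}_{X,1}^{-s,\mathcal{S}}}=\int_0^\infty t^{s/2}\|e^{t\mathcal{S}}x\|\frac{dt}{t}$. The space $\dot{B}_{X,1}^{s,\mathcal{S}}$ is the completion of $D(\mathcal{S})$ in the first norm, and $\dot{B}_{X,1}^{-s,\mathcal{S}}$ is the completion of the range $R(\mathcal{S})$ in the second norm (both norms are finite on these subspaces). The operators $e^{t\mathcal{S}}|_{D(\mathcal{S})}$ (resp. $e^{t\mathcal{S}}|_{R(\mathcal{S})}$) extend by continuity to a bounded $C_0$ semigroup $\{\mathcal{T}_s(t)\}_{t\ge0}$ on $\dot{B}_{X,1}^{s,\mathcal{S}}$ (resp. $\{\mathcal{T}_{-s}(t)\}_{t\ge0}$ on $\dot{B}_{X,1}^{-s,\mathcal{S}}$), with generator $\mathcal{G}_s$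 (resp. $\mathcal{G}_{-s}$). The data $X$ and $\mathcal{S}$ are fixed; $C$ is independent of $T$, $x$ and $f$. A strong solution of $u'-\mathcal{G}u=f$, $u(0)=x$, in a Banach space $Y$ is a continuous $Y$-valued function $u$ with $u\in W^{1,1}((0,T);Y)\cap L^1((0,T);D(\mathcal{G}))$ (for $T=\infty$: on each finite time interval), $D(\mathcal{G})$ with the graph norm, that satisfies the equation for a.e. $t\in(0,T)$ and the initial condition. *)

(* Defs.v *)
From HB Require Import structures.
From mathcomp Require Import all_boot all_order all_algebra.
From mathcomp Require Import all_classical all_reals all_analysis.
From mathcomp Require Import ess_sup_inf.

Set Implicit Arguments.
Unset Strict Implicit.
Unset Printing Implicit Defensive.

Import Order.TTheory GRing.Theory Num.Theory.
Import numFieldNormedType.Exports.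

Local Open Scope classical_set_scope.
Local Open Scope ring_scope.

(** A one-parameter family of operators on [X] is a function [E : R -> X -> X];
    only its values at times [t >= 0] are meaningful.  An unbounded operator is
    a domain [D : set X] together with a function [S : X -> X] of which only the
    restriction to [D] is meaningful. *)

Definition c0_semigroup (R : realType) (X : completeNormedModType R)
    (E : R -> X -> X) : Prop :=
  [/\ forall t, 0 <= t -> linear (E t) /\ continuous (E t),
      forall x, E 0 x = x,
      forall t r x, 0 <= t -> 0 <= r -> E (t + r) x = E t (E r x) &
      forall x, E t x @[t --> 0^'+] --> x].

Definition gen_dom (R : realType) (X : completeNormedModType R)
    (E : R -> X -> X) : set X :=
  [set x | cvg (h^-1 *: (E h x - x) @[h --> 0^'+])].

Definition gen_op (R : realType) (X : completeNormedModType R)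
    (E : R -> X -> X) (x : X) : X :=
  lim (h^-1 *: (E h x - x) @[h --> 0^'+]).

Definition generates (R : realType) (X : completeNormedModType R)
    (D : set X) (S : X -> X) (E : R -> X -> X) : Prop :=
  [/\ c0_semigroup E, D = gen_dom E & forall x, D x -> S x = gen_op E x].

Definition bounded_analytic_semigroup (R : realType)
    (X : completeNormedModType R) (E : R -> X -> X) : Prop :=
  [/\ c0_semigroup E,
      exists M : R, forall t x, 0 <= t -> `|E t x| <= M * `|x|,
      forall t x, 0 < t -> gen_dom E (E t x) &
      exists M : R, forall t x, 0 < t -> `|t *: gen_op E (E t x)| <= M * `|x|].

Definition besov_norm_pos (R : realType) (X : completeNormedModType R)
    (S : X -> X) (E : R -> X -> X) (s : R) (x : X) : \bar R :=
  \int[lebesgue_measure]_(t in [set t : R | 0 < t])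
     (t `^ (- (s / 2)) * `|t *: S (E t x)| / t)%:E.

Definition besov_norm_neg (R : realType) (X : completeNormedModType R)
    (E : R -> X -> X) (s : R) (x : X) : \bar R :=
  \int[lebesgue_measure]_(t in [set t : R | 0 < t])
     (t `^ (s / 2) * `|E t x| / t)%:E.

(** [(B, iota)] is a completion of the subspace [D] of [X] for the norm [N].
    Only the restriction of [iota] to [D] is meaningful. *)
Definition is_completion (R : realType) (X B : completeNormedModType R)
    (D : set X) (N : X -> \bar R) (iota : X -> B) : Prop :=
  [/\ forall (a : R) x y, D x -> D y ->
        iota (a *: x + y) = a *: iota x + iota y,
      forall x, D x -> (`|iota x|)%:E = N x &
      dense (iota @` D)].

(** As [iota @` D] is dense, there is at most one such family [F] on [t >= 0]. *)
Definition extends_by_continuity (R : realType) (X B : completeNormedModType R)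
    (D : set X) (iota : X -> B) (E : R -> X -> X) (F : R -> B -> B) : Prop :=
  forall t, 0 <= t ->
    continuous (F t) /\ forall x, D x -> F t (iota x) = iota (E t x).

Definition simple_function (R : realType) (Y : completeNormedModType R)
    (V : set Y) (f : R -> Y) : Prop :=
  [/\ finite_set (range f),
      forall y, measurable (f @^-1` [set y] : set (measurableTypeR R)) &
      range f `<=` V].

Definition simple_integral (R : realType) (Y : completeNormedModType R)
    (A : set R) (f : R -> Y) : Y :=
  \sum_(y \in range f)
     fine (lebesgue_measure (A `&` f @^-1` [set y] : set (measurableTypeR R)))
       *: y.

(** Strong measurability on [A] into the subspace [V] of [Y] equipped with the
    norm [N]: almost everywhere limit of [V]-valued simple functions. *)
Definition strongly_measurable (R : realType) (Y : completeNormedModType R)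
    (V : set Y) (N : Y -> R) (A : set R) (f : R -> Y) : Prop :=
  exists g : nat -> R -> Y, (forall n, simple_function V (g n)) /\
    {ae @lebesgue_measure R, forall t, A t ->
       V (f t) /\ N (g n t - f t) @[n --> \oo] --> (0 : R)}.

Definition L1norm (R : realType) (Y : completeNormedModType R)
    (N : Y -> R) (A : set R) (f : R -> Y) : \bar R :=
  \int[lebesgue_measure]_(t in A) (N (f t))%:E.

(** [f] belongs to [L^1(A; V)], where [V] carries the norm [N]. *)
Definition in_L1 (R : realType) (Y : completeNormedModType R)
    (V : set Y) (N : Y -> R) (A : set R) (f : R -> Y) : Prop :=
  strongly_measurable V N A f /\ (L1norm N A f < +oo)%E.

(** Extension by zero outside [A] is harmless as the norm is nonnegative. *)
Definition Linfty_norm (R : realType) (Y : completeNormedModType R)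
    (A : set R) (f : R -> Y) : \bar R :=
  ess_sup lebesgue_measure ((fun t => (`|f t|)%:E) \_ A).

Definition is_bochner_integral (R : realType) (Y : completeNormedModType R)
    (A : set R) (f : R -> Y) (I : Y) : Prop :=
  strongly_measurable [set: Y] Num.norm A f /\
  exists g : nat -> R -> Y,
    [/\ forall n, simple_function [set: Y] (g n),
        forall n, (L1norm Num.norm A (g n) < +oo)%E,
        L1norm Num.norm A (fun t => f t - g n t)%R @[n --> \oo] --> (0 : \bar R)%E &
        simple_integral A (g n) @[n --> \oo] --> I].

(** Arbitrary value when [f] is not Bochner integrable on [A]. *)
Definition bochner (R : realType) (Y : completeNormedModType R)
    (A : set R) (f : R -> Y) : Y :=
  get (is_bochner_integral A f).

Definition test_function (R : realType) (tau : R) (phi : R -> R) : Prop :=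
  (forall n t, derivable (derive1n n phi) t 1) /\
  exists a b : R, [/\ 0 < a, b < tau & forall t, ~ (a <= t <= b) -> phi t = 0].

Definition weak_derivative (R : realType) (Y : completeNormedModType R)
    (tau : R) (u v : R -> Y) : Prop :=
  forall phi, test_function tau phi ->
    bochner [set t | 0 < t < tau] (fun t => derive1 phi t *: u t)
    = - bochner [set t | 0 < t < tau] (fun t => phi t *: v t).

(** [u] belongs to [W^{1,1}((0,tau); Y)] and has weak derivative [v]. *)
Definition in_W11 (R : realType) (Y : completeNormedModType R)
    (tau : R) (u v : R -> Y) : Prop :=
  [/\ in_L1 [set: Y] Num.norm [set t | 0 < t < tau] u,
      in_L1 [set: Y] Num.norm [set t | 0 < t < tau] v &
      weak_derivative tau u v].

Definition graph_norm (R : realType) (Y : completeNormedModType R)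
    (G : Y -> Y) (y : Y) : R := `|y| + `|G y|.

Definition time_interval (R : realType) (T : \bar R) : set R :=
  [set t | 0 < t /\ (t%:E < T)%E].

(** [u] is a strong solution on [(0,T)] of [u' - G u = f], [u(0) = x], where
    [G] is the generator of [F], and [u'] is its weak derivative.  Quantifying
    over the real [tau <= T] means the interval [(0,T)] itself when
    [T] is finite, and each finite time interval when [T] is infinite. *)
Definition strong_solution (R : realType) (Y : completeNormedModType R)
    (F : R -> Y -> Y) (T : \bar R) (x : Y) (f u u' : R -> Y) : Prop :=
  [/\ {within [set t : R | 0 <= t /\ (t%:E < T)%E], continuous u},
      forall tau : R, 0 < tau -> (tau%:E <= T)%E ->
        in_W11 tau u u' /\
        in_L1 (gen_dom F) (graph_norm (gen_op F)) [set t | 0 < t < tau] u,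
      {ae @lebesgue_measure R, forall t, time_interval T t ->
         gen_dom F (u t) /\ u' t - gen_op F (u t) = f t} &
      u 0 = x].

(** Unique solvability together with the maximal [L^1]-regularity estimate. *)
Definition uniquely_solvable_with_bound (R : realType)
    (Y : completeNormedModType R) (F : R -> Y -> Y) (T : \bar R) (C : R)
    (x : Y) (f : R -> Y) : Prop :=
  exists u u' : R -> Y,
    [/\ strong_solution F T x f u u',
        (Linfty_norm (time_interval T) u
         + L1norm Num.norm (time_interval T) u'
         + L1norm Num.norm (time_interval T) (fun t => gen_op F (u t))
         <= C%:E * (`|x|)%:E + C%:E * L1norm Num.norm (time_interval T) f)%E &
        forall w w' : R -> Y, strong_solution F T x f w w' ->
          forall t, 0 <= t -> (t%:E < T)%E -> w t = u t].

(* Main.v *)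
Require Import Defs.
From HB Require Import structures.
From mathcomp Require Import all_boot all_order all_algebra.
From mathcomp Require Import all_classical all_reals all_analysis.
From mathcomp Require Import measurable_realfun ess_sup_inf.
From mathcomp Require Import ring lra.

Import Order.TTheory GRing.Theory Num.Theory.
Import numFieldNormedType.Exports.

Local Open Scope classical_set_scope.
Local Open Scope ring_scope.

(** Why the theorem holds.  Both Besov norms are weighted L^1 norms along orbits:
    they have the form [N x = \int_(r > 0) r^a * `|L r x|] with [-1 < a < 0], where
    [L r = S e^{rS}] and [a = - s / 2] for the space of order [s], and [L r = e^{rS}]
    and [a = s / 2 - 1] for the space of order [-s].  In both cases
    [L r (e^{tS} x) = L (r + t) x].  Hence, for a vector [z] smoothed by the
    semigroup, Tonelli's theorem gives

      [\int_t N (e^{tS} S z) = \int_t \int_r r^a * `|L (r + t) (S z)|]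
      [  = \int_y (\int_(0 < t < y) (y - t)^a) * `|L y (S z)|]
      [  <= C * \int_y y^(a + 1) * `|L y (S z)|,]

    and analyticity, in the form
    [`|L y (S z)| <= (2 * M1 / y) * `|L (y / 2) z|], bounds this by [C * N z]
    ([weighted_hardy], [smoothed_integral]).  So in the completion, for the
    extended semigroup [F] with generator [G], the orbits satisfy

      [\int_t `|G (F t z)| <= K * `|z|]   for [z] in a dense set.           (1)

    Estimate (1) implies L^1 maximal regularity for any bounded strongly continuous
    semigroup ([maximal_regularity]).  It bounds the homogeneous solution starting
    at [z].  For a pulse, the right-hand side equal to [y] on [a, b) and to 0
    elsewhere, the solution is explicit, and (1) bounds the L^1 norm of [G u] by a
    multiple of [(b - a) * `|y|], the L^1 norm of the pulse
    ([block_mild_solution]).  The L^1 norm of a step function is the sum of the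
    norms of its pulses, so by superposition the estimate holds for step functions,
    which are dense in L^1.  Instead of passing to the limit in the variation of
    constants formula, one approximates the data, solves, and repeats this with the
    error; the solutions so obtained are summed ([mild_solution_series],
    [mild_solution_exists]).  The sum solves the integrated equation
    [u t = x + \int_(0, t) (G u + f)] because the graph of [G] is closed.

    It remains to match this with strong solutions.  A primitive has its integrand
    as weak derivative ([weak_pair_primitive]), and [u] is measurable for the graph
    norm because the operators [h^-1 \int_(0, h) F] map simple functions into the
    domain ([graph_approximable]).  For uniqueness, let [z] be the difference of two
    strong solutions and [Z] its primitive.  Applying [P h = \int_(0, h) F] to the
    weak equation [z' = G z] gives [(P h z)' = F h z - z] weakly; by the lemma of
    du Bois-Reymond, [P h z = F h Z - Z] for every [h], that is, [Z' = z = G Z].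
    Then [F (t - r) (Z r)] is constant in [r], so [Z = 0] and [z = 0]
    ([weak_homogeneous_zero]).

    Functions with values in a Banach space are handled through [approximable],
    approximation in L^1 by simple functions, the error being measured by
    [upper_le], an upper integral that does not presuppose measurability. *)

Set Implicit Arguments.
Unset Strict Implicit.
Unset Printing Implicit Defensive.

(** * Upper bounds on integrals of possibly nonmeasurable functions *)

Section upper_integral.
Context {R : realType}.
Local Notation mu := (@lebesgue_measure R).
Implicit Types (A : set (measurableTypeR R)) (h : R -> R) (c : R).

Lemma ae_imply (P Q : R -> Prop) : (forall t, P t -> Q t) ->
  {ae mu, forall t, P t} -> {ae mu, forall t, Q t}.
Proof. by move=> PQ; exact: (@filterS _ _ (ae_filter_ringOfSetsType mu) _ _ PQ). Qed.

Lemma ae_imply2 (P Q Q' : R -> Prop) : (forall t, P t -> Q t -> Q' t) ->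
  {ae mu, forall t, P t} -> {ae mu, forall t, Q t} -> {ae mu, forall t, Q' t}.
Proof. by move=> PQ; exact: (@filterS2 _ _ (ae_filter_ringOfSetsType mu) _ _ _ PQ). Qed.

(** For nonnegative integrands the integral is the supremum over the simple
    functions below the integrand, so it is monotone whether or not the
    integrands are measurable. *)
Lemma le_integral_nonmeasurable A (f g : R -> \bar R) :
  (forall t, A t -> (0 <= f t)%E) -> (forall t, A t -> (f t <= g t)%E) ->
  (\int[mu]_(t in A) f t <= \int[mu]_(t in A) g t)%E.
Proof.
move=> f0 fg; have g0 t : A t -> (0 <= g t)%E.
  by move=> At; exact: le_trans (f0 _ At) (fg _ At).
rewrite !ge0_integralE//; apply: ereal_sup_le => _ [s /= sf <-].
exists s => //= t; apply: le_trans (sf t) _.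
by rewrite !patchE; case: ifPn => // /set_mem At; exact: fg.
Qed.

(** The upper integral of [h] over [A] is at most [c].  Errors such as
    [`|f t - s t|] come from functions that are only almost everywhere limits of
    simple functions and need not be Borel; a Borel majorant makes the integral
    subadditive and countably subadditive on them. *)
Definition upper_le A h c := exists k : R -> \bar R,
  [/\ measurable_fun [set: R] k, forall t, (0 <= k t)%E,
      {ae mu, forall t, A t -> ((h t)%:E <= k t)%E} &
      (\int[mu]_(t in A) k t <= c%:E)%E].

Lemma upper_leW A h h' c c' : {ae mu, forall t, A t -> h t <= h' t} ->
  c' <= c -> upper_le A h' c' -> upper_le A h c.
Proof.
move=> hh' cc' [k [mk k0 hk kc]]; exists k; split => //.
- apply: filterS2 hh' hk => t /= h1 h2 At.
  by apply: le_trans (h2 At); rewrite lee_fin; exact: h1.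
- by apply: le_trans kc _; rewrite lee_fin.
Qed.

Lemma upper_le_le A h h' c : (forall t, A t -> h t <= h' t) ->
  upper_le A h' c -> upper_le A h c.
Proof. by move=> hh'; apply: upper_leW => //; apply: aeW => t; exact: hh'. Qed.

Lemma upper_leD A h h' c c' : measurable A ->
  upper_le A h c -> upper_le A h' c' -> upper_le A (fun t => h t + h' t) (c + c').
Proof.
move=> mA [k [mk k0 hk kc]] [k' [mk' k0' hk' kc']].
exists (fun t => k t + k' t)%E; split => //.
- exact: emeasurable_funD.
- by move=> t; exact: adde_ge0.
- by apply: filterS2 hk hk' => t h1 h2 At; rewrite EFinD; apply: leeD; [exact: h1|exact: h2].
- rewrite ge0_integralD//; [|exact: measurable_funTS|exact: measurable_funTS].
  by rewrite EFinD; apply: leeD.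
Qed.

Lemma upper_leZ A h c a : measurable A -> 0 <= a ->
  upper_le A h c -> upper_le A (fun t => a * h t) (a * c).
Proof.
move=> mA a0 [k [mk k0 hk kc]].
exists (fun t => a%:E * k t)%E; split => //.
- exact: measurable_funeM.
- by move=> t; apply: mule_ge0.
- by apply: filterS hk => t h1 At; rewrite EFinM; apply: lee_wpmul2l => //; exact: h1.
- rewrite ge0_integralZl//; last exact: measurable_funTS.
  by rewrite EFinM; apply: lee_wpmul2l.
Qed.

Lemma upper_leS A B h c : measurable A -> measurable B -> A `<=` B ->
  upper_le B h c -> upper_le A h c.
Proof.
move=> mA mB AB [k [mk k0 hk kc]]; exists k; split => //.
- by apply: filterS hk => t h1 At; exact/h1/AB.
- by apply: le_trans kc; apply: ge0_subset_integral => //; exact: measurable_funTS.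
Qed.

Lemma upper_le_measurable A h c : measurable A -> measurable_fun [set: R] h ->
  (forall t, 0 <= h t) ->
  (\int[mu]_(t in A) (h t)%:E <= c%:E)%E -> upper_le A h c.
Proof.
move=> mA mh h0 hc; exists (EFin \o h); split => //=.
  exact/measurable_EFinP.
exact: aeW.
Qed.

Lemma integral_le_upper A h c : measurable A -> (forall t, A t -> 0 <= h t) ->
  upper_le A h c -> (\int[mu]_(t in A) (h t)%:E <= c%:E)%E.
Proof.
move=> mA h0 [k [mk k0 [N [mN N0 sN]] kc]].
pose k' t := if t \in (N : set (measurableTypeR R)) then +oo%E else k t.
apply: (@le_trans _ _ (\int[mu]_(t in A) k' t)%E).
  apply: le_integral_nonmeasurable => [t At|t At]; first by rewrite lee_fin h0.
  rewrite /k'; case: ifPn => [_|/negP tN]; first exact: leey.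
  apply: contrapT => hk; apply: tN; apply/mem_set/sN => /= /(_ At) ?; exact: hk.
apply: le_trans kc; rewrite le_eqVlt; apply/orP; left; apply/eqP.
apply: ge0_ae_eq_integral => //.
- apply: measurable_funTS; apply: measurable_fun_ifT => //.
  by apply: (measurable_fun_bool true); rewrite setTI preimage_mem_true.
- exact: measurable_funTS.
- by move=> t _; rewrite /k'; case: ifPn.
- exists N; split => // t; rewrite /k' => /=; apply: contra_notP => tN At.
  by case: ifPn => // /set_mem.
Qed.

Lemma upper_le_ge0 A h c : upper_le A h c -> 0 <= c.
Proof.
move=> [k [mk k0 _ kc]]; rewrite -lee_fin; apply: le_trans kc.
by apply: integral_ge0.
Qed.

(** Monotone convergence for the majorants: if the costs are summable, one
    almost everywhere finite function dominates all partial sums. *)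
Lemma upper_le_series A (h : nat -> R -> R) (c : nat -> R) (C : R) :
  measurable A -> (forall n, upper_le A (h n) (c n)) ->
  (forall n, \sum_(k < n) c k <= C) ->
  exists k : R -> \bar R, [/\ measurable_fun [set: R] k, forall t, (0 <= k t)%E,
     {ae mu, forall t, A t -> forall n, ((\sum_(j < n) h j t)%:E <= k t)%E /\ (k t < +oo)%E} &
     (\int[mu]_(t in A) k t <= C%:E)%E].
Proof.
move=> mA /choice[k hk] hC.
pose K t := (\sum_(n <oo) k n t)%E.
have mk n := let: And4 m _ _ _ := hk n in m.
have k0 n := let: And4 _ m _ _ := hk n in m.
have mK : measurable_fun setT K by exact: ge0_emeasurable_sum.
have K0 t : (0 <= K t)%E by exact: nneseries_ge0.
have iK : (\int[mu]_(t in A) K t <= C%:E)%E.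
  rewrite integral_nneseries//; last by move=> n; have := mk n; exact: measurable_funTS.
  apply: lime_le; first by apply: is_cvg_nneseries => n _ _; exact: integral_ge0.
  apply: nearW => n; rewrite big_mkord.
  apply: (@le_trans _ _ (\sum_(i < n) (c i)%:E)%E).
    by apply: lee_sum => i _; have [] := hk i.
  by rewrite sumEFin lee_fin.
exists K; split => //.
have Kfin : {ae mu, forall t, A t -> (K t < +oo)%E}.
  have iKA : mu.-integrable A K.
    apply/integrableP; split; first exact: measurable_funTS.
    under eq_integral => t _ do rewrite gee0_abs//.
    by apply: le_lt_trans iK _; rewrite ltry.
  have := integrable_ae mA iKA; apply: filterS => t h1 /h1.
  by rewrite ge0_fin_numE.
have hk' : {ae mu, forall t, forall n, A t -> ((h n t)%:E <= k n t)%E}.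
  by apply/ae_foralln => n; have [] := hk n.
apply: filterS2 Kfin hk' => t h1 h2 At n; split; last exact: h1.
rewrite -sumEFin; apply: (@le_trans _ _ (\sum_(i < n) k i t)%E).
  by apply: lee_sum => i _; exact: h2.
by rewrite -(big_mkord xpredT (k ^~ t)); exact: nneseries_lim_ge.
Qed.

(** The form in which completeness of L^1 is used: a function dominated in the
    limit by partial sums inherits the sum of their costs. *)
Lemma upper_le_lim A (h : nat -> R -> R) (c : nat -> R) (C : R) (g : R -> R) :
  measurable A -> (forall n, upper_le A (h n) (c n)) ->
  (forall n, \sum_(k < n) c k <= C) ->
  {ae mu, forall t, A t -> forall e, 0 < e -> exists n, g t <= \sum_(j < n) h j t + e} ->
  upper_le A g C.
Proof.
move=> mA hc hC hg; have [k [mk k0 hk kc]] := upper_le_series mA hc hC.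
exists k; split => //; apply: filterS2 hk hg => t h1 h2 At.
have [_ kfin] := h1 At 0%N.
apply/lee_addgt0Pr => e e0; have [n hn] := h2 At _ e0.
have [hn1 _] := h1 At n.
apply: (@le_trans _ _ (\sum_(j < n) h j t + e)%:E); first by rewrite lee_fin.
by rewrite EFinD; exact: leeD.
Qed.

Lemma upper_le_ae_bounded A (h : nat -> R -> R) (c : nat -> R) (C : R) :
  measurable A -> (forall n, upper_le A (h n) (c n)) ->
  (forall n, \sum_(k < n) c k <= C) ->
  {ae mu, forall t, A t -> exists m, forall n, \sum_(j < n) h j t <= m}.
Proof.
move=> mA hc hC; have [k [mk k0 hk kc]] := upper_le_series mA hc hC.
apply: filterS hk => t h1 At; exists (fine (k t)) => n.
have [h2 h3] := h1 At n.
by rewrite -lee_fin fineK// ge0_fin_numE.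
Qed.

End upper_integral.

(** * Measurable functions with finite range *)

Section finite_range.
Context {R : realType}.
Local Notation mu := (@lebesgue_measure R).
Local Notation TR := (measurableTypeR R).

(** Simple functions with values in an arbitrary type: pairs of simple functions
    are again of this kind, so that two simple functions can be refined to a
    common partition. *)
Definition finite_measurable (Z : Type) (f : R -> Z) :=
  finite_set (range f) /\ forall z, measurable (f @^-1` [set z] : set TR).

Lemma finite_measurable_preimage (Z : choiceType) (f : R -> Z) (B : set Z) :
  finite_measurable f -> measurable (f @^-1` B : set TR).
Proof.
move=> [ff mf].
rewrite (_ : f @^-1` B = \bigcup_(z in range f `&` B) f @^-1` [set z]).
  by apply: fin_bigcup_measurable => [|z _]; [exact: finite_setIl|exact: mf].
apply/seteqP; split => [t Bt|t [z [_ Bz] /= fz]]; first by exists (f t).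
by rewrite /preimage/= fz.
Qed.

Lemma finite_measurable_comp (Z Z' : choiceType) (p : Z -> Z') (f : R -> Z) :
  finite_measurable f -> finite_measurable (p \o f).
Proof.
move=> ff; split; last first.
  by move=> z; exact: (finite_measurable_preimage (p @^-1` [set z]) ff).
by rewrite -(image_comp f p); apply: finite_image; exact: (proj1 ff).
Qed.

Lemma finite_measurable_pair (Z Z' : choiceType) (f : R -> Z) (g : R -> Z') :
  finite_measurable f -> finite_measurable g ->
  finite_measurable (fun t => (f t, g t)).
Proof.
move=> [ff mf] [fg mg]; split.
  apply: (sub_finite_set _ (finite_setX ff fg)) => _ [t _ <-].
  by split => /=; exists t.
move=> [z z']; rewrite (_ : _ @^-1` _ = f @^-1` [set z] `&` g @^-1` [set z']).
  exact: measurableI.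
by apply/seteqP; split => [t /= [-> ->]//|t /= [-> ->]].
Qed.

Lemma finite_measurable_fun (h : R -> R) :
  finite_measurable h -> measurable_fun [set: R] h.
Proof. by move=> hh _ B mB; rewrite setTI; exact: finite_measurable_preimage. Qed.

Lemma finite_measurable_patch (Z : choiceType) (z0 : Z) (f : R -> Z) (B : set TR) :
  measurable B -> finite_measurable f ->
  finite_measurable (fun t => if t \in B then f t else z0).
Proof.
move=> mB ff; have fB : finite_measurable (fun t => t \in B).
  split; first exact: finite_finset.
  case.
    rewrite (_ : _ @^-1` _ = B)//; apply/seteqP; split => t /=.
      by move/set_mem.
    exact: mem_set.
  rewrite (_ : _ @^-1` _ = ~` B); first exact: measurableC.
  apply/seteqP; split => t /=; first by move=> tB Bt; rewrite mem_set in tB.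
  exact: memNset.
exact: (finite_measurable_comp (fun z => if z.2 then z.1 else z0) (finite_measurable_pair ff fB)).
Qed.

Context {Y : completeNormedModType R}.

Lemma simple_finite_measurable (V : set Y) f : simple_function V f -> finite_measurable f.
Proof. by case. Qed.

Lemma finite_measurable_simple f : finite_measurable f -> simple_function [set: Y] f.
Proof. by case. Qed.

(** Refining the partition does not change the integral; additivity follows by
    applying this to the pair of the two functions. *)
Lemma simple_integral_comp (Z : choiceType) (A : set TR) (p : Z -> Y) (h : R -> Z) :
  measurable A -> (mu A < +oo)%E -> finite_measurable h ->
  simple_integral A (p \o h) =
  \sum_(z \in range h) fine (mu (A `&` h @^-1` [set z])) *: p z.
Proof.
move=> mA finA fh.
have muE z : mu (A `&` h @^-1` [set z]) = (fine (mu (A `&` h @^-1` [set z])))%:E.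
  rewrite fineK// ge0_fin_numE//; apply: le_lt_trans finA; apply: le_measure; rewrite ?inE//.
  by apply: measurableI => //; exact: finite_measurable_preimage.
set m := fun z => fine (mu (A `&` h @^-1` [set z])).
have finr : finite_set (range h) := proj1 fh.
have finp : finite_set (range (p \o h)) by rewrite -(image_comp h p); exact: finite_image.
transitivity (\sum_(y \in range (p \o h)) \sum_(z \in range h)
    (if p z == y then m z *: p z else 0)).
  rewrite /simple_integral; apply: eq_fsbigr => y _.
  have -> : mu (A `&` (p \o h) @^-1` [set y]) =
      (\sum_(z \in range h `&` [set z | p z = y]) m z)%:E.
    rewrite -fsumEFin; last exact: finite_setIl.
    under eq_fsbigr do rewrite /m -muE.
    rewrite -measure_fin_bigcup//.
    - congr (mu _); apply/seteqP; split => [t [At pt]|t [z [_ pz] [At /= hz]]].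
        by exists (h t) => //; split => //; exists t.
      by split => //=; rewrite hz.
    - exact: finite_setIl.
    - by move=> z z' _ _ [t [[_ /= <-] [_ /= <-]]].
    - by move=> z _; apply: measurableI => //; exact: finite_measurable_preimage.
  rewrite /= fsbig_mkcondr fsbig_finite//= [RHS]fsbig_finite//= scaler_suml.
  apply: eq_bigr => z _; case: ifPn => [/set_mem /= ->|/negP pzy].
    by rewrite eqxx.
  by rewrite scale0r; case: eqP => // pz; exfalso; apply: pzy; exact/mem_set.
rewrite exchange_fsbig//; apply: eq_fsbigr => z /set_mem [t _ htz].
rewrite (fsbigD1 (p z))//=; last by exists t => //; rewrite /= htz.
rewrite eqxx fsbig1 ?addr0// => y [_ /= ypz].
by case: eqP => // /esym.
Qed.

Lemma simple_integralD (A : set TR) f g : measurable A -> (mu A < +oo)%E ->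
  finite_measurable f -> finite_measurable g ->
  simple_integral A (fun t => f t + g t : Y) = simple_integral A f + simple_integral A g.
Proof.
move=> mA finA ff fg; have fgP := finite_measurable_pair ff fg.
rewrite (simple_integral_comp (fun z => z.1 + z.2) mA finA fgP).
rewrite (simple_integral_comp (fun z => z.1) mA finA fgP).
rewrite (simple_integral_comp (fun z => z.2) mA finA fgP).
have fr : finite_set (range (fun t => (f t, g t))) by case: fgP.
rewrite !fsbig_finite//= -big_split/=.
by apply: eq_bigr => z _; rewrite scalerDr.
Qed.

Lemma upper_le_simple (A : set TR) (h : R -> Y) c : measurable A -> (mu A < +oo)%E ->
  finite_measurable h -> upper_le A (fun t => `|h t|) c ->
  `|simple_integral A h| <= c.
Proof.
move=> mA finA fh hc.
have nh : finite_measurable (fun t => `|h t|) by exact: finite_measurable_comp fh.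
have hc' : (\int[mu]_(t in A) (`|h t|)%:E <= c%:E)%E by exact: integral_le_upper.
have finr : finite_set (range h) := proj1 fh.
have muE z : mu (A `&` h @^-1` [set z]) = (fine (mu (A `&` h @^-1` [set z])))%:E.
  rewrite fineK// ge0_fin_numE//; apply: le_lt_trans finA; apply: le_measure; rewrite ?inE//.
  by apply: measurableI => //; exact: finite_measurable_preimage.
have := simple_integral_comp id mA finA fh; rewrite /comp => ->.
have hE t : (`|h t|)%:E = (\sum_(z \in range h) (`|z| * \1_(h @^-1` [set z]) t)%:E)%E.
  rewrite (fsbigD1 (h t))//=; last by exists t.
  rewrite indicE mem_set// mulr1 fsbig1 ?adde0// => z [_ /= zh].
  rewrite indicE memNset ?mulr0//= => hz; exact/zh.
have iE : (\int[mu]_(t in A) (`|h t|)%:E =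
    (\sum_(z \in range h) fine (mu (A `&` h @^-1` [set z])) * `|z|)%:E)%E.
  under eq_integral => t _ do rewrite hE.
  have mi z : measurable_fun A (fun t => (`|z| * \1_(h @^-1` [set z]) t)%:E : \bar R).
    apply/measurable_EFinP; apply: measurable_funM => //.
    by apply: measurable_indic; exact: finite_measurable_preimage.
  rewrite (ge0_integral_fsum mu mA mi)//=.
  rewrite -fsumEFin//; apply: eq_fsbigr => z _.
  under eq_integral => t _ do rewrite EFinM.
  have mi' : measurable_fun A (fun t => (\1_(h @^-1` [set z]) t)%:E : \bar R).
    by apply/measurable_EFinP; apply: measurable_indic; exact: finite_measurable_preimage.
  rewrite ge0_integralZl//.
  rewrite integral_indic//; last exact: finite_measurable_preimage.
  by rewrite setIC [X in (_ * X)%E = _]muE -EFinM mulrC.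
rewrite -lee_fin; apply: le_trans hc'; rewrite iE lee_fin.
rewrite fsbig_finite//= [leRHS]fsbig_finite//=; apply: le_trans (ler_norm_sum _ _ _) _.
by apply: ler_sum => z _; rewrite normrZ ger0_norm ?fine_ge0.
Qed.

End finite_range.

(** * Approximation in L1 by simple functions *)

Section approximable.
Context {R : realType}.
Local Notation mu := (@lebesgue_measure R).
Local Notation TR := (measurableTypeR R).
Context {Y : completeNormedModType R}.

Lemma sum_half n : \sum_(k < n) (2^-1 ^+ k.+1 : R) <= 1.
Proof.
suff -> : \sum_(k < n) (2^-1 ^+ k.+1 : R) = 1 - 2^-1 ^+ n.
  by rewrite gerBl exprn_ge0// invr_ge0.
elim: n => [|n IH]; first by rewrite big_ord0 expr0 subrr.
by rewrite big_ord_recr/= IH exprS; field.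
Qed.

Lemma half_gt0 n : (0 : R) < 2^-1 ^+ n.
Proof. by rewrite exprn_gt0// invr_gt0. Qed.

Lemma bounded_sum_cvg0 (a : nat -> R) m : (forall n, 0 <= a n) ->
  (forall n, \sum_(j < n) a j <= m) -> a n @[n --> \oo] --> (0 : R).
Proof.
move=> a0 am; apply: cvg_series_cvg_0; apply: nondecreasing_is_cvgn.
  by move=> i j ij; rewrite /series/=; apply: (@nondecreasing_series _ a xpredT 0 (fun n _ _ => a0 n)).
exists m => _ [n _ <-]; rewrite /series/= big_mkord; exact: am.
Qed.

(** Approximability by simple functions in L^1.  On a set of finite measure this
    is Bochner integrability, in the form that is stable under bounded linear
    maps, sums and limits; [in_L1_approximable] leads from integrability to it and
    [approximable_strongly_measurable] leads back. *)
Definition approximable (V : set Y) (N : Y -> R) (A : set TR) (f : R -> Y) :=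
  forall e, 0 < e -> exists2 s, simple_function V s &
    upper_le A (fun t => N (s t - f t)) e.

(** Along approximations of summable errors the distances [N (g n t - f t)] are
    summable for almost every [t], hence tend to 0. *)
Lemma approximable_strongly_measurable V N A f : measurable A ->
  (forall y, 0 <= N y) -> {ae mu, forall t, A t -> V (f t)} ->
  approximable V N A f -> strongly_measurable V N A f.
Proof.
move=> mA N0 Vf fA.
have /choice[g hg] : forall n, exists s, simple_function V s /\
    upper_le A (fun t => N (s t - f t)) (2^-1 ^+ n.+1).
  by move=> n; have [s ? ?] := fA _ (half_gt0 n.+1); exists s.
exists g; split; first by move=> n; case: (hg n).
have := upper_le_ae_bounded mA (fun n => (hg n).2) sum_half.
apply: filterS2 Vf => t h1 h2 At; split; first exact: h1.
have [m hm] := h2 At.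
by apply: (@bounded_sum_cvg0 (fun n => N (g n t - f t)) m).
Qed.

Lemma approximable_upper (A : set TR) f : (forall e, 0 < e ->
   exists2 g, approximable setT Num.norm A g & upper_le A (fun t => `|g t - f t|) e) ->
  measurable A ->
  approximable setT Num.norm A f.
Proof.
move=> h mA e e0; have e20 : 0 < e / 2 by rewrite divr_gt0.
have [g ga gf] := h _ e20; have [s ss sg] := ga _ e20.
exists s => //; rewrite (splitr e).
apply: upper_le_le (upper_leD mA sg gf) => t _.
exact: ler_distD.
Qed.

Lemma simple_approximable (A : set TR) s : simple_function setT s ->
  approximable (setT : set Y) Num.norm A s.
Proof.
move=> ss e e0; exists s => //; exists (fun _ => 0%E); split => //.
- by apply: aeW => t _; rewrite subrr normr0.
- by rewrite integral0 lee_fin ltW.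
Qed.

Lemma approximable_linear (A : set TR) f (L : Y -> Y) M : measurable A -> 0 <= M ->
  linear L -> (forall y, `|L y| <= M * `|y|) ->
  approximable setT Num.norm A f -> approximable setT Num.norm A (L \o f).
Proof.
move=> mA M0 lL bL fa e e0; have eM : 0 < e / (M + 1) by rewrite divr_gt0// ltr_wpDl.
have [s ss sf] := fa _ eM.
exists (L \o s).
  exact/finite_measurable_simple/finite_measurable_comp/simple_finite_measurable/ss.
have LB x y : L (x - y) = L x - L y.
  by rewrite addrC -scaleN1r lL scaleN1r addrC.
have Me : M * (e / (M + 1)) <= e.
  rewrite mulrA ler_pdivrMr ?ltr_wpDl// mulrDr mulr1 mulrC lerDl; exact: ltW.
apply: upper_leW (upper_leZ mA M0 sf) => //.
by apply: aeW => t _ /=; rewrite -LB.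
Qed.

Lemma approximableD (A : set TR) f g : measurable A ->
  approximable setT Num.norm A f -> approximable setT Num.norm A g ->
  approximable (setT : set Y) Num.norm A (fun t => f t + g t).
Proof.
move=> mA fa ga e e0; have e20 : 0 < e / 2 by rewrite divr_gt0.
have [s ss sf] := fa _ e20; have [s' ss' sg] := ga _ e20.
exists (fun t => s t + s' t).
  apply/finite_measurable_simple.
  exact: (finite_measurable_comp (fun z => z.1 + z.2)
    (finite_measurable_pair (simple_finite_measurable ss) (simple_finite_measurable ss'))).
rewrite (splitr e); apply: upper_le_le (upper_leD mA sf sg) => t _.
by rewrite opprD addrACA; exact: ler_normD.
Qed.

Lemma approximable_ae (A : set TR) f g : {ae mu, forall t, A t -> f t = g t} ->
  approximable setT Num.norm A f ->
  approximable (setT : set Y) Num.norm A g.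
Proof.
move=> fg fa e e0; have [s ss sf] := fa _ e0; exists s => //.
by apply: upper_leW sf => //; apply: filterS fg => t h At; rewrite h.
Qed.

Lemma approximableS (A B : set TR) f : measurable A -> measurable B -> A `<=` B ->
  approximable setT Num.norm B f -> approximable (setT : set Y) Num.norm A f.
Proof.
move=> mA mB AB fa e e0; have [s ss sf] := fa _ e0; exists s => //.
exact: upper_leS sf.
Qed.

Lemma approximable_patch (A B C : set TR) (f : R -> Y) : measurable A -> measurable C -> measurable B ->
  A `&` C `<=` B ->
  approximable setT Num.norm B f ->
  approximable setT Num.norm A (fun t => if t \in C then f t else 0).
Proof.
move=> mA mC mB ACB fa e e0; have [s ss sf] := fa _ e0.
exists (fun t => if t \in C then s t else 0).
  apply/finite_measurable_simple.
  exact: (finite_measurable_patch 0 mC (simple_finite_measurable ss)).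
have [k [mk k0 hk kc]] := sf.
exists (k \_ (A `&` C)); split => //.
- by apply/(measurable_restrictT _ _).1; [exact: measurableI|exact: measurable_funTS].
- by move=> t; apply: erestrict_ge0 => *; exact: k0.
- apply: filterS hk => t h1 At; rewrite patchE; case: ifPn => /= [tC|tC].
    rewrite mem_set; last by split => //; exact/set_mem.
    by apply: h1; apply: ACB; split => //; exact/set_mem.
  by rewrite subrr normr0 (_ : _ \in _ = false)//; apply/negP => /set_mem[_ /mem_set]; exact/negP.
- rewrite -integral_mkcondr setIA setIid; apply: le_trans kc.
  apply: ge0_subset_integral => //; [exact: measurableI|exact: measurable_funTS].
Qed.

End approximable.

Section strongly_measurable_norm.
Context {R : realType}.
Local Notation mu := (@lebesgue_measure R).
Local Notation TR := (measurableTypeR R).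
Context {Y : completeNormedModType R}.
Local Notation strong := (@strongly_measurable R Y setT Num.norm).

(** Almost everywhere the norm of [f] is the upper limit of the norms of its
    simple approximations, which is Borel; so the norm of [f], even if not
    measurable itself, has an integral that is a true upper bound. *)
Lemma strongly_measurable_upper (A : set TR) f : measurable A ->
  strong A f -> (L1norm Num.norm A f < +oo)%E ->
  upper_le A (fun t => `|f t|) (fine (L1norm Num.norm A f)).
Proof.
move=> mA [g [sg hg]] finf.
have fg n : finite_measurable (fun t => `|g n t|).
  exact/(finite_measurable_comp (fun y => `|y|))/simple_finite_measurable/sg.
pose th t := limn_esup (fun n => (`|g n t|)%:E).
have mth : measurable_fun [set: R] th.
  apply: measurable_fun_limn_esup => n; apply/measurable_EFinP.
  by have := finite_measurable_fun (fg n).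
have thE : {ae mu, forall t, A t -> th t = (`|f t|)%:E}.
  apply: ae_imply hg => t h At; have [_ {}h] := h At.
  apply: (cvg_limn_einf_sup _).2; apply: cvg_EFin; first exact: nearW.
  apply/cvgrPdist_le => /= e e0.
  move/cvgrPdist_le : h => /(_ _ e0); apply: filterS => n /=.
  rewrite sub0r normrN normr_id; apply: le_trans.
  by rewrite -normrN opprB; exact: ler_dist_dist.
have th0 t : (0 <= th t)%E.
  rewrite /th; apply: le_trans (limn_einf_sup _).
  rewrite limn_einf_lim; apply: lime_ge; first exact: is_cvg_einfs.
  apply: nearW => n; apply: le_ereal_inf_tmp => _ [m /= _ <-].
  by rewrite lee_fin.
have [Z [mZ Z0 sZ]] := thE.
exists th; split => //.
  by apply: ae_imply thE => t h At; rewrite h.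
rewrite fineK ?ge0_fin_numE//; last by apply: integral_ge0 => t _; rewrite lee_fin.
rewrite (_ : (\int[mu]_(t in A) th t = \int[mu]_(t in A) ((th \_ (~` Z)) t))%E).
  apply: le_integral_nonmeasurable => t At; first by apply: erestrict_ge0 => *; exact: th0.
  rewrite patchE; case: ifPn => [/set_mem Zt|_]; last by rewrite lee_fin.
  by move: Zt; apply: contra_notP => h; apply: sZ => /= /(_ At) h'; apply: h; rewrite h'.
apply: ge0_ae_eq_integral => //.
- exact: measurable_funTS.
- apply: measurable_funTS; apply/(measurable_restrictT _ _).1; [exact: measurableC|exact: measurable_funTS].
- by move=> t _; apply: erestrict_ge0 => *; exact: th0.
- exists Z; split => // t; apply: contra_notP => Zt At /=.
  by rewrite patchE mem_set.
Qed.

Lemma strongly_measurableB_simple (A : set TR) f s :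
  simple_function (setT : set Y) s -> strong A f -> strong A (fun t => f t - s t).
Proof.
move=> ss [g [sg hg]]; exists (fun n t => g n t - s t); split.
  move=> n; apply: finite_measurable_simple.
  exact: (finite_measurable_comp (fun z => z.1 - z.2)
    (finite_measurable_pair (simple_finite_measurable (sg n)) (simple_finite_measurable ss))).
apply: ae_imply hg => t h At; have [_ {}h] := h At; split => //.
by under eq_cvg do rewrite opprB addrA subrK.
Qed.

End strongly_measurable_norm.

(** * Existence and size of the Bochner integral *)

Section in_L1_approximable.
Context {R : realType}.
Local Notation mu := (@lebesgue_measure R).
Local Notation TR := (measurableTypeR R).
Context {Y : completeNormedModType R}.
Local Notation strong := (@strongly_measurable R Y setT Num.norm).

(** Cut the approximating simple functions off where they exceed twice the Borel
    majorant of the norm of [f]; the errors are then dominated by three times that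
    majorant and dominated convergence applies. *)
Lemma in_L1_approximable (A : set TR) f : measurable A ->
  in_L1 (setT : set Y) Num.norm A f -> approximable setT Num.norm A f.
Proof.
move=> mA [sf finf] e e0.
have [k [mk k0 fk kc]] := strongly_measurable_upper mA sf finf.
have {kc} ik : mu.-integrable A (fun t => 3%:E * k t)%E.
  apply: integrableZl => //; apply/integrableP; split; first by exact: measurable_funTS.
  under eq_integral => t _ do rewrite gee0_abs//.
  by apply: le_lt_trans kc _; rewrite ltry.
have [g [sg hg]] := sf.
have ng (p : Y -> R) n : measurable_fun [set: R] (fun t => p (g n t)).
  have := finite_measurable_fun (finite_measurable_comp p (simple_finite_measurable (sg n))).
  by [].
pose B n : set TR := [set t | ((`|g n t|)%:E <= 2%:E * k t)%E].
have mB n : measurable (B n).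
  rewrite /B -[X in measurable X]setTI.
  apply: emeasurable_fun_le => //; last exact: measurable_funeM.
  by apply/measurable_EFinP; exact: ng.
pose s n t := if t \in B n then g n t else 0.
have fs n : finite_measurable (s n).
  exact: (finite_measurable_patch 0 (mB n) (simple_finite_measurable (sg n))).
(* a Borel version of the error [`|s n t - f t|] *)
pose kap n t := limn_esup (fun m => (`|s n t - g m t|)%:E).
have mkap n : measurable_fun [set: R] (kap n).
  apply: measurable_fun_limn_esup => m; apply/measurable_EFinP.
  have := finite_measurable_fun (finite_measurable_comp (fun z => `|z.1 - z.2|)
    (finite_measurable_pair (fs n) (simple_finite_measurable (sg m)))).
  by [].
have gcv : {ae mu, forall t, A t -> g ^~ t @ \oo --> f t}.
  apply: ae_imply hg => t h At; have [_ {}h] := h At.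
  apply/cvgrPdist_le => /= d d0; move/cvgrPdist_le : h => /(_ _ d0).
  by apply: filterS => n /=; rewrite sub0r normrN normr_id distrC.
have kapE : {ae mu, forall t, A t -> forall n, kap n t = (`|s n t - f t|)%:E}.
  apply: ae_imply gcv => t h At n; have {}h := h At.
  apply: (cvg_limn_einf_sup _).2; apply: cvg_EFin; first exact: nearW.
  by apply: cvg_norm; apply: cvgB => //; exact: cvg_cst.
have bnd : {ae mu, forall t, A t -> forall n, (`|s n t - f t|%:E <= 3%:E * k t)%E}.
  apply: ae_imply fk => t h At n; have {}h := h At.
  have sk : (`|s n t|%:E <= 2%:E * k t)%E.
    rewrite /s; case: ifPn => [/set_mem//|_]; rewrite normr0.
    by apply: mule_ge0 => //; rewrite lee_fin.
  apply: (@le_trans _ _ (`|s n t| + `|f t|)%:E); first by rewrite lee_fin ler_normB.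
  have -> : (3%:E * k t = 2%:E * k t + k t)%E.
    rewrite -[X in (_ + X)%E]mul1e -ge0_muleDl ?lee_fin// -EFinD.
    by congr (_%:E * _)%E; rewrite -natr1.
  by rewrite EFinD; exact: leeD.
have skf : {ae mu, forall t, A t -> s ^~ t @ \oo --> f t}.
  apply: ae_imply2 gcv fk => t h1 h2 At; have {}h1 := h1 At; have {}h2 := h2 At.
  have [f0|f0] := eqVneq (f t) 0.
    rewrite f0 in h1 *; apply/cvgrPdist_le => /= d d0.
    move/cvgrPdist_le : h1 => /(_ _ d0); apply: filterS => n; rewrite !sub0r !normrN.
    by rewrite /s; case: ifPn => // _ _; rewrite normr0 ltW.
  have nf0 : 0 < `|f t| by rewrite normr_gt0.
  apply/cvgrPdist_le => /= d d0.
  move/cvgrPdist_le : (h1) => /(_ _ d0); move/cvgrPdist_le : (h1) => /(_ _ nf0).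
  apply: filterS2 => n /= hf hd; rewrite /s mem_set//; rewrite /B/=.
  apply: (@le_trans _ _ (2%:E * (`|f t|)%:E)%E); last first.
    by apply: lee_wpmul2l => //; rewrite lee_fin.
  rewrite -EFinM lee_fin.
  have := ler_distD (f t) (g n t) 0; rewrite !subr0 distrC; lra.
have c1 : {ae mu, forall t, A t -> kap ^~ t @ \oo --> 0%E}.
  apply: ae_imply2 kapE skf => t h1 h2 At; have {}h1 := h1 At; have {}h2 := h2 At.
  under eq_fun do rewrite h1.
  apply: cvg_EFin; first exact: nearW.
  apply/cvgrPdist_le => /= d d0; move/cvgrPdist_le : h2 => /(_ _ d0).
  by apply: filterS => n /=; rewrite sub0r normrN normr_id distrC.
have c2 : {ae mu, forall t n, A t -> (`|kap n t| <= 3%:E * k t)%E}.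
  apply: ae_imply2 kapE bnd => t h1 h2 n At; rewrite h1// gee0_abs ?lee_fin//.
  exact: h2.
have mkA n : measurable_fun A (kap n) by have := mkap n; exact: measurable_funTS.
have [_ _] := dominated_convergence mA mkA (measurable_cst 0%E) c1 ik c2.
rewrite integral0 => /fine_cvgP[fin].
move=> /cvgrPdist_le/(_ _ e0) h; near \oo => n.
have hn1 : (\int[mu]_(x in A) kap n x)%E \is a fin_num by near: n.
have hn2 : `|0 - fine (\int[mu]_(x in A) kap n x)%E| <= e by near: n.
exists (s n); first exact: finite_measurable_simple.
have kap0 t : (0 <= kap n t)%E.
  rewrite /kap; apply: le_trans (limn_einf_sup _).
  rewrite limn_einf_lim; apply: lime_ge; first exact: is_cvg_einfs.
  by apply: nearW => m; apply: le_ereal_inf_tmp => _ [p /= _ <-]; rewrite lee_fin.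
exists (kap n); split => //.
  by apply: ae_imply kapE => t h1 At; rewrite h1.
rewrite -(fineK hn1) lee_fin; apply: le_trans hn2.
by rewrite sub0r normrN ler_norm.
Unshelve. all: by end_near. Qed.

End in_L1_approximable.

Section bochner_integral.
Context {R : realType}.
Local Notation mu := (@lebesgue_measure R).
Local Notation TR := (measurableTypeR R).
Context {Y : completeNormedModType R}.
Implicit Types (f g : R -> Y).
Local Notation ap := (@approximable R Y setT Num.norm).
Variables (A : set TR) (mA : measurable A) (finA : (mu A < +oo)%E).

Lemma simple_upper_le f : finite_measurable f ->
  exists c, upper_le A (fun t => `|f t|) c.
Proof.
move=> ff; have finr : finite_set (range f) := proj1 ff.
have /finite_seqP[r rE] := finr.
exists (\sum_(y <- r) `|y| * fine (mu A)).
apply: (@upper_le_le _ _ _ (fun=> \sum_(y <- r) `|y|)) => [t _|].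
  have : f t \in r.
    have : range f (f t) by exists t.
    by rewrite rE.
  by move=> ftr; rewrite (big_rem (f t))//= lerDl; apply: sumr_ge0.
exists (fun=> (\sum_(y <- r) `|y|)%:E); split => //.
- by move=> t; rewrite lee_fin; apply: sumr_ge0.
- exact: aeW.
- rewrite integral_cst// -mulr_suml EFinM fineK//.
  by rewrite ge0_fin_numE.
Qed.

Lemma approximable_upper_bound f : ap A f -> exists c, upper_le A (fun t => `|f t|) c.
Proof.
move=> /(_ 1 ltr01)[s ss sf]; have [c hc] := simple_upper_le (simple_finite_measurable ss).
exists (c + 1); apply: upper_le_le (upper_leD mA hc sf) => t _.
by rewrite -lerBlDl; apply: le_trans (lerB_dist _ _) _; rewrite distrC.
Qed.

Lemma L1norm_upper_le f e : @strongly_measurable R Y setT Num.norm A f ->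
  L1norm Num.norm A f \is a fin_num -> `|0 - fine (L1norm Num.norm A f)| <= e ->
  upper_le A (fun t => `|f t|) e.
Proof.
move=> sf finf fe; apply: (@upper_leW _ _ _ (fun t => `|f t|) _ (fine (L1norm Num.norm A f))).
- exact: aeW.
- by apply: le_trans fe; rewrite sub0r normrN ler_norm.
- by apply: strongly_measurable_upper => //; rewrite ltey_eq finf.
Qed.

(** Stated for every value that satisfies the defining property, so that it
    bounds the value selected by [bochner] before anything else is known of it. *)
Lemma is_bochner_bound f I c : is_bochner_integral A f I ->
  upper_le A (fun t => `|f t|) c -> `|I| <= c.
Proof.
move=> [sf [g [sg gfin gf gI]]] hc.
apply/ler_addgt0Pr => e e0.
have e20 : 0 < e / 2 by rewrite divr_gt0.
move/cvgrPdist_le : gI => /(_ _ e20) gI.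
move/fine_cvgP : gf => [ffin /cvgrPdist_le/(_ _ e20) gf].
near \oo => n.
have h1 : `|I - simple_integral A (g n)| <= e / 2 by near: n.
have h2 : L1norm Num.norm A (fun t => f t - g n t) \is a fin_num by near: n.
have h3 : `|0 - fine (L1norm Num.norm A (fun t => f t - g n t))| <= e / 2 by near: n.
have u1 : upper_le A (fun t => `|f t - g n t|) (e / 2).
  exact: (L1norm_upper_le (strongly_measurableB_simple _ sf) h2 h3).
have u2 : upper_le A (fun t => `|g n t|) (c + e / 2).
  apply: upper_le_le (upper_leD mA hc u1) => t _.
  by have := ler_distD (f t) (g n t) 0; rewrite !subr0 distrC addrC.
have := upper_le_simple mA finA (simple_finite_measurable (sg n)) u2.
have := ler_distD (simple_integral A (g n)) I 0; rewrite !subr0; lra.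
Unshelve. all: by end_near. Qed.

(** The integrals of simple approximations with errors [2^-n] form a Cauchy
    sequence. *)
Lemma is_bochner_exists f : ap A f -> exists I, is_bochner_integral A f I.
Proof.
move=> fa.
have /choice[g hg] : forall n, exists s, simple_function setT s /\
    upper_le A (fun t => `|s t - f t|) (2^-1 ^+ n.+1).
  by move=> n; have [s ? ?] := fa _ (half_gt0 n.+1); exists s.
have fg n : finite_measurable (g n) := simple_finite_measurable (hg n).1.
have half0 : (2^-1 ^+ n.+1 : R) @[n --> \oo] --> (0 : R).
  by apply: (bounded_sum_cvg0 (fun n => ltW (half_gt0 n.+1)) (@sum_half R)).
have cau : cvg (simple_integral A (g n) @[n --> \oo]).
  apply/cauchy_cvgP; apply: cauchy_exP => e e0.
  have e20 : 0 < e / 2 by rewrite divr_gt0.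
  move/cvgrPdist_lt : (half0) => /(_ _ e20)[M _ hM].
  have hM' n : (M <= n)%N -> (2^-1 ^+ n.+1 : R) < e / 2.
    by move/hM => /=; rewrite sub0r normrN ger0_norm// ltW// half_gt0.
  exists (simple_integral A (g M)); exists M => // m mM /=.
  rewrite -ball_normE /ball_/=; set n := M; have nM : (M <= n)%N by [].
  have dg : finite_measurable (fun t => g n t - g m t).
    exact: (finite_measurable_comp (fun z => z.1 - z.2)
      (finite_measurable_pair (fg n) (fg m))).
  have u2 : upper_le A (fun t => `|g n t - g m t|) (2^-1 ^+ n.+1 + 2^-1 ^+ m.+1).
    apply: upper_le_le (upper_leD mA (hg n).2 (hg m).2) => t _.
    by rewrite (distrC (g m t)); exact: ler_distD.
  have := upper_le_simple mA finA dg u2.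
  have -> : simple_integral A (fun t => g n t - g m t) =
      simple_integral A (g n) - simple_integral A (g m).
    apply/eqP; rewrite eq_sym subr_eq -simple_integralD//.
    by apply/eqP; congr simple_integral; apply/funext => t; rewrite subrK.
  move: (hM' _ nM) (hM' _ mM); lra.
exists (lim (simple_integral A (g n) @[n --> \oo])); split.
  apply: approximable_strongly_measurable => //.
  exact: aeW.
exists g; split => //.
- by move=> n; case: (hg n).
- move=> n; have [c hc] := simple_upper_le (fg n).
  by apply: le_lt_trans (ltry c); exact: integral_le_upper.
- have h n : (0 <= L1norm Num.norm A (fun t => f t - g n t)%R <= (2^-1 ^+ n.+1 : R)%:E)%E.
    apply/andP; split; first by apply: integral_ge0 => t _; rewrite lee_fin.
    apply: integral_le_upper => //.
    by apply: upper_le_le (hg n).2 => t _; rewrite distrC.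
  apply: (@squeeze_cvge _ _ _ _ (fun=> 0%E) _ (fun n => (2^-1 ^+ n.+1 : R)%:E)).
  + exact: nearW.
  + exact: cvg_cst.
  + by apply: cvg_EFin => //; exact: nearW.
Qed.

Lemma bochnerP f : ap A f -> is_bochner_integral A f (bochner A f).
Proof. by move=> /is_bochner_exists[I fI]; exact: (getPex (ex_intro _ I fI)). Qed.

Lemma bochner_bound f c : ap A f -> upper_le A (fun t => `|f t|) c -> `|bochner A f| <= c.
Proof. by move=> /bochnerP; exact: is_bochner_bound. Qed.

End bochner_integral.

(** * Calculus of the Bochner integral *)

Section bochner_calculus.
Context {R : realType}.
Local Notation mu := (@lebesgue_measure R).
Local Notation TR := (measurableTypeR R).
Context {Y : completeNormedModType R}.
Implicit Types (f g : R -> Y).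
Local Notation ap := (@approximable R Y setT Num.norm).

Import HBSimple.

Section fixed_set.
Variables (A : set TR) (mA : measurable A) (finA : (mu A < +oo)%E).

Lemma simple_integralB f g : finite_measurable f -> finite_measurable g ->
  simple_integral A (fun t => f t - g t) = simple_integral A f - simple_integral A g.
Proof.
move=> ff fg.
have dg : finite_measurable (fun t => f t - g t).
  exact: (finite_measurable_comp (fun z => z.1 - z.2) (finite_measurable_pair ff fg)).
apply/eqP; rewrite eq_sym subr_eq -simple_integralD//.
by apply/eqP; congr simple_integral; apply/funext => t; rewrite subrK.
Qed.

Lemma bochner_simple_dist f s e : ap A f -> finite_measurable s ->
  upper_le A (fun t => `|s t - f t|) e ->
  `|bochner A f - simple_integral A s| <= e.
Proof.
move=> fa fs sf.
have [smf [g [sg gfin gf gI]]] := bochnerP mA finA fa.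
apply/ler_addgt0Pr => d d0.
have d20 : 0 < d / 2 by rewrite divr_gt0.
move/cvgrPdist_le : gI => /(_ _ d20) gI.
move/fine_cvgP : gf => [ffin /cvgrPdist_le/(_ _ d20) gf].
near \oo => n.
have h1 : `|bochner A f - simple_integral A (g n)| <= d / 2 by near: n.
have h2 : L1norm Num.norm A (fun t => f t - g n t) \is a fin_num by near: n.
have h3 : `|0 - fine (L1norm Num.norm A (fun t => f t - g n t))| <= d / 2 by near: n.
have u1 : upper_le A (fun t => `|f t - g n t|) (d / 2).
  exact: (L1norm_upper_le mA (strongly_measurableB_simple (sg n) smf) h2 h3).
have u2 : upper_le A (fun t => `|s t - g n t|) (e + d / 2).
  by apply: upper_le_le (upper_leD mA sf u1) => t _; exact: ler_distD.
have fg := simple_finite_measurable (sg n).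
have dg : finite_measurable (fun t => s t - g n t).
  exact: (finite_measurable_comp (fun z => z.1 - z.2) (finite_measurable_pair fs fg)).
have := upper_le_simple mA finA dg u2.
rewrite simple_integralB// (distrC (simple_integral A s)).
have := ler_distD (simple_integral A (g n)) (bochner A f) (simple_integral A s); lra.
Unshelve. all: by end_near. Qed.

Lemma norm_small_eq (x y : Y) : (forall e, 0 < e -> `|x - y| <= e) -> x = y.
Proof.
move=> h; apply/eqP; rewrite -subr_eq0 -normr_le0; apply/ler_addgt0Pr => e e0.
by rewrite add0r; exact: h.
Qed.

(** The integral is identified by simple approximants alone; every identity
    below is checked on simple functions and transferred by this lemma. *)
Lemma bochner_char f I : ap A f -> (forall e, 0 < e -> exists s : R -> Y,
   [/\ finite_measurable s, upper_le A (fun t => `|s t - f t|) e &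
       `|simple_integral A s - I| <= e]) -> bochner A f = I.
Proof.
move=> fa h; apply: norm_small_eq => e e0.
have e20 : 0 < e / 2 by rewrite divr_gt0.
have [s [fs sf sI]] := h _ e20.
have := bochner_simple_dist fa fs sf.
have := ler_distD (simple_integral A s) (bochner A f) I; lra.
Qed.

Lemma bochnerD f g : ap A f -> ap A g ->
  bochner A (fun t => f t + g t) = bochner A f + bochner A g.
Proof.
move=> fa ga; apply: bochner_char; first exact: approximableD.
move=> e e0; have e20 : 0 < e / 2 by rewrite divr_gt0.
have [s /simple_finite_measurable ss sf] := fa _ e20.
have [s' /simple_finite_measurable ss' sg] := ga _ e20.
exists (fun t => s t + s' t); split.
- exact: (finite_measurable_comp (fun z => z.1 + z.2) (finite_measurable_pair ss ss')).
- rewrite (splitr e); apply: upper_le_le (upper_leD mA sf sg) => t _.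
  by rewrite opprD addrACA; exact: ler_normD.
- rewrite simple_integralD// opprD addrACA.
  apply: le_trans (ler_normD _ _) _; rewrite (splitr e).
  apply: lerD; rewrite distrC. exact: bochner_simple_dist fa ss sf. exact: bochner_simple_dist ga ss' sg.
Qed.

Lemma linear_sub (L : Y -> Y) : linear L -> forall x y, L (x - y) = L x - L y.
Proof. by move=> lL x y; rewrite addrC -scaleN1r lL scaleN1r addrC. Qed.

Lemma linear_zero (L : Y -> Y) : linear L -> L 0 = 0.
Proof. by move=> lL; rewrite -[X in L X](subrr (0 : Y)) linear_sub// subrr. Qed.

Lemma linear_scale (L : Y -> Y) : linear L -> forall a x, L (a *: x) = a *: L x.
Proof. by move=> lL a x; rewrite -[a *: x]addr0 lL linear_zero// addr0. Qed.

Lemma simple_integral_map (L : Y -> Y) s : linear L -> finite_measurable s ->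
  simple_integral A (L \o s) = L (simple_integral A s).
Proof.
move=> lL fs; rewrite (simple_integral_comp L mA finA fs).
have -> := simple_integral_comp id mA finA fs.
have finr : finite_set (range s) := proj1 fs.
rewrite !fsbig_finite//=.
pose l : {linear Y -> Y} := HB.pack L (GRing.isLinear.Build _ _ _ _ L lL).
rewrite -[L _]/(l _) linear_sum; apply: eq_bigr => z _.
by rewrite linearZ.
Qed.

Lemma bochner_map (L : Y -> Y) M f : 0 <= M -> linear L ->
  (forall y, `|L y| <= M * `|y|) -> ap A f ->
  bochner A (L \o f) = L (bochner A f).
Proof.
move=> M0 lL bL fa; apply: bochner_char; first exact: approximable_linear bL fa.
move=> e e0; have eM : 0 < e / (M + 1) by rewrite divr_gt0// ltr_wpDl.
have Me : M * (e / (M + 1)) <= e.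
  rewrite mulrA ler_pdivrMr ?ltr_wpDl// mulrDr mulr1 mulrC lerDl; exact: ltW.
have [s /simple_finite_measurable fs sf] := fa _ eM.
exists (L \o s); split.
- exact: finite_measurable_comp.
- apply: upper_leW (upper_leZ mA M0 sf) => //.
  by apply: aeW => t _ /=; rewrite -linear_sub.
- rewrite simple_integral_map// -linear_sub//; apply: le_trans (bL _) _.
  apply: le_trans Me; apply: ler_wpM2l => //; rewrite distrC.
  exact: bochner_simple_dist.
Qed.

Lemma approximableZ a f : ap A f -> ap A (fun t => a *: f t).
Proof.
move=> fa; apply: (@approximable_linear _ _ _ f (fun y => a *: y) `|a|) => //.
- by move=> c x y; rewrite scalerDr !scalerA mulrC.
- by move=> y; rewrite normrZ.
Qed.

Lemma bochnerZ a f : ap A f -> bochner A (fun t => a *: f t) = a *: bochner A f.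
Proof.
move=> fa; apply: (@bochner_map (fun y => a *: y) `|a| f) => //.
- by move=> c x y; rewrite scalerDr !scalerA mulrC.
- by move=> y; rewrite normrZ.
Qed.

Lemma approximableN f : ap A f -> ap A (fun t => - f t).
Proof.
by move=> fa; under eq_fun do rewrite -scaleN1r; exact: approximableZ.
Qed.

Lemma approximableB f g : ap A f -> ap A g -> ap A (fun t => f t - g t).
Proof. by move=> fa ga; apply: approximableD => //; exact: approximableN. Qed.

Lemma bochnerB f g : ap A f -> ap A g ->
  bochner A (fun t => f t - g t) = bochner A f - bochner A g.
Proof.
move=> fa ga; rewrite bochnerD//; last exact: approximableN.
by under eq_fun do rewrite -scaleN1r; rewrite bochnerZ// scaleN1r.
Qed.

Lemma bochner_ae f g : {ae mu, forall t, A t -> f t = g t} -> ap A f ->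
  bochner A f = bochner A g.
Proof.
move=> fg fa; have ga := approximable_ae fg fa.
apply: norm_small_eq => e e0; rewrite -bochnerB//; apply: bochner_bound => //.
  exact: approximableB.
exists (fun=> 0%E); split => //.
- by apply: ae_imply fg => t h At; rewrite h// subrr normr0.
- by rewrite integral0 lee_fin ltW.
Qed.

Lemma bochner_dist f g c : ap A f -> ap A g -> upper_le A (fun t => `|f t - g t|) c ->
  `|bochner A f - bochner A g| <= c.
Proof.
by move=> fa ga h; rewrite -bochnerB//; apply: bochner_bound => //; exact: approximableB.
Qed.

(** [approximable] is not visibly stable under products; boundedness of [h] and
    the description as L^1 functions give it. *)
Lemma approximable_mulr (h : R -> R) M f : measurable_fun [set: R] h ->
  (forall t, `|h t| <= M) -> ap A f -> ap A (fun t => h t *: f t).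
Proof.
move=> mh hM fa.
have M0 : 0 <= M by apply: le_trans (hM 0).
have [c hc] := approximable_upper_bound mA finA fa.
apply: in_L1_approximable => //; split; last first.
  apply: (@le_lt_trans _ _ (M * c)%:E); last exact: ltry.
  apply: integral_le_upper => //; apply: upper_le_le (upper_leZ mA M0 hc) => t _.
  by rewrite normrZ; exact: ler_wpM2r.
have [g [sg hg]] : strongly_measurable setT Num.norm A f.
  by apply: approximable_strongly_measurable => //; exact: aeW.
have mEh : measurable_fun [set: R] (EFin \o h) by exact/measurable_EFinP.
have [q hq] := approximation_sfun measurableT mEh.
exists (fun n t => q n t *: g n t); split => [n|].
  apply: finite_measurable_simple.
  have fq : finite_measurable (q n) by split => // z; have := measurable_funPTI (q n) (measurable_set1 z).
  exact: (finite_measurable_comp (fun z => z.1 *: z.2)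
    (finite_measurable_pair fq (simple_finite_measurable (sg n)))).
apply: ae_imply hg => t hgt At; have [_ {}hgt] := hgt At; split => //.
have gt : g ^~ t @ \oo --> f t.
  apply/cvgrPdist_le => /= d d0; move/cvgrPdist_le : hgt => /(_ _ d0).
  by apply: filterS => n /=; rewrite sub0r normrN normr_id distrC.
have qt : q ^~ t @ \oo --> h t by move: (hq t I) => /fine_cvgP[].
have : (q n t *: g n t - h t *: f t) @[n --> \oo] --> h t *: f t - h t *: f t.
  by apply: cvgB; [exact: cvgZ|exact: cvg_cst].
by rewrite subrr => /cvg_norm; rewrite normr0.
Qed.

End fixed_set.


Lemma simple_integral_patch (A B : set TR) s : measurable A -> measurable B ->
  A `<=` B -> (mu B < +oo)%E -> finite_measurable s ->
  simple_integral B (fun t => if t \in A then s t else (0 : Y)) = simple_integral A s.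
Proof.
move=> mA mB AB finB fs.
have finA : (mu A < +oo)%E by apply: le_lt_trans finB; apply: le_measure; rewrite ?inE.
have fP := finite_measurable_patch (0 : Y) mA fs.
have finr : finite_set (range s `|` [set 0]) by rewrite finite_setU; split => //; exact: (proj1 fs).
rewrite /simple_integral (fsbig_widen _ (range s `|` [set 0]))//=; last 2 first.
- by move=> _ [t _ <-]; case: ifPn => _; [left; exists t|right].
- move=> y [_ /= yn]; rewrite (_ : B `&` _ = set0) ?measure0 ?scale0r//.
  by apply/seteqP; split => // t [_ /= ty]; apply: yn; exists t.
rewrite [RHS](fsbig_widen _ (range s `|` [set 0]))//=; last first.
- move=> y [_ /= yn]; rewrite (_ : A `&` _ = set0) ?measure0 ?scale0r//.
  by apply/seteqP; split => // t [_ /= ty]; apply: yn; exists t.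
apply: eq_fsbigr => y _; have [->|y0] := eqVneq y 0; first by rewrite !scaler0.
congr (fine (mu _) *: _); apply/seteqP; split => t /= [].
  by move=> _; case: ifPn => [/set_mem //|_ y0']; rewrite -y0' eqxx in y0.
by move=> At <-; split; [exact: AB|rewrite mem_set].
Qed.

Lemma bochner_patch (A B : set TR) f : measurable A -> measurable B ->
  A `<=` B -> (mu B < +oo)%E -> ap A f ->
  bochner B (fun t => if t \in A then f t else 0) = bochner A f.
Proof.
move=> mA mB AB finB fa.
have finA : (mu A < +oo)%E by apply: le_lt_trans finB; apply: le_measure; rewrite ?inE.
have fpa : ap B (fun t => if t \in A then f t else 0).
  by apply: (@approximable_patch _ _ B A A) => // t [].
apply: bochner_char => // e e0; have [s /simple_finite_measurable fs sf] := fa _ e0.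
exists (fun t => if t \in A then s t else 0); split.
- exact: finite_measurable_patch.
- have [k [mk k0 hk kc]] := sf.
  exists (k \_ A); split => //.
  + by apply/(measurable_restrictT _ _).1; [|exact: measurable_funTS].
  + by move=> t; apply: erestrict_ge0 => *; exact: k0.
  + apply: ae_imply hk => t h Bt; rewrite patchE; case: ifPn => /= [/set_mem tA|tA].
      by apply: h.
    by rewrite subrr normr0.
  + by rewrite -integral_mkcondr setIidr.
- by rewrite simple_integral_patch// distrC; exact: bochner_simple_dist.
Qed.

Lemma bochner_cst (A : set TR) (y : Y) : measurable A -> (mu A < +oo)%E ->
  bochner A (fun=> y) = fine (mu A) *: y.
Proof.
move=> mA finA.
have fc : finite_measurable (fun _ : R => y).
  split; first by apply: (sub_finite_set _ (finite_set1 y)) => _ [_ _ <-].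
  move=> z; have [->|zy] := eqVneq z y.
    by rewrite (_ : _ @^-1` _ = setT)//; apply/seteqP; split.
  rewrite (_ : _ @^-1` _ = set0)//; apply/seteqP; split => // t /= yz.
  by rewrite yz eqxx in zy.
have ca : ap A (fun=> y) by apply: simple_approximable; exact: finite_measurable_simple.
apply: bochner_char => // e e0; exists (fun=> y); split => //.
- exists (fun=> 0%E); split => //.
  + by apply: aeW => t _; rewrite subrr normr0.
  + by rewrite integral0 lee_fin ltW.
- rewrite /simple_integral (fsbig_widen _ [set y])//=; last 2 first.
  + by move=> _ [_ _ <-].
  + move=> z [_ /= yn]; rewrite (_ : A `&` _ = set0) ?measure0 ?scale0r//.
    by apply/seteqP; split => // t [_ /= ty]; apply: yn; exists t.
  rewrite fsbig_set1 (_ : A `&` _ = A) ?subrr ?normr0 ?ltW//.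
  by apply/seteqP; split => t // [].
Qed.

End bochner_calculus.

(** * Derivatives and continuity of functions of time *)

Section time_derivative.
Context {R : realType}.

(** Differentiability of a Banach space valued function with derivative [y],
    written as an estimate so that increments can be compared directly with those
    of integrals. *)
Definition tderive {Y : completeNormedModType R} (u : R -> Y) t y :=
  forall e, 0 < e -> exists2 d, 0 < d &
    forall r, `|r - t| < d -> `|u r - u t - (r - t) *: y| <= e * `|r - t|.

(** Continuity at [t] of the restriction of [u] to [D]; the time intervals in
    use are half open, so the relative form is needed at their endpoints. *)
Definition tcont {Y : completeNormedModType R} (D : set R) (u : R -> Y) t :=
  forall e, 0 < e -> exists2 d, 0 < d &
    forall r, D r -> `|r - t| < d -> `|u r - u t| <= e.

Section basics.
Context {Y : completeNormedModType R}.
Implicit Types (u v : R -> Y).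

Lemma tcont_within (D : set R) u : {within D, continuous u} <->
  (forall t, D t -> tcont D u t).
Proof.
rewrite subspace_continuousP; split => h t Dt.
  move=> e e0; have /cvgrPdist_le/(_ _ e0) := h t Dt.
  rewrite near_withinE => /nbhs_ballP[d /= d0 hd]; exists d => // r Dr rt.
  by rewrite distrC; apply: hd => //; rewrite /ball/= distrC.
apply/cvgrPdist_le => /= e e0; have [d d0 hd] := h t Dt _ e0.
rewrite near_withinE; apply/nbhs_ballP; exists d => //= r rt Dr.
by rewrite distrC; apply: hd => //; rewrite distrC.
Qed.

Lemma tcontS (D D' : set R) u t : D `<=` D' -> tcont D' u t -> tcont D u t.
Proof.
move=> DD' h e e0; have [d d0 hd] := h _ e0; exists d => // r Dr; exact/hd/DD'.
Qed.

Lemma tderive_tcont D u t y : tderive u t y -> tcont D u t.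
Proof.
move=> h e e0; have [d d0 hd] := h _ ltr01.
exists (Num.min d (e / (1 + `|y|))).
  by rewrite lt_min d0/= divr_gt0// ltr_wpDr.
move=> r _; rewrite lt_min => /andP[/hd h1 h2].
have : `|u r - u t| <= `|r - t| * (1 + `|y|).
  have := ler_normD (u r - u t - (r - t) *: y) ((r - t) *: y).
  by rewrite subrK normrZ; move: h1; rewrite mul1r mulrDr mulr1; lra.
move/le_trans; apply; move: h2; rewrite ltr_pdivlMr ?ltr_wpDr//; exact: ltW.
Qed.

Lemma tderive_local u v t y d : 0 < d -> (forall r, `|r - t| < d -> u r = v r) ->
  tderive u t y -> tderive v t y.
Proof.
move=> d0 uv h e e0; have [d' d'0 hd] := h _ e0.
exists (Num.min d d'); first by rewrite lt_min d0.
move=> r; rewrite lt_min => /andP[r1 r2].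
by rewrite -!uv ?subrr ?normr0//; exact: hd.
Qed.

Lemma tderiveD u v t y z : tderive u t y -> tderive v t z ->
  tderive (fun r => u r + v r) t (y + z).
Proof.
move=> hu hv e e0; have e20 : 0 < e / 2 by rewrite divr_gt0.
have [d d0 hd] := hu _ e20; have [d' d'0 hd'] := hv _ e20.
exists (Num.min d d'); first by rewrite lt_min d0.
move=> r; rewrite lt_min => /andP[/hd r1 /hd' r2].
have -> : u r + v r - (u t + v t) - (r - t) *: (y + z) =
  (u r - u t - (r - t) *: y) + (v r - v t - (r - t) *: z).
  by rewrite scalerDr !opprD (addrACA (u r)) (addrACA (u r - u t)).
by apply: le_trans (ler_normD _ _) _; rewrite [in leRHS](splitr e) mulrDl lerD.
Qed.

Lemma tderive_map (L : Y -> Y) M u t y : linear L -> 0 <= M ->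
  (forall y, `|L y| <= M * `|y|) -> tderive u t y -> tderive (L \o u) t (L y).
Proof.
move=> lL M0 bL hu e e0; have eM : 0 < e / (M + 1) by rewrite divr_gt0// ltr_wpDl.
have Me : M * (e / (M + 1)) <= e.
  rewrite mulrA ler_pdivrMr ?ltr_wpDl// mulrDr mulr1 mulrC lerDl; exact: ltW.
have [d d0 hd] := hu _ eM; exists d => // r /hd h /=.
rewrite -(linear_scale lL) -!(linear_sub lL).
apply: le_trans (bL _) _; apply: le_trans (ler_wpM2l M0 h) _.
by rewrite mulrA; apply: ler_wpM2r.
Qed.

Lemma tderiveZ a u t y : tderive u t y -> tderive (fun r => a *: u r) t (a *: y).
Proof.
apply: (@tderive_map (fun y => a *: y) `|a|) => //.
- by move=> c x z; rewrite scalerDr !scalerA mulrC.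
- by move=> z; rewrite normrZ.
Qed.

Lemma tderiveB u v t y z : tderive u t y -> tderive v t z ->
  tderive (fun r => u r - v r) t (y - z).
Proof.
move=> hu /(tderiveZ (-1)) hv; have := tderiveD hu hv; rewrite scaleN1r.
by under eq_fun do rewrite scaleN1r.
Qed.

Lemma tderive_cst (y : Y) t : tderive (fun=> y) t 0.
Proof.
by move=> e e0; exists 1 => // r _; rewrite subrr scaler0 subr0 normr0 mulr_ge0// ltW.
Qed.

Lemma tderive_shift u t a y : tderive u (t - a) y -> tderive (fun r => u (r - a)) t y.
Proof.
move=> h e e0; have [d d0 hd] := h _ e0; exists d => // r rt.
have := hd (r - a); rewrite (_ : r - a - (t - a) = r - t); last by ring.
exact.
Qed.

Lemma product_increment (p q s t' : R) (a b y : Y) :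
  p *: a - q *: b - s *: (t' *: b + q *: y) =
  p *: (a - b - s *: y) + (p - q) *: (s *: y) + (p - q - s * t') *: b.
Proof.
rewrite !scalerBr scalerDr !scalerBl !scalerA (mulrC s q).
have -> // : forall A B C D E F : Y, (A-B-C)+(C-F)+(B-D-E)=A-D-(E+F).
move=> A B C D E F; rewrite [(A-B-C)+(C-F)]addrA subrK (addrAC A) opprD !addrA subrK.
by rewrite (addrAC A) (addrAC (A - D)).
Qed.

Lemma tderive_mul (phi : R -> R) dphi u t y :
  is_derive t (1 : R) phi dphi -> tderive u t y ->
  tderive (fun r => phi r *: u r) t (dphi *: u t + phi t *: y).
Proof.
move=> [dp vp] hu e e0.
have hphi : forall e, 0 < e -> exists2 d, 0 < d & forall r, `|r - t| < d ->
    `|phi r - phi t - (r - t) * dphi| <= e * `|r - t|.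
  move=> d d0.
  have := dp; rewrite /derivable => /cvg_ex[/= l hl].
  have ldphi : l = dphi.
    by rewrite -vp /derive; apply/esym/cvg_lim => //; exact: hl.
  rewrite {}ldphi in hl; move/cvgrPdist_le : hl => /(_ _ d0).
  rewrite near_withinE => /nbhs_ballP[c /= c0 hc]; exists c => // r rt.
  have [->|rt0] := eqVneq r t; first by rewrite !subrr mul0r subr0 normr0 mulr0.
  have rt1 : r - t != 0 by rewrite subr_eq0.
  have := hc (r - t); rewrite /ball/= sub0r normrN => /(_ rt rt1).
  rewrite scaler1 subrK -[_ *: _]/(_ * _) => h.
  have -> : phi r - phi t - (r - t) * dphi =
    - (r - t) * (dphi - (r - t)^-1 * (phi r - phi t)) by field.
  by rewrite normrM normrN mulrC; apply: ler_wpM2r.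
set K := 1 + `|phi t| + `|y| + `|u t|.
have K0 : 0 < K by rewrite /K -!addrA ltr_wpDr// !addr_ge0.
have e10 : 0 < e / K by rewrite divr_gt0.
have [d1 d10 h1] := hphi _ ltr01; have [d2 d20 h2] := hphi _ e10.
have [d3 d30 h3] := hu _ e10.
have dp0 : 0 < 1 + `|dphi| by rewrite ltr_wpDr.
exists (Num.min (Num.min d1 d2) (Num.min d3 (Num.min 1 (e / K) / (1 + `|dphi|)))).
  by rewrite !lt_min d10 d20 d30/= divr_gt0// lt_min ltr01.
move=> r; rewrite !lt_min -andbA => /and4P[/h1 {}h1 /h2 {}h2 /h3 {}h3].
rewrite ltr_pdivlMr// lt_min => /andP[s1 s2].
have ph : `|phi r - phi t| <= `|r - t| * (1 + `|dphi|).
  have := ler_normD (phi r - phi t - (r - t) * dphi) ((r - t) * dphi).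
  by rewrite subrK normrM; move: h1; rewrite mul1r mulrDr mulr1; lra.
have pr : `|phi r| <= 1 + `|phi t|.
  have := ler_normD (phi r - phi t) (phi t); rewrite subrK; lra.
have -> : phi r *: u r - phi t *: u t - (r - t) *: (dphi *: u t + phi t *: y) =
  phi r *: (u r - u t - (r - t) *: y) + (phi r - phi t) *: ((r - t) *: y) +
  (phi r - phi t - (r - t) * dphi) *: u t.
  exact: product_increment.
apply: le_trans (ler_normD _ _) _; rewrite !normrZ.
apply: (@le_trans _ _ ((1 + `|phi t|) * (e / K * `|r - t|) +
    e / K * (`|r - t| * `|y|) + (e / K * `|r - t|) * `|u t|)).
  apply: lerD; last exact: ler_wpM2r.
  apply: le_trans (ler_normD _ _) _; rewrite !normrZ.
  apply: lerD; first exact: ler_pM.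
  by apply: ler_wpM2r; [exact: mulr_ge0|lra].
by rewrite le_eqVlt; apply/orP; left; apply/eqP; rewrite /K; field; exact: lt0r_neq0.
Qed.

(** Reduction to real functions: [r |-> `|u r - u c|] has derivative 0, hence is
    constant and equal to 0. *)
Lemma zero_derive u c d : c <= d -> (forall t, c < t < d -> tderive u t 0) ->
  (forall t, c <= t <= d -> tcont [set r | c <= r <= d] u t) -> u c = u d.
Proof.
move=> cd hd hc; pose g r := `|u r - u c|.
have dg t : t \in `]c, d[ -> is_derive t (1 : R) g 0.
  rewrite in_itv/= => tcd.
  have gl : (h^-1 *: ((g \o shift t) (h *: (1 : R)) - g t)) @[h --> 0^'] --> (0 : R).
    apply/cvgrPdist_le => /= e e0; have [b b0 hb] := hd t tcd _ e0.
    rewrite near_withinE; apply/nbhs_ballP; exists b => //= h; rewrite /ball/= sub0r normrN => hlt h0.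
    rewrite sub0r normrN -[_ *: _]/(_ * _) -[h *: _]/(h * 1) mulr1 normrM normfV.
    rewrite ler_pdivrMl ?normr_gt0// mulrC.
    have := hb (h + t); rewrite addrK => /(_ hlt); rewrite scaler0 subr0.
    apply: le_trans; rewrite /g; apply: le_trans (ler_dist_dist _ _) _.
    by rewrite opprB addrA subrK.
  have dd : derivable g t 1 by apply/cvg_ex; exists 0.
  by split => //; apply/cvg_lim.
have cg : {within `[c, d], continuous g}.
  apply/subspace_continuousP => t; rewrite /= in_itv/= => tcd.
  apply/cvgrPdist_le => /= e e0; have [b b0 hb] := hc t tcd _ e0.
  rewrite near_withinE; apply/nbhs_ballP; exists b => //= r rt; rewrite in_itv/= => rcd.
  rewrite /g; apply: le_trans (ler_dist_dist _ _) _.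
  by rewrite opprB addrA subrK distrC; apply: hb => //; rewrite distrC.
have [b _] := MVT_segment cd dg cg.
rewrite mul0r /g subrr normr0 subr0 => /eqP; rewrite normr_eq0 subr_eq0 => /eqP //.
Qed.

End basics.
End time_derivative.

(** * Primitives and the fundamental theorem of calculus *)

Section primitive.
Context {R : realType}.
Local Notation mu := (@lebesgue_measure R).
Local Notation TR := (measurableTypeR R).
Context {Y : completeNormedModType R}.
Implicit Types (k u : R -> Y).
Local Notation ap := (@approximable R Y setT Num.norm).

Definition oi (tau : R) : set TR := [set r | 0 < r < tau].

Lemma oiE tau : oi tau = `]0, tau[%classic :> set R.
Proof. by apply/seteqP; split => r; rewrite /oi /= in_itv. Qed.

Lemma measurable_oi tau : measurable (oi tau).
Proof. by rewrite oiE; exact: measurable_itv. Qed.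

Lemma measure_oi tau : 0 <= tau -> mu (oi tau) = tau%:E.
Proof.
by rewrite oiE lebesgue_measure_itv/= lte_fin le_eqVlt => /predU1P[<-|->]; rewrite ?ltxx ?oppr0 ?adde0.
Qed.

Lemma finite_oi tau : (mu (oi tau) < +oo)%E.
Proof.
have [t0|t0] := leP 0 tau; first by rewrite measure_oi// ltry.
rewrite oiE lebesgue_measure_itv/= lte_fin; case: ifPn => [h|_]; last exact: ltry.
by move: (lt_trans h t0); rewrite ltxx.
Qed.

Lemma subset_oi t t' : t <= t' -> oi t `<=` oi t'.
Proof. by move=> tt' r /andP[r0 rt]; apply/andP; split => //; exact: lt_le_trans tt'. Qed.

Hint Resolve measurable_oi finite_oi : core.

Definition primitive k t : Y := bochner (oi t) k.

Lemma approximable_oi t t' k : t <= t' -> ap (oi t') k -> ap (oi t) k.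
Proof. by move=> tt'; apply: approximableS => //; exact: subset_oi. Qed.

Lemma approximable0 k t : t <= 0 -> ap (oi t) k.
Proof.
move=> t0 e e0; exists (fun=> 0).
  split => //.
    by apply: (sub_finite_set _ (finite_set1 0)) => _ [_ _ <-].
  move=> z; have [->|zy] := eqVneq z 0.
    by rewrite (_ : _ @^-1` _ = setT)//; apply/seteqP; split.
  rewrite (_ : _ @^-1` _ = set0)//; apply/seteqP; split => // r /= yz.
  by rewrite yz eqxx in zy.
exists (fun=> 0%E); split => //.
- by apply: aeW => r /andP[r0 rt]; move: (lt_le_trans (lt_trans r0 rt) t0); rewrite ltxx.
- by rewrite integral0 lee_fin ltW.
Qed.

Lemma upper_le_cst (A : set TR) c : measurable A -> (mu A < +oo)%E -> 0 <= c ->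
  upper_le A (fun=> c) (c * fine (mu A)).
Proof.
move=> mA finA c0; exists (fun=> c%:E); split => //; first exact: aeW.
by rewrite integral_cst// EFinM fineK// ge0_fin_numE.
Qed.

Lemma primitive0 k : primitive k 0 = 0.
Proof.
apply/eqP; rewrite -normr_le0.
suff : `|primitive k 0| <= 0 * fine (mu (oi 0)) by rewrite mul0r.
apply: (bochner_bound _ _ (approximable0 k (lexx 0))) => //.
apply: upper_le_le (upper_le_cst (measurable_oi 0) (finite_oi 0) (lexx 0)) => r /andP[r0 rt].
by move: (lt_trans r0 rt); rewrite ltxx.
Qed.

(** The increment is the integral over [t, t'); comparing it with that of the
    constant [y] gives differentiability of primitives at points of continuity as
    well as their Lipschitz bounds. *)
Lemma primitive_increment k t t' e y : 0 <= t -> t <= t' -> 0 <= e -> ap (oi t') k ->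
  (forall r, t <= r -> 0 < r -> r < t' -> `|k r - y| <= e) ->
  `|primitive k t' - primitive k t - (t' - t) *: y| <= e * (t' - t).
Proof.
move=> t0 tt' e0 ka hk.
have t'0 : 0 <= t' by exact: le_trans tt'.
pose D : set TR := `[t, t'[%classic `&` oi t'.
have mD : measurable D by apply: measurableI => //; exact: measurable_itv.
have DO : D `<=` oi t' by move=> r [].
have muD : mu D = (t' - t)%:E.
  have /orP[/eqP t00|t00] : (0 == t) || (0 < t) by rewrite -le_eqVlt.
    have -> : D = oi t'.
      apply/seteqP; split => // r rr; split => //.
      by move: rr => /andP[r0 rt]; rewrite /= in_itv/= -t00 ltW.
    by rewrite measure_oi// -t00 subr0.
  have -> : D = `[t, t'[%classic.
    apply/seteqP; split => [r []//|r rr]; split => //.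
    by move: rr; rewrite /oi/= in_itv/= => /andP[tr ->]; rewrite (lt_le_trans t00 tr).
  rewrite lebesgue_measure_itv/= lte_fin; case: ifPn => // /negbTE h.
  by move: tt'; rewrite le_eqVlt h orbF => /eqP ->; rewrite subrr.
have finD : (mu D < +oo)%E by rewrite muD ltry.
have ka' := approximable_oi tt' ka.
have kD : ap (oi t') (fun r => if r \in oi t then k r else 0).
  by apply: (@approximable_patch _ _ (oi t') (oi t) (oi t)) => // r [].
have yD : ap (oi t') (fun r => if r \in D then y else 0).
  apply: (@approximable_patch _ _ (oi t') (oi t') D (fun=> y)) => //.
  apply: simple_approximable; split => //.
    by apply: (sub_finite_set _ (finite_set1 y)) => _ [_ _ <-].
  move=> z; have [->|zy] := eqVneq z y.
    by rewrite (_ : _ @^-1` _ = setT)//; apply/seteqP; split.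
  rewrite (_ : _ @^-1` _ = set0)//; apply/seteqP; split => // r /= yz.
  by rewrite yz eqxx in zy.
have kDb : bochner (oi t') (fun r => if r \in oi t then k r else 0) = primitive k t.
  by apply: bochner_patch => //; exact: subset_oi.
have yDb : bochner (oi t') (fun r => if r \in D then y else 0) = (t' - t) *: y.
  rewrite bochner_patch//; last first.
    by have := approximableS mD (measurable_oi t') DO yD; apply: approximable_ae; apply: aeW => r rD; rewrite mem_set.
  by rewrite bochner_cst// muD.
rewrite -kDb -yDb /primitive -!bochnerB//; last exact: approximableB.
apply: bochner_bound => //; first by do 2 apply: approximableB => //.
exists (fun r => (e * \1_D r)%:E); split => //.
- by apply/measurable_EFinP; apply: measurable_funM => //; exact: measurable_indic.
- by move=> r; rewrite lee_fin mulr_ge0.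
- apply: aeW => r /[dup] ro /andP[r0 rt]; rewrite lee_fin.
  have [tr|rt'] := leP t r.
    have rD : D r by split => //=; rewrite in_itv/= tr.
    rewrite indicE (mem_set rD) mulr1 memNset ?subr0; first exact: hk.
    by move=> /andP[_]; rewrite ltNge tr.
  rewrite mem_set; last by apply/andP; split.
  rewrite subrr sub0r memNset ?oppr0 ?normr0 ?mulr_ge0//.
  by move=> [/=]; rewrite in_itv/= => /andP[]; rewrite leNgt rt'.
- under eq_integral => r _ do rewrite EFinM.
  rewrite ge0_integralZl//; last by apply/measurable_EFinP; exact: measurable_indic.
  by rewrite integral_indic// setIidl// [X in (_ * X)%E]muD.
Qed.

Lemma tderive_primitive k t tau : 0 < t < tau -> ap (oi tau) k -> tcont (oi tau) k t ->
  tderive (primitive k) t (k t).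
Proof.
move=> /andP[t0 tt] ka ck e e0; have [d d0 hd] := ck _ e0.
exists (Num.min d (Num.min t (tau - t))); first by rewrite !lt_min d0 t0 subr_gt0.
move=> r; rewrite !lt_min => /and3P[rd r1 r2].
have r0 : 0 < r by move: r1; rewrite ltr_norml; lra.
have rtau : r < tau by move: r2; rewrite ltr_norml; lra.
have [tr|/ltW rt] := leP t r.
  rewrite [`|r - t|]ger0_norm ?subr_ge0//; apply: primitive_increment => //; [exact: ltW|exact: ltW| |].
    by apply: approximable_oi ka; exact: ltW.
  move=> x tx x0 xr; apply: hd; first by apply/andP; split => //; exact: lt_trans rtau.
  by apply: le_lt_trans rd; rewrite !ger0_norm ?subr_ge0//; lra.
have -> : primitive k r - primitive k t - (r - t) *: k t =
    - (primitive k t - primitive k r - (t - r) *: k t).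
  by rewrite !opprB -(opprB t r) scaleNr addrC opprK.
rewrite normrN (distrC r t) [`|t - r|]ger0_norm ?subr_ge0//; apply: primitive_increment => //; [exact: ltW|exact: ltW| |].
  by apply: approximable_oi ka; exact: ltW.
move=> x rx x0 xt; apply: hd; first by apply/andP; split => //; exact: lt_trans tt.
by apply: le_lt_trans rd; rewrite distrC (distrC r) !ger0_norm ?subr_ge0//; lra.
Qed.

Lemma tcont_primitive k t tau : 0 <= t < tau -> ap (oi tau) k ->
  (exists M d, 0 < d /\ forall r, 0 < r < tau -> `|r - t| < d -> `|k r| <= M) ->
  tcont [set r | 0 <= r < tau] (primitive k) t.
Proof.
move=> /andP[t0 tt] ka [M [d [d0 hM]]] e e0.
pose M1 := `|M| + 1; have M10 : 0 < M1 by rewrite ltr_wpDl.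
exists (Num.min d (e / M1)); first by rewrite lt_min d0 divr_gt0.
move=> r /andP[r0 rtau]; rewrite lt_min ltr_pdivlMr// => /andP[rd re].
have H a b : 0 <= a -> a <= b -> b < tau -> (forall x, a <= x -> x <= b -> `|x - t| < d) ->
    `|primitive k b - primitive k a| <= M1 * (b - a).
  move=> a0 ab bt hx; have := @primitive_increment k a b M1 0 a0 ab (ltW M10).
  rewrite scaler0 subr0; apply; first by apply: approximable_oi ka; exact: ltW.
  move=> x ax x0 xb; rewrite subr0 /M1; apply: le_trans (hM x _ _) _.
  - by rewrite x0; exact: lt_trans bt.
  - by apply: hx => //; exact: ltW.
  - by apply: le_trans (ler_norm _) _; rewrite lerDl.
apply: le_trans (ltW re); rewrite mulrC.
have [tr|/ltW rt] := leP t r.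
  rewrite [`|r - t|]ger0_norm ?subr_ge0//; apply: H => // x tx xr.
  by apply: le_lt_trans rd; rewrite !ger0_norm ?subr_ge0// lerB.
rewrite distrC (distrC r) [`|t - r|]ger0_norm ?subr_ge0//; apply: H => // x tx xr.
by apply: le_lt_trans rd; rewrite distrC (distrC r) !ger0_norm ?subr_ge0// lerB.
Qed.

(** [U - primitive k] is continuous with derivative 0 on both sides of the
    exceptional time [a], hence constant.  One exceptional time suffices for
    functions with a single jump. *)
Lemma ftc tau a k U : ap (oi tau) k ->
  (forall t, 0 <= t < tau ->
     exists M d, 0 < d /\ forall r, 0 < r < tau -> `|r - t| < d -> `|k r| <= M) ->
  (forall t, 0 < t < tau -> t != a -> tcont (oi tau) k t /\ tderive U t (k t)) ->
  (forall t, 0 <= t < tau -> tcont [set r | 0 <= r < tau] U t) ->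
  forall t, 0 <= t < tau -> U t = U 0 + primitive k t.
Proof.
move=> ka lb dU cU.
pose V r := U r - primitive k r.
have cV t : 0 <= t < tau -> tcont [set r | 0 <= r < tau] V t.
  move=> tt e e0; have e20 : 0 < e / 2 by rewrite divr_gt0.
  have [d d0 hd] := cU t tt _ e20; have [d' d'0 hd'] := tcont_primitive tt ka (lb t tt) e20.
  exists (Num.min d d'); first by rewrite lt_min d0.
  move=> r rr; rewrite lt_min => /andP[/(hd _ rr) h1 /(hd' _ rr) h2].
  have -> : V r - V t = (U r - U t) - (primitive k r - primitive k t).
    by rewrite /V !opprB addrACA [RHS]addrACA; congr (_ + _); rewrite addrC.
  rewrite (splitr e); apply: le_trans (ler_normB _ _) _; exact: lerD.
have dV t : 0 < t < tau -> t != a -> tderive V t 0.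
  move=> tt ta; have [ck du] := dU t tt ta.
  by rewrite -(subrr (k t)); apply: tderiveB => //; exact: (tderive_primitive tt ka).
have H b c : 0 <= b -> b <= c -> c < tau -> ~ (b < a < c) -> V b = V c.
  move=> b0 bc ct nac; apply: zero_derive => // t /andP[bt tc].
    apply: dV; first by apply/andP; split; lra.
    by apply/negP => /eqP ta; apply: nac; rewrite -ta bt.
  apply: tcontS (cV t _) => [r /= /andP[br rc]|]; apply/andP; split; lra.
move=> t /andP[t0 tt]; have VU : V 0 = U 0 by rewrite /V primitive0 subr0.
suff : V 0 = V t by rewrite VU /V => ->; rewrite subrK.
have [/andP[a0 at_]|] := boolP (0 < a < t); last by move=> /negP; exact: H.
transitivity (V a); apply: H => //; try lra; by rewrite ltxx ?andbF.
Qed.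

(** Index of the cell of the uniform grid of mesh [1 / n.+1] that contains [r];
    the value outside (0, tau) only has to keep the range finite. *)
Definition grid tau n (r : R) : nat :=
  if r \in oi tau then Num.truncn (r * n.+1%:R) else 0%N.

Lemma finite_measurable_grid tau n : finite_measurable (grid tau n).
Proof.
split.
  apply: (sub_finite_set _ (finite_II (Num.truncn (tau * n.+1%:R)).+1)) => _ [r _ <-] /=.
  rewrite /grid; case: ifPn => // /set_mem/andP[r0 rt]; rewrite ltnS; apply: le_truncn.
  by apply: ler_wpM2r => //; exact: ltW.
have mt m : measurable ([set r : R | m%:R <= r * n.+1%:R < m.+1%:R] : set TR).
  rewrite (_ : [set r : R | _] = `[m%:R / n.+1%:R, m.+1%:R / n.+1%:R[%classic).
    exact: measurable_itv.
  by apply/seteqP; split => r /=; rewrite in_itv/= ler_pdivrMr// ltr_pdivlMr.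
move=> m; have [->|m0] := eqVneq m 0%N.
  rewrite (_ : _ @^-1` _ = ~` oi tau `|` (oi tau `&` [set r : R | 0%:R <= r * n.+1%:R < 1%:R])).
    by apply: measurableU; [exact: measurableC|exact: measurableI].
  apply/seteqP; split => r /=; rewrite /grid.
    case: ifPn => [/set_mem ro|/negP ro _]; last by left; move/mem_set.
    move: (ro) => /andP[r0 _] h; right; split => //.
    by have := truncn_itv (_ : 0 <= r * n.+1%:R); rewrite h; apply; rewrite mulr_ge0// ltW.
  case; first by move=> ?; rewrite memNset.
  move=> [ro h]; rewrite mem_set//; exact: truncn_def.
rewrite (_ : _ @^-1` _ = oi tau `&` [set r : R | m%:R <= r * n.+1%:R < m.+1%:R]).
  exact: measurableI.
apply/seteqP; split => r /=; rewrite /grid.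
  case: ifPn => [/set_mem ro|_ m00]; last by rewrite -m00 eqxx in m0.
  move: (ro) => /andP[r0 _] h; split => //.
  by have := truncn_itv (_ : 0 <= r * n.+1%:R); rewrite h; apply; rewrite mulr_ge0// ltW.
move=> [ro h]; rewrite mem_set//; exact: truncn_def.
Qed.

Lemma grid_itv tau n t : 0 < t < tau ->
  t - n.+1%:R^-1 < (grid tau n t)%:R / n.+1%:R <= t.
Proof.
move=> /[dup] tO /andP[t0 tt].
rewrite /grid mem_set//; have /andP[h1 h2] := truncn_itv (mulr_ge0 (ltW t0) (ler0n R n.+1)).
rewrite ler_pdivrMr// h1 andbT ltr_pdivlMr// mulrBl mulVf ?pnatr_eq0// ltrBlDr.
by rewrite natr1.
Qed.

Lemma grid_cvg tau (k : R -> Y) t : 0 < t < tau -> tcont (oi tau) k t ->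
  k ((grid tau n t)%:R / n.+1%:R) @[n --> \oo] --> k t.
Proof.
move=> /[dup] tO /andP[t0 tt] ck.
apply/cvgrPdist_le => /= e e0; have [d d0 hd] := ck _ e0.
have hx x i : t - i < x <= t -> i < t -> i < d -> `|k t - k x| <= e.
  by move=> xt it id; rewrite distrC; apply: hd; rewrite ?ltr_norml /oi /=; lra.
near=> n.
have nt : (n.+1%:R : R)^-1 < Num.min t d.
  near: n; have h : 0 < Num.min t d by rewrite lt_min t0 d0.
  by have := near_infty_natSinv_lt (PosNum h).
rewrite lt_min in nt; case/andP: nt => nt nd.
exact: hx (grid_itv n tO) nt nd.
Unshelve. all: by end_near. Qed.

(** A continuous function is the pointwise limit of its samples on finer and
    finer grids, so it is strongly measurable; being bounded it is in L^1. *)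
Lemma tcont_approximable tau k M : (forall t, 0 < t < tau -> tcont (oi tau) k t) ->
  (forall t, 0 < t < tau -> `|k t| <= M) -> ap (oi tau) k.
Proof.
move=> ck kM; have [tau0|tau0] := leP tau 0; first exact: approximable0.
have hM : 0 <= M.
  by apply: le_trans (kM (tau / 2) _); [|rewrite divr_gt0//= ltr_pdivrMr// ltr_pMr// ltr1n].
apply: in_L1_approximable => //; split; last first.
  apply: (@le_lt_trans _ _ (M * fine (mu (oi tau)))%:E); last exact: ltry.
  apply: integral_le_upper => //.
  exact: upper_le_le (upper_le_cst (measurable_oi tau) (finite_oi tau) hM).
exists (fun n r => k ((grid tau n r)%:R / n.+1%:R)); split => [n|].
  exact/finite_measurable_simple/(finite_measurable_comp (fun i => k (i%:R / n.+1%:R)) (finite_measurable_grid tau n)).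
apply: aeW => t tO; split => //.
have : (k ((grid tau n t)%:R / n.+1%:R) - k t) @[n --> \oo] --> k t - k t.
  by apply: cvgB; [exact: (grid_cvg tO (ck t tO))|exact: cvg_cst].
by rewrite subrr => /cvg_norm; rewrite normr0.
Qed.

End primitive.
#[global] Hint Resolve measurable_oi finite_oi : core.

(** * The generator of a bounded strongly continuous semigroup *)

Section semigroup.
Context {R : realType}.
Context {Y : completeNormedModType R}.
Local Notation ap := (@approximable R Y setT Num.norm).
Variables (F : R -> Y -> Y) (M : R).
Hypothesis F_c0 : c0_semigroup F.
Hypothesis F_bound : forall t y, 0 <= t -> `|F t y| <= M * `|y|.
Hypothesis M_ge0 : 0 <= M.

Let F_linear t : 0 <= t -> linear (F t).
Proof. by case: F_c0 => h _ _ _ /h[]. Qed.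

Let F_zero x : F 0 x = x.
Proof. by case: F_c0. Qed.

Let F_add t r x : 0 <= t -> 0 <= r -> F (t + r) x = F t (F r x).
Proof. by case: F_c0 => _ _ h _; exact: h. Qed.

Lemma semigroup_cvg0 y e : 0 < e -> exists2 d, 0 < d &
  forall h, 0 <= h < d -> `|F h y - y| <= e.
Proof.
move=> e0; have /cvgrPdist_le/(_ _ e0) : F h y @[h --> 0^'+] --> y by case: F_c0.
rewrite near_withinE => /nbhs_ballP[d /= d0 hd]; exists d => // h /andP[h0 hlt].
move: h0; rewrite le_eqVlt => /predU1P[<-|h0]; first by rewrite F_zero subrr normr0 ltW.
by rewrite distrC; apply: hd => //; rewrite /ball/= sub0r normrN gtr0_norm.
Qed.

Lemma orbit_tcont y t : 0 <= t -> tcont [set r | 0 <= r] (fun r => F r y) t.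
Proof.
move=> t0 e e0; have eM : 0 < e / (M + 1) by rewrite divr_gt0// ltr_wpDl.
have Me : M * (e / (M + 1)) <= e.
  rewrite mulrA ler_pdivrMr ?ltr_wpDl// mulrDr mulr1 mulrC lerDl; exact: ltW.
have [d d0 hd] := semigroup_cvg0 y eM; exists d => // r r0 rt; apply: le_trans Me.
have H a b : 0 <= a -> a <= b -> b - a < d -> `|F b y - F a y| <= M * (e / (M + 1)).
  move=> a0 ab bad; have ba0 : 0 <= b - a by rewrite subr_ge0.
  rewrite -[b in F b](subrKC a) F_add// -(linear_sub (F_linear a0)).
  by apply: le_trans (F_bound _ a0) _; apply: ler_wpM2l => //; apply: hd; rewrite ba0.
have [tr|/ltW rt'] := leP t r.
  by apply: H => //; move: rt; rewrite ger0_norm ?subr_ge0.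
by rewrite distrC; apply: H => //; move: rt; rewrite distrC ger0_norm ?subr_ge0.
Qed.

Lemma orbit_tcont_oi y tau t : 0 < t < tau -> tcont (oi tau) (fun r => F r y) t.
Proof.
move=> /andP[t0 tt]; apply: tcontS (orbit_tcont y (ltW t0)).
by move=> r /andP[r0 _] /=; exact: ltW.
Qed.

Lemma orbit_approximable y tau : ap (oi tau) (fun r => F r y).
Proof.
apply: (@tcont_approximable _ _ _ _ (M * `|y|)) => t; first exact: orbit_tcont_oi.
by move=> /andP[t0 _]; apply: F_bound; exact: ltW.
Qed.

Definition orbit_integral t y : Y := primitive (fun r => F r y) t.
Local Notation P := orbit_integral.

Lemma orbit_integral0 y : P 0 y = 0. Proof. exact: primitive0. Qed.

Lemma tderive_orbit_integral y t : 0 < t -> tderive (fun r => P r y) t (F t y).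
Proof.
move=> t0; apply: (@tderive_primitive _ _ (fun r => F r y) t (t + 1)).
- by rewrite t0 ltrDl ltr01.
- exact: orbit_approximable.
- by apply: orbit_tcont_oi; rewrite t0 ltrDl ltr01.
Qed.

Lemma orbit_integral_lipschitz y t t' : 0 <= t -> t <= t' ->
  `|P t' y - P t y| <= M * `|y| * (t' - t).
Proof.
move=> t0 tt'; have := @primitive_increment _ _ (fun r => F r y) t t' (M * `|y|) 0 t0 tt'.
rewrite scaler0 subr0; apply; first exact: mulr_ge0.
  exact: orbit_approximable.
by move=> r _ r0 _; rewrite subr0; apply: F_bound; exact: ltW.
Qed.

Lemma orbit_integral_bound y t : 0 <= t -> `|P t y| <= M * t * `|y|.
Proof.
move=> t0; have := orbit_integral_lipschitz y (lexx 0) t0.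
by rewrite orbit_integral0 !subr0 mulrAC.
Qed.

Lemma tcont_orbit_integral y t : 0 <= t -> tcont [set r | 0 <= r] (fun r => P r y) t.
Proof.
move=> t0 e e0; have K0 : 0 < M * `|y| + 1 by rewrite ltr_wpDl// mulr_ge0.
exists (e / (M * `|y| + 1)); first by rewrite divr_gt0.
move=> r r0; rewrite ltr_pdivlMr// => h; apply: le_trans (ltW h).
have H : M * `|y| * `|r - t| <= `|r - t| * (M * `|y| + 1).
  by rewrite mulrDr mulr1 mulrC lerDl.
apply: le_trans H; have [tr|/ltW rt] := leP t r.
  by rewrite [`|r - t|]ger0_norm ?subr_ge0//; exact: orbit_integral_lipschitz.
by rewrite distrC (distrC r) [`|t - r|]ger0_norm ?subr_ge0//; exact: orbit_integral_lipschitz.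
Qed.

Lemma orbit_integral_near0 y e : 0 < e -> exists2 d, 0 < d &
  forall h, 0 <= h < d -> `|P h y - h *: y| <= e * h.
Proof.
move=> e0; have [d d0 hd] := semigroup_cvg0 y e0; exists d => // h /andP[h0 hlt].
have := @primitive_increment _ _ (fun r => F r y) 0 h e y (lexx 0) h0 (ltW e0).
rewrite primitive0 !subr0; apply; first exact: orbit_approximable.
by move=> r r0 _ rh; apply: hd; rewrite r0; exact: lt_trans hlt.
Qed.

Lemma orbit_integral_linear t : linear (P t).
Proof.
have [t0|/ltW t0] := leP 0 t; last first.
  move=> a x y; suff h z : P t z = 0 by rewrite !h scaler0 addr0.
  have h : oi t = oi 0.
    by apply/seteqP; split => r /andP[h1 h2]; apply/andP; split => //; lra.
  by rewrite /P /primitive h; exact: primitive0.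
move=> a x y; rewrite /P /primitive.
rewrite -bochnerZ//; last exact: orbit_approximable.
rewrite -bochnerD//; last 2 first.
- by apply: approximableZ => //; exact: orbit_approximable.
- exact: orbit_approximable.
apply: bochner_ae => //; last exact: orbit_approximable.
by apply: aeW => r /andP[r0 _]; exact: (F_linear (ltW r0)).
Qed.

Lemma orbit_integral_shift y h t : 0 <= h -> 0 <= t ->
  P (t + h) y - P h y = primitive (fun r => F (r + h) y) t.
Proof.
move=> h0 t0.
have ka tau : ap (oi tau) (fun r => F (r + h) y).
  apply: (approximable_ae _ (orbit_approximable (F h y) tau)).
  by apply: aeW => r /andP[r0 _]; rewrite F_add// ltW.
have ck tau r : 0 < r < tau -> tcont (oi tau) (fun r => F (r + h) y) r.
  move=> rr e e0; have [d d0 hd] := orbit_tcont_oi (F h y) rr e0; exists d => // x xo xr.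
  have := hd x xo xr; have /andP[x0 _] := xo; have /andP[r0 _] := rr.
  by rewrite !F_add// ltW.
have := @ftc _ _ (t + 1) (-1) _ (fun r => P (r + h) y - P h y) (ka (t + 1)).
rewrite add0r subrr => H; rewrite (H _ _ _ t) ?add0r//.
- move=> r /andP[r0 rt]; exists (M * `|y|), 1; split => // x /andP[x0 _] _.
  by apply: F_bound; rewrite addr_ge0// ltW.
- move=> r /[dup] rr /andP[r0 rt] _; split; first exact: ck.
  rewrite -[F (r + h) y]subr0; apply: tderiveB; last exact: tderive_cst.
  have -> : (fun r => P (r + h) y) = (fun r => P (r - (- h)) y).
    by apply/funext => x; rewrite opprK.
  apply: (@tderive_shift _ _ (fun x => P x y)); rewrite opprK.
  by apply: tderive_orbit_integral; rewrite ltr_pwDl.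
- move=> r /andP[r0 rt] e e0.
  have [d d0 hd] := tcont_orbit_integral y (addr_ge0 r0 h0) e0.
  exists d => // x /andP[x0 xt] xr.
  rewrite opprB addrA subrK; apply: hd; first exact: addr_ge0.
  by rewrite (_ : x + h - _ = x - r)//; ring.
- by rewrite t0 ltrDl ltr01.
Qed.

(** Both sides are the integral of [F r y] over (h, t + h). *)
Lemma semigroup_orbit_integral y h t : 0 <= h -> 0 <= t ->
  F h (P t y) = P (t + h) y - P h y.
Proof.
move=> h0 t0; rewrite orbit_integral_shift//.
rewrite -(bochner_map _ _ M_ge0 (F_linear h0)) => //; last 2 first.
- by move=> z; exact: F_bound.
- exact: orbit_approximable.
apply: bochner_ae => //.
  by apply: aeW => r /andP[r0 _] /=; rewrite addrC F_add// ltW.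
apply: (approximable_linear _ M_ge0 (F_linear h0)) => //; last exact: orbit_approximable.
by move=> z; exact: F_bound.
Qed.

Lemma orbit_integral_semigroup y h t : 0 <= h -> 0 <= t ->
  P t (F h y) = F h (P t y).
Proof.
move=> h0 t0; rewrite semigroup_orbit_integral// orbit_integral_shift//.
apply: bochner_ae => //; last exact: orbit_approximable.
by apply: aeW => r /andP[r0 _]; rewrite F_add// ltW.
Qed.

(** The graph of the generator, as a relation: linearity and closedness are stated
    and used without a separate membership in the domain. *)
Definition gen_graph (z v : Y) := forall e, 0 < e -> exists2 d, 0 < d &
  forall h, 0 < h < d -> `|F h z - z - h *: v| <= e * h.

Lemma gen_graph_cvg z v : gen_graph z v <-> h^-1 *: (F h z - z) @[h --> 0^'+] --> v.
Proof.
have E h : 0 < h -> `|v - h^-1 *: (F h z - z)| = h^-1 * `|F h z - z - h *: v|.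
  move=> h0; rewrite -[in h^-1 * _](gtr0_norm (_ : 0 < h^-1)) ?invr_gt0// -normrZ.
  by rewrite [in RHS]scalerBr scalerA mulVf ?gt_eqF// scale1r distrC.
split => H.
  apply/cvgrPdist_le => /= e e0; have [d d0 hd] := H _ e0.
  rewrite near_withinE; apply/nbhs_ballP; exists d => //= h; rewrite /ball/= sub0r normrN => hd' h0.
  rewrite E// mulrC ler_pdivrMr//; apply: hd; rewrite h0/=.
  by apply: le_lt_trans hd'; exact: ler_norm.
move=> e e0; move/cvgrPdist_le : H => /(_ _ e0).
rewrite near_withinE => /nbhs_ballP[d /= d0 hd]; exists d => // h /andP[h0 hlt].
have := hd h; rewrite /ball/= sub0r normrN gtr0_norm// => /(_ hlt h0).
by rewrite E// mulrC ler_pdivrMr.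
Qed.

Lemma gen_graphP z v : gen_graph z v <-> gen_dom F z /\ gen_op F z = v.
Proof.
rewrite gen_graph_cvg; split.
  by move=> H; split; [apply/cvg_ex; exists v|exact: cvg_lim].
by move=> [d <-].
Qed.

Lemma gen_graph_op z : gen_dom F z -> gen_graph z (gen_op F z).
Proof. by move=> dz; apply/gen_graphP. Qed.

(** [F h (P t y) - P t y = P h (F t y) - P h y], and [P h z / h] tends to [z]. *)
Lemma gen_graph_orbit_integral y t : 0 <= t -> gen_graph (P t y) (F t y - y).
Proof.
move=> t0 e e0; have e20 : 0 < e / 2 by rewrite divr_gt0.
have [d d0 hd] := orbit_integral_near0 y e20.
have [d' d'0 hd'] := orbit_integral_near0 (F t y) e20.
exists (Num.min d d'); first by rewrite lt_min d0.
move=> h /andP[h0]; rewrite lt_min => /andP[h1 h2].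
rewrite semigroup_orbit_integral ?(ltW h0)//.
have -> : P (t + h) y - P h y - P t y - h *: (F t y - y) =
   (P h (F t y) - h *: F t y) - (P h y - h *: y).
  rewrite orbit_integral_semigroup ?(ltW h0)// semigroup_orbit_integral ?(ltW h0)// (addrC h t).
  rewrite scalerBr.
  have H A B C D E : A - B - C - (D - E) = (A - C - D) - (B - E) :> Y.
    rewrite !opprB (addrAC A (- B)) (addrACA (A - C) (- B)).
    by rewrite [RHS](addrACA (A - C)); congr (_ + _); exact: addrC.
  exact: H.
have -> : e * h = e / 2 * h + e / 2 * h by field.
apply: le_trans (ler_normB _ _) _.
by apply: lerD; [apply: hd'|apply: hd]; rewrite (ltW h0).
Qed.

(** Apply [P t] to the difference quotient of [z] and let the step tend to 0:
    by commutation with [F] this is the difference quotient of [P t z], which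
    tends to [F t z - z]. *)
Lemma orbit_integral_gen z v t : 0 <= t -> gen_graph z v -> P t v = F t z - z.
Proof.
move=> t0 zv; apply: norm_small_eq => e e0.
have K0 : 0 < M * t + 1 by rewrite ltr_wpDl// mulr_ge0.
have e1 : 0 < e / (M * t + 1) by rewrite divr_gt0.
have [d d0 hd] := zv _ e1; have [d' d'0 hd'] := gen_graph_orbit_integral z t0 e1.
pose h := Num.min d d' / 2.
have h0 : 0 < h by rewrite divr_gt0// lt_min d0.
have : h < Num.min d d' by rewrite /h ltr_pdivrMr// ltr_pMr ?lt_min ?d0// ltr1n.
rewrite lt_min => /andP[h1 h2].
have {hd} k1 : `|F h z - z - h *: v| <= e / (M * t + 1) * h by apply: hd; rewrite h0.
have {hd'} k2 : `|F h (P t z) - P t z - h *: (F t z - z)| <= e / (M * t + 1) * h by apply: hd'; rewrite h0.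
have k3 : `|P t (F h z) - P t z - h *: P t v| <= M * t * (e / (M * t + 1) * h).
  rewrite -(linear_scale (@orbit_integral_linear t)) -!(linear_sub (@orbit_integral_linear t)).
  apply: le_trans (orbit_integral_bound _ t0) _; apply: ler_wpM2l => //; exact: mulr_ge0.
rewrite orbit_integral_semigroup ?(ltW h0)// in k3.
rewrite -(ler_pM2l h0) -{1}(gtr0_norm h0) -normrZ scalerBr.
have -> : h *: P t v - h *: (F t z - z) = (F h (P t z) - P t z - h *: (F t z - z)) -
    (F h (P t z) - P t z - h *: P t v).
  have H A B W : A - B = (W - B) - (W - A) :> Y by rewrite opprB [RHS]addrC addrA subrK.
  exact: H.
apply: le_trans (ler_normB _ _) _; apply: le_trans (lerD k2 k3) _.
rewrite -{1}[e / _ * h]mul1r -mulrDl (addrC 1) le_eqVlt; apply/orP; left; apply/eqP.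
by field; exact: lt0r_neq0.
Qed.

(** With [orbit_integral_gen], being in the graph is equivalent to an identity
    between bounded operators; linearity, invariance under the semigroup and
    closedness of the graph all follow. *)
Lemma gen_graph_integral z v : (forall h, 0 <= h -> F h z - z = P h v) -> gen_graph z v.
Proof.
move=> H e e0; have [d d0 hd] := orbit_integral_near0 v e0; exists d => // h /andP[h0 hlt].
by rewrite H ?(ltW h0)//; apply: hd; rewrite (ltW h0).
Qed.

Lemma gen_graph_linear a z v z' v' : gen_graph z v -> gen_graph z' v' ->
  gen_graph (a *: z + z') (a *: v + v').
Proof.
move=> zv zv'; apply: gen_graph_integral => h h0.
rewrite (F_linear h0) orbit_integral_linear (orbit_integral_gen h0 zv) (orbit_integral_gen h0 zv').
by rewrite opprD addrACA -scalerBr.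
Qed.

Lemma gen_graph0 : gen_graph 0 0.
Proof.
apply: gen_graph_integral => h h0.
by rewrite (linear_zero (F_linear h0)) (linear_zero (@orbit_integral_linear h)) subrr.
Qed.

Lemma gen_graph_semigroup z v t : 0 <= t -> gen_graph z v -> gen_graph (F t z) (F t v).
Proof.
move=> t0 zv; apply: gen_graph_integral => h h0.
rewrite orbit_integral_semigroup// (orbit_integral_gen h0 zv) (linear_sub (F_linear t0)).
by rewrite -!F_add// (addrC h t).
Qed.

Lemma gen_graph_closed z v :
  (forall e, 0 < e -> exists z' v', [/\ gen_graph z' v', `|z - z'| <= e & `|v - v'| <= e]) ->
  gen_graph z v.
Proof.
move=> H; apply: gen_graph_integral => h h0; apply: norm_small_eq => e e0.
have K0 : 0 < M + 1 + M * h + 1 by rewrite ltr_wpDl// addr_ge0 ?mulr_ge0// addr_ge0.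
have [z' [v' [zv' zz vv]]] := H _ (divr_gt0 e0 K0).
have -> : F h z - z - P h v = F h (z - z') - (z - z') - P h (v - v').
  rewrite (linear_sub (F_linear h0)) (linear_sub (@orbit_integral_linear h)) (orbit_integral_gen h0 zv').
  have K A B C D E : A - B - C = A - D - (B - E) - (C - (D - E)) :> Y.
    rewrite !opprB [RHS]addrA; congr (_ - _).
    by rewrite (addrAC _ (E - B)) (addrA (A - D)) subrK addrA subrK.
  exact: K.
apply: le_trans (ler_normB _ _) _.
apply: (@le_trans _ _ ((M + 1) * (e / (M + 1 + M * h + 1)) + M * h * (e / (M + 1 + M * h + 1)))).
  apply: lerD.
    apply: le_trans (ler_normB _ _) _; rewrite mulrDl mul1r; apply: lerD => //.
    by apply: le_trans (F_bound _ h0) _; exact: ler_wpM2l.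
  apply: le_trans (orbit_integral_bound _ h0) _; apply: ler_wpM2l => //; exact: mulr_ge0.
rewrite -mulrDl mulrA ler_pdivrMr// mulrC; apply: ler_wpM2l; first exact: ltW.
by rewrite lerDl.
Qed.

End semigroup.

(** * Solutions with a cost, and their superposition *)

Section solutions.
Context {R : realType}.
Local Notation mu := (@lebesgue_measure R).
Local Notation TR := (measurableTypeR R).
Context {Y : completeNormedModType R}.
Local Notation ap := (@approximable R Y setT Num.norm).
Variables (F : R -> Y -> Y) (M : R).
Hypothesis F_c0 : c0_semigroup F.
Hypothesis F_bound : forall t y, 0 <= t -> `|F t y| <= M * `|y|.
Hypothesis M_ge0 : 0 <= M.

Definition pos : set TR := [set r | 0 < r].

Lemma measurable_pos : measurable pos.
Proof.
have -> : pos = `]0, +oo[%classic by apply/seteqP; split => r; rewrite /pos/= in_itv/= andbT.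
exact: measurable_itv.
Qed.
Hint Resolve measurable_pos : core.

Lemma oi_pos tau : oi tau `<=` pos.
Proof. by move=> r /andP[]. Qed.

(** Besides the integrated equation, with [w = G u] almost everywhere, a solution
    carries a single bound [c] for the sup norm of [u] and the L^1 norm of [G u]:
    only bounds that add up along a series can survive superposition. *)
Definition mild_solution x f u w (c : R) :=
  [/\ [/\ forall t, 0 <= t -> tcont [set r | 0 <= r] u t,
          forall tau, ap (oi tau) f & forall tau, ap (oi tau) w],
      forall t, 0 <= t -> u t = x + primitive (fun r => w r + f r) t,
      {ae mu, forall t, pos t -> gen_graph F (u t) (w t)},
      forall t, 0 <= t -> `|u t| <= c &
      upper_le pos (fun t => `|w t|) c].

Lemma series_bound_cvg (a : nat -> Y) (b : nat -> R) B :
  (forall k, `|a k| <= b k) -> (forall n, \sum_(k < n) b k <= B) ->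
  let l := lim (series a @ \oo) in
  forall e, 0 < e -> exists N, forall n, (N <= n)%N -> `|l - \sum_(k < n) a k| <= e.
Proof.
move=> ab bB /= e e0.
have cb : cvgn (series b).
  apply: nondecreasing_is_cvgn.
    move=> i j ij; apply: (@nondecreasing_series _ b xpredT 0) => // k _ _.
    exact: le_trans (ab k).
  by exists B => _ [n _ <-]; rewrite /series/= big_mkord.
have cna : cvgn [normed series a].
  by apply: (series_le_cvg _ _ ab) => // k; exact: le_trans (ab k).
have /cvgrPdist_le/(_ _ e0)[N _ hN] := normed_cvg cna.
by exists N => n /hN /=; rewrite /series/= big_mkord.
Qed.

Lemma approximable_sum n (f : nat -> R -> Y) (A : set TR) : measurable A ->
  (forall k, ap A (f k)) -> ap A (fun t => \sum_(k < n) f k t).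
Proof.
move=> mA fa; elim: n => [|n IH].
  under eq_fun do rewrite big_ord0.
  apply: simple_approximable; apply: finite_measurable_simple; split.
    by apply: (sub_finite_set _ (finite_set1 0)) => _ [_ _ <-].
  move=> z; have [->|zy] := eqVneq z 0.
    by rewrite (_ : _ @^-1` _ = setT)//; apply/seteqP; split.
  rewrite (_ : _ @^-1` _ = set0)//; apply/seteqP; split => // r /= yz.
  by rewrite yz eqxx in zy.
under eq_fun do rewrite big_ord_recr/=.
exact: approximableD.
Qed.

Lemma gen_graph_sum n (z v : nat -> Y) : (forall k, gen_graph F (z k) (v k)) ->
  gen_graph F (\sum_(k < n) z k) (\sum_(k < n) v k).
Proof.
move=> zv; elim: n => [|n IH]; first by rewrite !big_ord0; exact: gen_graph0 F_c0 F_bound M_ge0.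
rewrite !big_ord_recr/= -[X in gen_graph _ (X + _)]scale1r -[X in gen_graph _ _ (X + _)]scale1r.
exact: (gen_graph_linear F_c0 F_bound M_ge0).
Qed.

Lemma primitive_sum n (g : nat -> R -> Y) t : (forall k, ap (oi t) (g k)) ->
  primitive (fun r => \sum_(k < n) g k r) t = \sum_(k < n) primitive (g k) t.
Proof.
move=> ga; elim: n => [|n IH].
  rewrite big_ord0; under eq_fun do rewrite big_ord0.
  by rewrite /primitive bochner_cst// scaler0.
rewrite big_ord_recr/= -IH -bochnerD//; last exact: approximable_sum.
by congr bochner; apply/funext => r; rewrite big_ord_recr.
Qed.

Lemma tail_small (c : nat -> R) C : (forall k, 0 <= c k) -> (forall n, \sum_(k < n) c k <= C) ->
  forall e, 0 < e -> exists N, forall n, (N <= n)%N -> forall m, \sum_(j < m) c (n + j)%N <= e.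
Proof.
move=> c0 cC e e0.
have cc : cvgn (series c).
  apply: nondecreasing_is_cvgn.
    by move=> i j ij; apply: (@nondecreasing_series _ c xpredT 0) => // k _ _.
  by exists C => _ [n _ <-]; rewrite /series/= big_mkord.
have /cvgrPdist_le/(_ _ e0)[N _ hN] := cc.
exists N => n /hN /=; set l := lim _ => h m.
have sm : \sum_(j < m) c (n + j)%N = series c (n + m)%N - series c n.
  elim: m => [|m IH]; first by rewrite big_ord0 addn0 subrr.
  by rewrite big_ord_recr/= IH addnS /series/= [in RHS]big_nat_recr//= addrAC.
rewrite sm; apply: le_trans h; apply: le_trans (ler_norm _); apply: lerB => //.
apply: nondecreasing_cvgn_le cc _ => i j ij.
by apply: (@nondecreasing_series _ c xpredT 0) => // k _ _.
Qed.

(** Solutions may be added up as soon as their costs are summable: [u] converges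
    uniformly, [w] converges in L^1 and almost everywhere, and the graph of the
    generator is closed. *)
Lemma mild_solution_series (x : nat -> Y) (f u w : nat -> R -> Y) (c : nat -> R) X G C :
  (forall k, mild_solution (x k) (f k) (u k) (w k) (c k)) ->
  (forall n, \sum_(k < n) c k <= C) ->
  (forall tau, ap (oi tau) G) ->
  (forall e, 0 < e -> exists N, forall n, (N <= n)%N ->
     `|X - \sum_(k < n) x k| <= e /\
     upper_le pos (fun t => `|G t - \sum_(k < n) f k t|) e) ->
  exists U W, mild_solution X G U W C.
Proof.
move=> sk cC Ga XG.
have c0 k : 0 <= c k by have [_ _ _ _ /upper_le_ge0] := sk k.
have C0 : 0 <= C by have := cC 0%N; rewrite big_ord0.
pose U t := lim (series (fun k => u k t) @ \oo).
pose W t := lim (series (fun k => w k t) @ \oo).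
have fa k tau : ap (oi tau) (f k) by have [[_ h _] _ _ _ _] := sk k.
have wa k tau : ap (oi tau) (w k) by have [[_ _ h] _ _ _ _] := sk k.
have wc k : upper_le pos (fun t => `|w k t|) (c k) by have [_ _ _ _ h] := sk k.
have uc k t : 0 <= t -> `|u k t| <= c k by move=> t0; have [_ _ _ h _] := sk k; exact: h.
have tl := tail_small c0 cC.
have Uuni e : 0 < e -> exists N, forall n, (N <= n)%N -> forall t, 0 <= t ->
    `|U t - \sum_(k < n) u k t| <= e.
  move=> e0; have e20 : 0 < e / 2 by rewrite divr_gt0.
  have [N hN] := tl _ e20; exists N => n /hN h t t0.
  have [N' hN'] := series_bound_cvg (fun k => uc k t t0) cC e20.
  have := hN' (n + N')%N (leq_addl _ _).
  have : `|\sum_(k < n + N') u k t - \sum_(k < n) u k t| <= e / 2.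
    apply: le_trans (h N').
    rewrite big_split_ord/= [X in X - _]addrC addrK.
    by apply: le_trans (ler_norm_sum _ _ _) _; apply: ler_sum => j _; exact: uc.
  rewrite -/(U t); have := ler_distD (\sum_(k < n + N') u k t) (U t) (\sum_(k < n) u k t); lra.
have wb : {ae mu, forall t, pos t -> exists m, forall n, \sum_(j < n) `|w j t| <= m}.
  exact: upper_le_ae_bounded wc cC.
have Wlim n D : (forall m, \sum_(j < m) c (n + j)%N <= D) ->
    upper_le pos (fun t => `|W t - \sum_(k < n) w k t|) D.
  move=> hD; apply: (upper_le_lim measurable_pos (fun j => wc (n + j)%N) hD).
  apply: ae_imply wb => t h At e e0; have {h}[m hm] := h At.
  have [N hN] := series_bound_cvg (fun k => lexx `|w k t|) hm e0.
  exists N; have := hN (n + N)%N (leq_addl _ _); rewrite -/(W t).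
  have : `|\sum_(k < n + N) w k t - \sum_(k < n) w k t| <= \sum_(j < N) `|w (n + j)%N t|.
    by rewrite big_split_ord/= [X in X - _]addrC addrK; exact: ler_norm_sum.
  have := ler_distD (\sum_(k < n + N) w k t) (W t) (\sum_(k < n) w k t); lra.
have Wap tau : ap (oi tau) W.
  apply: approximable_upper => // e e0; have [N hN] := tl _ e0.
  exists (fun t => \sum_(k < N) w k t); first exact: approximable_sum.
  apply: upper_leS (measurable_oi tau) measurable_pos (@oi_pos tau) _.
  by apply: upper_le_le (Wlim N e (hN N (leqnn N))) => t _; rewrite distrC.
exists U, W; split; first split => //.
- move=> t t0 e e0; have e30 : 0 < e / 3 by rewrite divr_gt0.
  have [N hN] := Uuni _ e30; have {hN}h := hN N (leqnn N).
  have ct : tcont [set r | 0 <= r] (fun r => \sum_(k < N) u k r) t.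
    elim: N {h} => [|N IH] d d0.
      by exists 1 => // r _ _; rewrite !big_ord0 subrr normr0 ltW.
    have d20 : 0 < d / 2 by rewrite divr_gt0.
    have [[cu _ _] _ _ _ _] := sk N.
    have [d1 d10 hd1] := IH _ d20; have [d2 d2_0 hd2] := cu t t0 _ d20.
    exists (Num.min d1 d2); first by rewrite lt_min d10.
    move=> r r0; rewrite lt_min => /andP[/(hd1 _ r0) h1 /(hd2 _ r0) h2].
    rewrite !big_ord_recr/= opprD addrACA (splitr d).
    by apply: le_trans (ler_normD _ _) _; exact: lerD.
  have [d d0 hd] := ct _ e30; exists d => // r r0 rt.
  have := hd r r0 rt; have := h r r0; have := h t t0.
  have := ler_distD (\sum_(k < N) u k r) (U r) (U t).
  have := ler_distD (\sum_(k < N) u k t) (\sum_(k < N) u k r) (U t).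
  rewrite (distrC (\sum_(k < N) u k t) (U t)); lra.
- move=> t t0; apply: norm_small_eq => e e0; have e40 : 0 < e / 4 by rewrite divr_gt0.
  have [N1 hN1] := Uuni _ e40; have [N2 hN2] := tl _ e40; have [N3 hN3] := XG _ e40.
  pose N := (N1 + N2 + N3)%N.
  have l1 : (N1 <= N)%N by rewrite /N -addnA leq_addr.
  have l2 : (N2 <= N)%N by rewrite /N addnAC leq_addl.
  have l3 : (N3 <= N)%N by rewrite /N leq_addl.
  have {hN1}h1 := hN1 N l1 t t0; have {hN2}h2 := Wlim N _ (hN2 N l2); have {hN3}[h3 h4] := hN3 N l3.
  have E : \sum_(k < N) u k t = \sum_(k < N) x k +
      primitive (fun r => \sum_(k < N) w k r + \sum_(k < N) f k r) t.
    transitivity (\sum_(k < N) x k + primitive (fun r => \sum_(k < N) (w k r + f k r)) t).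
      rewrite (@primitive_sum N (fun k r => w k r + f k r)); last by move=> k; exact: approximableD.
      rewrite -big_split/=; apply: eq_bigr => k _.
      by have [_ h _ _ _] := sk k; exact: h.
    by congr (_ + primitive _ t); apply/funext => r; rewrite big_split.
  have h5 : `|primitive (fun r => W r + G r) t -
     primitive (fun r => \sum_(k < N) w k r + \sum_(k < N) f k r) t| <= e / 4 + e / 4.
    apply: bochner_dist => //.
    - exact: approximableD.
    - by apply: approximableD => //; exact: approximable_sum.
    - apply: upper_leS (measurable_oi t) measurable_pos (@oi_pos t) _.
      apply: upper_le_le (upper_leD measurable_pos h2 h4) => r _.
      by rewrite opprD addrACA; exact: ler_normD.
  have := ler_distD (\sum_(k < N) u k t) (U t) (X + primitive (fun r => W r + G r) t).
  have H (A B A' B' : Y) : `|A + B - (A' + B')| <= `|A' - A| + `|B' - B|.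
    by rewrite opprD addrACA (distrC A') (distrC B'); exact: ler_normD.
  have : `|\sum_(k < N) u k t - (X + primitive (fun r => W r + G r) t)| <=
      `|X - \sum_(k < N) x k| + `|primitive (fun r => W r + G r) t -
       primitive (fun r => \sum_(k < N) w k r + \sum_(k < N) f k r) t|.
    by rewrite E; exact: H.
  lra.
- have gae : {ae mu, forall t k, pos t -> gen_graph F (u k t) (w k t)}.
    by apply/ae_foralln => k; have [_ _ h _ _] := sk k.
  apply: ae_imply2 gae wb => t h1 h2 At; have {h2}[m hm] := h2 At.
  apply: (gen_graph_closed F_c0 F_bound M_ge0) => e e0.
  have [N1 hN1] := Uuni _ e0; have [N2 hN2] := series_bound_cvg (fun k => lexx `|w k t|) hm e0.
  exists (\sum_(k < N1 + N2) u k t), (\sum_(k < N1 + N2) w k t); split.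
  + by apply: (@gen_graph_sum (N1 + N2)%N (fun k => u k t) (fun k => w k t)) => k; exact: h1.
  + exact: (hN1 _ (leq_addr _ _) t (ltW At)).
  + exact: (hN2 _ (leq_addl _ _)).
- move=> t t0; apply/ler_addgt0Pr => e e0; have [N hN] := Uuni _ e0.
  have h1 := hN N (leqnn N) t t0.
  have h2 : `|\sum_(k < N) u k t| <= C.
    apply: le_trans (cC N); apply: le_trans (ler_norm_sum _ _ _) _.
    by apply: ler_sum => k _; exact: uc.
  have := ler_normD (U t - \sum_(k < N) u k t) (\sum_(k < N) u k t); rewrite subrK; lra.
- by have := Wlim 0%N C cC; apply: upper_le_le => t _; rewrite big_ord0 subr0.
Qed.

End solutions.
#[global] Hint Resolve measurable_pos : core.

(** * Affine changes of variables *)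

Section affine_change_of_variables.
Context {R : realType}.
Local Notation mu := (@lebesgue_measure R).
Local Notation TR := (measurableTypeR R).
Variables (a b : R).
Hypothesis a0 : 0 < a.

Let phi : TR -> TR := fun t => a * t + b.

Let measurable_phi : measurable_fun [set: TR] phi.
Proof.
have : measurable_fun [set: R] (fun t : R => a * t + b).
  by apply: measurable_funD => //; exact: measurable_funM.
by [].
Qed.

Let phi_measure : {measure set TR -> \bar R} :=
  measure_function_pushforward__canonical__measure_function_Measure mu measurable_phi.

(** Both sides agree on intervals, and that determines a Borel measure. *)
Lemma lebesgue_measure_affine (A : set TR) : measurable A ->
  mu A = mscale (NngNum (ltW a0)) phi_measure A.
Proof.
move=> mA; apply: lebesgue_measure_unique => // _ [[x y] _ <-] /=.
rewrite /mscale /phi_measure/= /pushforward /=.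
have -> : phi @^-1` `]x, y]%classic = `](x - b) / a, (y - b) / a]%classic.
  apply/seteqP; split => t; rewrite /phi /= !in_itv/=; rewrite ltr_pdivrMr// ler_pdivlMr// ltrBlDr lerBrDr; by rewrite mulrC.
rewrite !lebesgue_measure_itv/= !lte_fin ltr_pM2r ?invr_gt0// ltrD2r.
case: ifPn => _; last by rewrite mule0.
by rewrite -!EFinB -EFinM; congr EFin; field; exact: lt0r_neq0.
Qed.

Lemma ge0_integral_affine (D : set TR) (f : R -> \bar R) : measurable D ->
  measurable_fun D f -> (forall t, D t -> (0 <= f t)%E) ->
  (\int[mu]_(t in D) f t =
   a%:E * \int[mu]_(t in [set t | D (a * t + b)%R]) f (a * t + b)%R)%E.
Proof.
move=> mD mf f0.
transitivity (\int[mscale (NngNum (ltW a0)) phi_measure]_(t in D) f t)%E.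
  by apply: eq_measure_integral => A mA _; exact: lebesgue_measure_affine.
rewrite ge0_integral_mscale//= ge0_integral_pushforward//.
by move=> t /set_mem /f0.
Qed.

End affine_change_of_variables.

(** * Approximation by step functions on uniform grids *)

Section step_approximation.
Context {R : realType}.
Local Notation mu := (@lebesgue_measure R).
Local Notation TR := (measurableTypeR R).

(** Approximate the indicator in L^1 by a continuous function and sample that one
    on a fine grid. *)
Lemma indic_grid_approximation (B : set TR) tau e : measurable B -> 0 < tau -> 0 < e ->
  exists N, forall n, (N <= n)%N -> exists a : nat -> R,
    upper_le (oi tau) (fun t => `|\1_B t - a (grid tau n t)|) e.
Proof.
move=> mB tau0 e0.
have e40 : 0 < e / 2 by rewrite divr_gt0.
have iB : mu.-integrable (oi tau) (EFin \o \1_B).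
  apply/integrableP; split; first exact/measurable_EFinP/measurable_indic.
  apply: (@le_lt_trans _ _ (mu (oi tau))) => //.
  rewrite -[leRHS]mul1e -integral_cst//; apply: ge0_le_integral => //.
  - by apply: measurableT_comp => //; apply/measurable_EFinP; exact: measurable_indic.
  - by move=> t _ /=; rewrite lee_fin ger0_norm// indicE; case: (_ \in _).
have [g [cg ig gB]] := approximation_continuous_integrable (measurable_oi tau) (finite_oi tau) iB.
have [p hp] : exists p, (\int[mu]_(z in oi tau) `|(\1_B z - g p z)%:E| <= (e / 2)%:E)%E.
  move/fine_cvgP : gB => [fin /cvgrPdist_le/(_ _ e40) h].
  near \oo => n; exists n.
  have h1 : (\int[mu]_(z in oi tau) `|(\1_B z - g n z)%:E|)%E \is a fin_num by near: n.
  have h2 : `|0 - fine (\int[mu]_(z in oi tau) `|(\1_B z - g n z)%:E|)%E| <= e / 2 by near: n.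
  by rewrite -(fineK h1) lee_fin; apply: le_trans h2; rewrite sub0r normrN ler_norm.
have {cg} cgp : continuous (g p) := cg p.
have mg : measurable_fun [set: R] (g p) by exact: continuous_measurable_fun.
have u1 : upper_le (oi tau) (fun t => `|\1_B t - g p t|) (e / 2).
  apply: upper_le_measurable => //.
  by apply: measurableT_comp => //; apply: measurable_funB => //; exact: measurable_indic.
have [K hK] : exists K, forall t, 0 <= t <= tau -> `|g p t| <= K.
  have cn : {within `[0, tau], continuous (fun t => `|g p t|)}.
    by apply: continuous_subspaceT => t; apply: cvg_norm; exact: cgp.
  have [c ctau hc] := EVT_max (ltW tau0) cn.
  by exists `|g p c| => t tt; apply: hc; rewrite in_itv.
have K0 : 0 <= K by apply: le_trans (hK 0 _); rewrite ?lexx//= ltW.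
pose h n t := g p ((grid tau n t)%:R / n.+1%:R).
have mh n : measurable_fun [set: R] (h n).
  have := finite_measurable_fun (finite_measurable_comp (fun i => g p (i%:R / n.+1%:R)) (finite_measurable_grid tau n)).
  by [].
have mhE n : measurable_fun (oi tau) (fun t => (`|g p t - h n t|)%:E : \bar R).
  have : measurable_fun [set: R] (fun t => (`|g p t - h n t|)%:E : \bar R).
    apply/measurable_EFinP; apply: measurableT_comp => //; exact: measurable_funB.
  exact: measurable_funTS.
have iK : mu.-integrable (oi tau) (fun=> (2 * K)%:E).
  apply/integrableP; split; first exact: measurable_cst.
  by rewrite integral_cst// [X in (_ * X)%E](measure_oi (ltW tau0)) -EFinM ltry.
have [] := dominated_convergence (measurable_oi tau) mhE (measurable_cst 0%E) _ iK _.
- apply: aeW => t tO; apply: cvg_EFin; first exact: nearW.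
  have ct : tcont (oi tau) (g p : R -> R^o) t.
    move=> d d0; have /cvgrPdist_le/(_ _ d0)/nbhs_ballP[b /= b0 hb] := cgp t.
    by exists b => // r _ rt; rewrite distrC; apply: hb; rewrite /ball/= distrC.
  have : (g p t - h n t) @[n --> \oo] --> g p t - g p t.
    by apply: cvgB; [exact: cvg_cst|exact: (grid_cvg tO ct)].
  by rewrite subrr => /cvg_norm; rewrite normr0.
- apply: aeW => t n /[dup] tO /andP[t0 tt]; rewrite gee0_abs ?lee_fin//.
  apply: le_trans (ler_normB _ _) _; rewrite mulr_natl mulr2n; apply: lerD.
    by apply: hK; rewrite !ltW.
  have /andP[_ h2] := grid_itv n tO.
  by apply: hK; rewrite divr_ge0//= (le_trans h2)// ltW.
move=> _ _; rewrite integral0 => /fine_cvgP[[N1 _ hN1] /cvgrPdist_le/(_ _ e40)[N2 _ hN2]].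
exists (maxn N1 N2) => n; rewrite geq_max => /andP[n1 n2]; exists (fun i => g p (i%:R / n.+1%:R)).
rewrite (splitr e).
have u2 : upper_le (oi tau) (fun t => `|g p t - h n t|) (e / 2).
  apply: upper_le_measurable => //.
    by apply: measurableT_comp => //; exact: measurable_funB.
  have h1 : (\int[mu]_(t in oi tau) (`|g p t - h n t|)%:E)%E \is a fin_num := hN1 n n1.
  rewrite -(fineK h1) lee_fin; apply: le_trans (hN2 n n2) => /=.
  by rewrite sub0r normrN ler_norm.
apply: upper_le_le (upper_leD (measurable_oi tau) u1 u2) => t _.
exact: ler_distD.
Unshelve. all: by end_near. Qed.

Context {Y : completeNormedModType R}.
Local Notation ap := (@approximable R Y setT Num.norm).

Definition grid_approximable tau (f : R -> Y) := forall e, 0 < e ->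
  exists N, forall n, (N <= n)%N -> exists a : nat -> Y,
    upper_le (oi tau) (fun t => `|f t - a (grid tau n t)|) e.

Lemma grid_approximableD tau f g : grid_approximable tau f -> grid_approximable tau g ->
  grid_approximable tau (fun t => f t + g t).
Proof.
move=> hf hg e e0; have e20 : 0 < e / 2 by rewrite divr_gt0.
have [N1 hN1] := hf _ e20; have [N2 hN2] := hg _ e20.
exists (maxn N1 N2) => n; rewrite geq_max => /andP[/hN1[a ha] /hN2[b hb]].
exists (fun i => a i + b i); rewrite (splitr e).
apply: upper_le_le (upper_leD (measurable_oi tau) ha hb) => t _.
by rewrite opprD addrACA; exact: ler_normD.
Qed.

Lemma grid_approximable_simple tau s : 0 < tau -> finite_measurable s ->
  grid_approximable tau s.
Proof.
move=> tau0 fs; have finr : finite_set (range s) := proj1 fs.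
have H (r : seq Y) : grid_approximable tau (fun t => \sum_(y <- r) (\1_(s @^-1` [set y]) t : R) *: y).
  elim: r => [|y r IH].
    move=> e e0; exists 0%N => n _; exists (fun=> 0); exists (fun=> 0%E); split => //.
    - by apply: aeW => t _; rewrite big_nil subr0 normr0.
    - by rewrite integral0 lee_fin ltW.
  under eq_fun do rewrite big_cons.
  apply: grid_approximableD => // e e0.
  have ey : 0 < e / (1 + `|y|) by rewrite divr_gt0// ltr_wpDr.
  have [N hN] := indic_grid_approximation (finite_measurable_preimage [set y] fs) tau0 ey.
  exists N => n /hN[a ha]; exists (fun i => a i *: y).
  have := upper_leZ (measurable_oi tau) (normr_ge0 y) ha.
  apply: upper_leW; first by apply: aeW => t _; rewrite -scalerBl normrZ mulrC.
  rewrite mulrA ler_pdivrMr ?ltr_wpDr// mulrC; apply: ler_wpM2l; first exact: ltW.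
  by rewrite lerDr.
have /finite_seqP[r rE] := finr.
have {H}h := H (undup r).
suff E : s = fun t => \sum_(y <- undup r) (\1_(s @^-1` [set y]) t : R) *: y by rewrite E.
apply/funext => t; have sr : s t \in undup r.
  have : range s (s t) by exists t.
  by rewrite rE mem_undup.
rewrite (bigD1_seq (s t)) ?undup_uniq//= indicE mem_set// scale1r big1 ?addr0// => y ys.
by rewrite indicE memNset ?scale0r//= => /eqP; rewrite eq_sym (negbTE ys).
Qed.

Lemma grid_approximable_approximable tau f : 0 < tau -> ap (oi tau) f -> grid_approximable tau f.
Proof.
move=> tau0 fa e e0; have e20 : 0 < e / 2 by rewrite divr_gt0.
have [s /simple_finite_measurable fs sf] := fa _ e20.
have [N hN] := grid_approximable_simple tau0 fs e20.
exists N => n /hN[a ha]; exists a; rewrite (splitr e).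
apply: upper_le_le (upper_leD (measurable_oi tau) sf ha) => t _.
by rewrite (distrC (s t) (f t)); exact: ler_distD.
Qed.

(** The integral of the majorant over [n, +oo) tends to 0 by dominated
    convergence. *)
Lemma upper_le_tail h c e : upper_le (@pos R) h c -> 0 < e ->
  exists T : nat, upper_le (@pos R) (fun t => if t < T.+1%:R then 0 else h t) e.
Proof.
move=> [k [mk k0 hk kc]] e0.
pose kn n := (k \_ (~` (oi n.+1%:R : set TR)))%E.
have mkn n : measurable_fun [set: R] (kn n).
  apply/(measurable_restrictT _ _).1; last exact: measurable_funTS.
  by have := measurableC (measurable_oi (n.+1%:R : R)).
have mknp n : measurable_fun (@pos R) (kn n) by have := mkn n; exact: measurable_funTS.
have kn0 n t : (0 <= kn n t)%E by apply: erestrict_ge0.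
have ik : mu.-integrable (@pos R) k.
  apply/integrableP; split; first exact: measurable_funTS.
  under eq_integral => t _ do rewrite gee0_abs//.
  by apply: le_lt_trans kc _; rewrite ltry.
have [] := dominated_convergence (@measurable_pos R) mknp (measurable_cst 0%E) _ ik _.
- apply: aeW => t t0; apply: cvg_near_cst.
  exists (Num.truncn t).+1 => // n /= tn; rewrite /kn patchE memNset// => h1; apply: h1.
  apply/andP; split => //; apply: lt_le_trans (truncnS_gt t) _.
  by rewrite ler_nat ltnS ltnW.
- apply: aeW => t n _; rewrite gee0_abs// /kn patchE; by case: ifPn.
move=> _ _; rewrite integral0 => /fine_cvgP[[N1 _ hN1] /cvgrPdist_le/(_ _ e0)[N2 _ hN2]].
pose n := maxn N1 N2; exists n, (kn n); split => //.
  apply: ae_imply hk => t h1 t0; case: ifPn => tn; first exact: kn0.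
  by rewrite /kn patchE mem_set ?h1// => /andP[_]; rewrite (negbTE tn).
have l1 : (N1 <= n)%N by rewrite leq_maxl.
have l2 : (N2 <= n)%N by rewrite leq_maxr.
have h1 : (\int[mu]_(t in @pos R) kn n t)%E \is a fin_num := hN1 n l1.
rewrite -(fineK h1) lee_fin; apply: le_trans (hN2 n l2) => /=.
by rewrite sub0r normrN ler_norm.
Qed.

End step_approximation.

(** * Explicit solutions for constant pulses *)

Section elementary_solutions.
Context {R : realType}.
Local Notation mu := (@lebesgue_measure R).
Local Notation TR := (measurableTypeR R).
Context {Y : completeNormedModType R}.
Local Notation ap := (@approximable R Y setT Num.norm).
Local Notation pos := (@pos R).
Variables (F : R -> Y -> Y) (M : R).
Hypothesis F_c0 : c0_semigroup F.
Hypothesis F_bound : forall t y, 0 <= t -> `|F t y| <= M * `|y|.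
Hypothesis M_ge0 : 0 <= M.
Local Notation P := (orbit_integral F).
Local Notation G := (gen_op F).

Let F_linear t : 0 <= t -> linear (F t).
Proof. by case: F_c0 => h _ _ _ /h[]. Qed.

Let F_zero x : F 0 x = x.
Proof. by case: F_c0. Qed.

Let F_add t r x : 0 <= t -> 0 <= r -> F (t + r) x = F t (F r x).
Proof. by case: F_c0 => _ _ h _; exact: h. Qed.

Lemma max0_lipschitz (r t : R) : `|Num.max r 0 - Num.max t 0| <= `|r - t|.
Proof. by have [] := leP 0 r; have [] := leP 0 t => ? ?; rewrite ler_norml; have := ler_norm (r - t); have := ler_norm (t - r); rewrite (distrC t); lra. Qed.

Lemma max0_ge0 (r : R) : 0 <= Num.max r 0.
Proof. by rewrite le_max lexx orbT. Qed.

Lemma lipschitz_tcont (D : set R) (u : R -> Y) L t : 0 <= L ->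
  (forall r, `|u r - u t| <= L * `|r - t|) -> tcont D u t.
Proof.
move=> L0 h e e0; have K0 : 0 < L + 1 by rewrite ltr_wpDl.
exists (e / (L + 1)); first by rewrite divr_gt0.
move=> r _; rewrite ltr_pdivlMr// => h1; apply: le_trans (ltW h1).
by apply: le_trans (h r) _; rewrite mulrC ler_wpM2l// lerDl.
Qed.

(** Extension to negative times by the initial value, which makes the orbit
    continuous on the whole line. *)
Definition orbit0 y (t : R) : Y := F (Num.max t 0) y.
Definition orbit_integral0p y (t : R) : Y := P (Num.max t 0) y.

Lemma orbit0_tcont (D : set R) y t : tcont D (orbit0 y) t.
Proof.
move=> e e0; have [d d0 hd] := orbit_tcont F_c0 F_bound M_ge0 y (max0_ge0 t) e0.
exists d => // r _ rt; apply: hd; first exact: max0_ge0.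
by apply: le_lt_trans rt; exact: max0_lipschitz.
Qed.

Lemma orbit0_bound y t : `|orbit0 y t| <= M * `|y|.
Proof. by apply: F_bound; exact: max0_ge0. Qed.

Lemma orbit_integral0p_lipschitz y r t :
  `|orbit_integral0p y r - orbit_integral0p y t| <= M * `|y| * `|r - t|.
Proof.
have My : 0 <= M * `|y| by rewrite mulr_ge0.
apply: le_trans (ler_wpM2l My (max0_lipschitz r t)).
rewrite /orbit_integral0p; move: (max0_ge0 r) (max0_ge0 t).
move: (Num.max r 0) (Num.max t 0) => a b a0 b0.
have [ba|/ltW ab] := leP b a.
  by rewrite [`|a - b|]ger0_norm ?subr_ge0//; exact: (orbit_integral_lipschitz F_c0 F_bound M_ge0).
rewrite distrC (distrC a) [`|b - a|]ger0_norm ?subr_ge0//.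
exact: (orbit_integral_lipschitz F_c0 F_bound M_ge0).
Qed.

Lemma shift_tcont (D : set R) (u : R -> Y) a t :
  (forall t, tcont setT u t) -> tcont D (fun r => u (r - a)) t.
Proof.
move=> h e e0; have [d d0 hd] := h (t - a) e e0; exists d => // r _ rt.
by apply: hd => //; rewrite (_ : r - a - (t - a) = r - t)//; ring.
Qed.

Lemma finite_measurable_cst (y : Y) : finite_measurable (fun _ : R => y).
Proof.
split; first by apply: (sub_finite_set _ (finite_set1 y)) => _ [_ _ <-].
move=> z; have [->|zy] := eqVneq z y.
  by rewrite (_ : _ @^-1` _ = setT)//; apply/seteqP; split.
rewrite (_ : _ @^-1` _ = set0)//; apply/seteqP; split => // t /= yz.
by rewrite yz eqxx in zy.
Qed.

Definition block (y : Y) (a b t : R) : Y := if a <= t < b then y else 0.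

Lemma finite_measurable_block y a b : finite_measurable (block y a b).
Proof.
have -> : block y a b = fun t => if t \in (`[a, b[%classic : set TR) then y else 0.
  apply/funext => t; rewrite /block; case: ifPn => tab.
    by rewrite mem_set//= in_itv.
  by rewrite memNset//= in_itv/=; exact/negP.
by apply: (finite_measurable_patch _ _ (finite_measurable_cst y)); exact: measurable_itv.
Qed.

Lemma block_approximable A y a b : ap A (block y a b).
Proof. exact/simple_approximable/finite_measurable_simple/finite_measurable_block. Qed.

Definition retarded y a (r : R) : Y := if a <= r then orbit0 y (r - a) else 0.

Lemma retarded_approximable y a tau : ap (oi tau) (retarded y a).
Proof.
have h : ap (oi tau) (fun r => orbit0 y (r - a)).
  apply: (@tcont_approximable _ _ _ _ (M * `|y|)) => t _; last exact: orbit0_bound.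
  by apply: shift_tcont => r; exact: orbit0_tcont.
have -> : retarded y a = fun r => if r \in (`[a, +oo[%classic : set TR) then orbit0 y (r - a) else 0.
  apply/funext => r; rewrite /retarded; case: ifPn => ar.
    by rewrite mem_set//= in_itv/= andbT.
  by rewrite memNset//= in_itv/= andbT; exact/negP.
apply: (@approximable_patch _ _ (oi tau) (oi tau) `[a, +oo[%classic) => // r [].
Qed.

(** Fundamental theorem with the jump of [retarded] at [a] as exceptional
    time. *)
Lemma retarded_primitive y a t : 0 <= a -> 0 <= t ->
  orbit_integral0p y (t - a) = primitive (retarded y a) t.
Proof.
move=> a0 t0; have tt : 0 <= t < t + 1 by rewrite t0 ltrDl ltr01.
have P0 r : r <= 0 -> orbit_integral0p y r = 0.
  by move=> r0; rewrite /orbit_integral0p max_r// orbit_integral0.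
have := @ftc _ _ (t + 1) a (retarded y a) (fun r => orbit_integral0p y (r - a))
  (retarded_approximable y a (t + 1)).
rewrite sub0r (P0 (- a)) ?oppr_le0// => H; rewrite (H _ _ _ _ tt) ?add0r//.
- move=> r _; exists (M * `|y|), 1; split => // x _ _.
  rewrite /retarded; case: ifP => _; first exact: orbit0_bound.
  by rewrite normr0 mulr_ge0.
- move=> r /andP[r0 rt] ra.
  have [ar|ra'] := leP a r.
    have {ra}ar : a < r by rewrite lt_neqAle eq_sym ra.
    have ra0 : 0 < r - a by rewrite subr_gt0.
    split.
      move=> e e0; have [d d0 hd] := @shift_tcont setT (orbit0 y) a r (orbit0_tcont _ y) e e0.
      exists (Num.min d (r - a)); first by rewrite lt_min d0.
      move=> x _; rewrite lt_min => /andP[x1 x2]; rewrite /retarded.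
      have -> : a <= x by move: x2; rewrite ltr_norml; lra.
      by rewrite (ltW ar); exact: hd.
    rewrite /retarded (ltW ar); apply: (@tderive_shift _ _ (orbit_integral0p y)).
    rewrite /orbit0 max_l ?(ltW ra0)//.
    apply: (tderive_local ra0 _ (tderive_orbit_integral F_c0 F_bound M_ge0 y ra0)) => x.
    rewrite ltr_norml => hx; rewrite /orbit_integral0p max_l//; lra.
  have ar0 : 0 < a - r by rewrite subr_gt0.
  have z x : `|x - r| < a - r -> x < a by rewrite ltr_norml; lra.
  split.
    move=> e e0; exists (a - r) => // x _ /z xa.
    by rewrite /retarded (leNgt a x) (leNgt a r) xa ra' /= subrr normr0 ltW.
  rewrite /retarded leNgt ra' /=; apply: (tderive_local ar0 _ (tderive_cst 0 r)) => x /z xa.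
  by rewrite P0// subr_le0 ltW.
- move=> r _; apply: (@lipschitz_tcont _ _ (M * `|y|)); first by rewrite mulr_ge0.
  move=> x; have := orbit_integral0p_lipschitz y (x - a) (r - a).
  by rewrite (_ : x - a - (r - a) = x - r)//; ring.
Qed.

(** Variation of constants for the right-hand side [block y a b]: the integral of
    [F (t - r) y] over the [r] in [a, b) below [t] is a difference of two orbit
    integrals. *)
Definition block_solution y a b t : Y := orbit_integral0p y (t - a) - orbit_integral0p y (t - b).
(** The generator applied to [block_solution], by [gen_graph_orbit_integral]. *)
Definition block_generator y a b t : Y := orbit0 y (t - a) - orbit0 y (t - b).

Lemma shift_upper_le (h : R -> R) b c : 0 <= b -> measurable_fun [set: R] h ->
  (forall t, 0 <= h t) -> (\int[mu]_(t in pos) (h t)%:E <= c%:E)%E ->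
  upper_le pos (fun t => if b < t then h (t - b) else 0) c.
Proof.
move=> b0 mh h0 hc.
pose D : set TR := [set t | b < t].
have mD : measurable D.
  have -> : D = `]b, +oo[%classic by apply/seteqP; split => r; rewrite /D/= in_itv/= andbT.
  exact: measurable_itv.
have mhb : measurable_fun [set: R] (fun t => (h (t - b))%:E : \bar R).
  apply/measurable_EFinP; apply: (measurableT_comp mh).
  exact: measurable_funB.
exists ((fun t => (h (t - b))%:E) \_ D)%E; split.
- by apply/(measurable_restrictT _ _).1 => //; have := mhb; exact: measurable_funTS.
- by move=> t; apply: erestrict_ge0 => *; rewrite lee_fin.
- apply: aeW => t _; rewrite patchE; case: ifPn => bt; first by rewrite mem_set.
  by rewrite memNset//; exact/negP.
- rewrite -integral_mkcondr; have -> : pos `&` D = D.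
    by apply/setIidr => t bt; apply: le_lt_trans bt.
  have mhD : measurable_fun D (fun t => (h (t - b))%:E : \bar R).
    by have := mhb; exact: measurable_funTS.
  rewrite (ge0_integral_affine b ltr01 mD mhD) => [|t _]; last by rewrite lee_fin.
  rewrite mul1e; apply: le_trans hc; rewrite le_eqVlt; apply/orP; left; apply/eqP.
  have -> : [set t | b < 1 * t + b] = pos.
    by apply/seteqP; split => t /=; rewrite mul1r ltrDr.
  by apply: eq_integral => t _; rewrite mul1r addrK.
Qed.

Lemma orbit0_norm_measurable y : measurable_fun [set: R] (fun t => `|orbit0 y t|).
Proof.
apply: continuous_measurable_fun => t; apply/cvgrPdist_le => /= e e0.
have [d d0 hd] := @orbit0_tcont setT y t e e0; apply/nbhs_ballP; exists d => //= r rt.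
apply: le_trans (ler_dist_dist _ _) _; rewrite distrC; apply: hd => //.
by rewrite distrC.
Qed.

(** The cost is proportional to [(b - a) * `|y|], the L^1 norm of the right-hand
    side.  During the pulse [w] is bounded by [(M + 1) * `|y|].  After it, [w t]
    equals [P (b - a) (F (t - b) (G y))], of norm at most
    [M * (b - a) * `|F (t - b) (G y)|], and the integrability hypothesis on
    the orbit of [G y] applies. *)
Lemma block_mild_solution y a b K : 0 <= K -> 0 <= a -> a <= b -> gen_dom F y ->
  (\int[mu]_(t in pos) (`|F t (G y)|)%:E <= (K * `|y|)%:E)%E ->
  mild_solution F 0 (block y a b) (block_solution y a b) (block_generator y a b)
    ((M * K + M + 1) * ((b - a) * `|y|)).
Proof.
move=> K1 a0 ab dy Ky.
have ba : 0 <= b - a by rewrite subr_ge0.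
split.
- split.
  + move=> t t0; apply: (@lipschitz_tcont _ _ (M * `|y| * 2)); first by rewrite !mulr_ge0.
    move=> r; have h1 := orbit_integral0p_lipschitz y (r - a) (t - a).
    have h2 := orbit_integral0p_lipschitz y (r - b) (t - b).
    rewrite (_ : r - a - (t - a) = r - t) in h1; last by ring.
    rewrite (_ : r - b - (t - b) = r - t) in h2; last by ring.
    rewrite /block_solution.
    have H (A B A' B' : Y) : `|A - B - (A' - B')| <= `|A - A'| + `|B - B'|.
      have -> : A - B - (A' - B') = (A - A') - (B - B').
        by rewrite !opprB addrACA [RHS]addrACA; congr (_ + _); exact: addrC.
      exact: ler_normB.
    apply: le_trans (H _ _ _ _) _; apply: le_trans (lerD h1 h2) _.
    by rewrite le_eqVlt; apply/orP; left; apply/eqP; ring.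
  + by move=> tau; exact: block_approximable.
  + move=> tau; apply: approximableB => //.
      apply: (@tcont_approximable _ _ _ _ (M * `|y|)) => t _; last exact: orbit0_bound.
      by apply: shift_tcont => r; exact: orbit0_tcont.
    apply: (@tcont_approximable _ _ _ _ (M * `|y|)) => t _; last exact: orbit0_bound.
    by apply: shift_tcont => r; exact: orbit0_tcont.
- move=> t t0; rewrite add0r /block_solution !retarded_primitive//; last exact: le_trans ab.
  rewrite /primitive -bochnerB//; try exact: retarded_approximable.
  congr bochner; apply/funext => r; rewrite /block_generator /block /retarded.
  have o0 x : x <= 0 -> orbit0 y x = y by move=> x0; rewrite /orbit0 max_r.
  have [ar|ra] := leP a r; have [br|rb] := leP b r => /=.
  + by rewrite addr0.
  + by rewrite subr0 (o0 (r - b)) ?subr_le0 ?(ltW rb)// subrK.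
  + by have := lt_le_trans ra (le_trans ab br); rewrite ltxx.
  + by rewrite !o0 ?subr_le0 ?(ltW ra) ?(ltW rb)// subrr addr0 subrr.
- apply: aeW => t _; rewrite /block_solution /block_generator.
  have := gen_graph_orbit_integral F_c0 F_bound M_ge0 y (max0_ge0 (t - a)) => g1.
  have := gen_graph_orbit_integral F_c0 F_bound M_ge0 y (max0_ge0 (t - b)) => g2.
  have := gen_graph_linear F_c0 F_bound M_ge0 (-1) g2 g1.
  rewrite !scaleN1r [X in gen_graph _ X _]addrC [X in gen_graph _ _ X]addrC.
  by rewrite opprB addrA subrK.
- move=> t t0; rewrite /block_solution; apply: le_trans (orbit_integral0p_lipschitz _ _ _) _.
  rewrite (_ : t - a - (t - b) = b - a); last by ring.
  rewrite ger0_norm// -mulrA (mulrC `|y|); apply: ler_wpM2r; first exact: mulr_ge0.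
  have : 0 <= M * K by exact: mulr_ge0.
  lra.
- have u1 : upper_le pos (fun t => (M + 1) * `|y| * \1_(`[a, b]%classic : set TR) t) ((M + 1) * `|y| * (b - a)).
    apply: upper_leZ => //; first by rewrite mulr_ge0// addr_ge0.
    have mi : measurable_fun [set: R] (\1_(`[a, b]%classic : set TR) : R -> R).
      by apply: measurable_indic; exact: measurable_itv.
    apply: upper_le_measurable => //.
    rewrite integral_indic//.
    apply: (@le_trans _ _ (mu (`[a, b]%classic))).
      by apply: le_measure; rewrite ?inE//; apply: measurableI => //; exact: measurable_itv.
    rewrite lebesgue_measure_itv/= lte_fin; case: ifPn => _; first by rewrite -EFinB.
    by rewrite lee_fin.
  have u2 : upper_le pos (fun t => M * (b - a) * (if b < t then `|orbit0 (G y) (t - b)| else 0)) (M * (b - a) * (K * `|y|)).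
    apply: upper_leZ => //; first exact: mulr_ge0.
    apply: (@shift_upper_le (fun t => `|orbit0 (G y) t|)) => //; [exact: le_trans ab|exact: orbit0_norm_measurable|].
    apply: le_trans Ky; rewrite le_eqVlt; apply/orP; left; apply/eqP.
    by apply: eq_integral => t /set_mem t0; rewrite /orbit0 max_l// ltW.
  have -> : (M * K + M + 1) * ((b - a) * `|y|) = (M + 1) * `|y| * (b - a) + M * (b - a) * (K * `|y|) by ring.
  apply: upper_le_le (upper_leD measurable_pos u1 u2) => t t0.
  rewrite /block_generator; have [bt|tb] := ltP b t.
    rewrite [X in _ <= X + _](_ : _ = 0); last first.
      rewrite indicE memNset ?mulr0//= in_itv/= => /andP[_]; by rewrite leNgt bt.
    rewrite add0r.
    have tb0 : 0 <= t - b by rewrite subr_ge0 ltW.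
    have ta0 : 0 <= t - a by rewrite subr_ge0 (le_trans ab)// ltW.
    rewrite /orbit0 !max_l//.
    rewrite (_ : t - a = t - b + (b - a)); last by ring.
    rewrite F_add// -(linear_sub (F_linear tb0)).
    rewrite -(orbit_integral_gen F_c0 F_bound M_ge0 ba (gen_graph_op dy)).
    rewrite -(orbit_integral_semigroup F_c0 F_bound M_ge0)//.
    exact: (orbit_integral_bound F_c0 F_bound M_ge0).
  have ob : orbit0 y (t - b) = y by rewrite /orbit0 max_r ?subr_le0// F_zero.
  rewrite mulr0 addr0 ob.
  have [at_|ta] := leP a t.
    rewrite indicE mem_set ?mulr1; last by rewrite /= in_itv/= at_ tb.
    apply: le_trans (ler_normB _ _) _; rewrite mulrDl mul1r lerD2r; exact: orbit0_bound.
  rewrite /orbit0 max_r ?subr_le0 ?(ltW ta)// F_zero subrr normr0.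
  by rewrite mulr_ge0// mulr_ge0// addr_ge0.
Qed.

End elementary_solutions.

(** * Existence of solutions from integrability of orbits *)

Section existence.
Context {R : realType}.
Local Notation mu := (@lebesgue_measure R).
Local Notation TR := (measurableTypeR R).
Context {Y : completeNormedModType R}.
Local Notation ap := (@approximable R Y setT Num.norm).
Local Notation pos := (@pos R).
Variables (F : R -> Y -> Y) (M K : R) (D0 : set Y).
Hypothesis F_c0 : c0_semigroup F.
Hypothesis F_bound : forall t y, 0 <= t -> `|F t y| <= M * `|y|.
Hypothesis M_ge0 : 0 <= M.
Hypothesis K_ge0 : 0 <= K.
Hypothesis D0_dense : forall y e, 0 < e -> exists2 y', D0 y' & `|y - y'| <= e.
Hypothesis D0_0 : D0 0.
Hypothesis D0_dom : D0 `<=` gen_dom F.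
Hypothesis D0_int : forall y, D0 y ->
  (\int[mu]_(t in pos) (`|F t (gen_op F y)|)%:E <= (K * `|y|)%:E)%E.
Local Notation G := (gen_op F).

(** For initial values in [D0] the cost of the homogeneous solution is controlled
    by the integrability hypothesis itself. *)
Lemma orbit_mild_solution x : D0 x ->
  mild_solution F x (fun=> 0) (fun t => F t x) (fun t => F t (G x)) ((M + K) * `|x|).
Proof.
move=> Dx; have gx := gen_graph_op (D0_dom Dx); split.
- split.
  + by move=> t t0; exact: (orbit_tcont F_c0 F_bound M_ge0).
  + by move=> tau; apply: simple_approximable; exact/finite_measurable_simple/finite_measurable_cst.
  + by move=> tau; exact: (orbit_approximable F_c0 F_bound M_ge0).
- move=> t t0; have -> : (fun r => F r (G x) + 0) = (fun r => F r (G x)).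
    by apply/funext => r; rewrite addr0.
  by rewrite -/(orbit_integral F t (G x)) (orbit_integral_gen F_c0 F_bound M_ge0 t0 gx) addrC subrK.
- by apply: aeW => t t0; apply: (gen_graph_semigroup F_c0 F_bound M_ge0) => //; exact: ltW.
- move=> t t0; apply: le_trans (F_bound x t0) _.
  by apply: ler_wpM2r => //; rewrite lerDl.
- apply: (@upper_le_le _ _ _ (fun t => `|orbit0 F (G x) t|)) => [t t0|].
    by rewrite /orbit0 max_l// ltW.
  apply: upper_le_measurable => //; first exact: (orbit0_norm_measurable F_c0 F_bound M_ge0).
  apply: (@le_trans _ _ (K * `|x|)%:E).
    apply: le_trans (D0_int Dx); rewrite le_eqVlt; apply/orP; left; apply/eqP.
    by apply: eq_integral => t /set_mem t0; rewrite /orbit0 max_l// ltW.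
  by rewrite lee_fin; apply: ler_wpM2r => //; rewrite lerDr.
Qed.

Lemma upper_le_extend h tau c : upper_le (oi tau) h c ->
  upper_le pos (fun t => if t < tau then h t else 0) c.
Proof.
move=> [k [mk k0 hk kc]]; exists (k \_ (oi tau)); split.
- apply/(measurable_restrictT _ _).1; first exact: measurable_oi.
  by have := mk; exact: measurable_funTS.
- by move=> t; apply: erestrict_ge0 => *; exact: k0.
- apply: ae_imply hk => t h1 t0; rewrite patchE; case: ifPn => tt.
    by rewrite mem_set; [apply: h1|]; apply/andP.
  by case: ifPn.
- rewrite -integral_mkcondr (_ : pos `&` oi tau = oi tau)//.
  by apply/setIidr => t /andP[].
Qed.

Section blocks.
Variables (y : nat -> Y) (nu : nat).

Let blk j := block (y j) (j%:R / nu.+1%:R) (j.+1%:R / nu.+1%:R).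

Lemma blockE j t : 0 < t -> blk j t = if Num.truncn (t * nu.+1%:R) == j then y j else 0.
Proof.
move=> t0; rewrite /blk /block truncn_eq; last by rewrite mulr_ge0// ltW.
by rewrite ler_pdivrMr// ltr_pdivlMr.
Qed.

Lemma block_sumE m t : 0 < t -> \sum_(j < m) blk j t =
  if (Num.truncn (t * nu.+1%:R) < m)%N then y (Num.truncn (t * nu.+1%:R)) else 0.
Proof.
move=> t0; under eq_bigr do rewrite blockE// eq_sym.
by rewrite -big_mkcond/= (big_ord1_eq +%R y).
Qed.

(** The blocks have disjoint supports.  This is the point where the exponent 1
    matters: the L^1 norm of a step function is exactly the sum of the norms of its
    pulses, so solving pulse by pulse loses nothing. *)
Lemma block_sum_norm m t : 0 < t -> `|\sum_(j < m) blk j t| = \sum_(j < m) `|blk j t|.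
Proof.
move=> t0; rewrite block_sumE//.
have H j : `|blk j t| = if j == Num.truncn (t * nu.+1%:R) then `|y j| else 0.
  by rewrite blockE// eq_sym; case: ifP => // _; rewrite normr0.
under [RHS]eq_bigr do rewrite H.
rewrite -big_mkcond/= (big_ord1_eq +%R (fun j => `|y j|)).
by case: ifP => // _; rewrite normr0.
Qed.

Lemma block_sum_cost m c : upper_le pos (fun t => `|\sum_(j < m) blk j t|) c ->
  \sum_(j < m) (nu.+1%:R^-1 * `|y j|) <= c.
Proof.
move=> /integral_le_upper; move=> /(_ measurable_pos (fun _ _ => normr_ge0 _)) h.
rewrite -lee_fin; apply: le_trans h.
pose I j : set TR := `[j%:R / nu.+1%:R, j.+1%:R / nu.+1%:R[%classic.
have mI j : measurable (I j) by exact: measurable_itv.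
have E t : pos t -> (`|\sum_(j < m) blk j t|)%:E = (\sum_(j < m) (`|y j| * \1_(I j) t)%:E)%E.
  move=> t0; rewrite block_sum_norm// -sumEFin; apply: eq_bigr => j _; congr EFin.
  have tI : I j t <-> j%:R / nu.+1%:R <= t < j.+1%:R / nu.+1%:R by rewrite /I/= in_itv.
  rewrite /blk /block indicE; case: ifPn => tj.
    by rewrite mem_set ?mulr1//; exact/tI.
  by rewrite memNset ?mulr0 ?normr0// => /tI; exact/negP.
under eq_integral => t /set_mem t0 do rewrite E//.
have mi0 j : measurable_fun pos (\1_(I j) : R -> R).
  have h : measurable_fun [set: R] (\1_(I j) : R -> R) by apply: measurable_indic; exact: mI.
  exact: measurable_funTS.
have mi j : measurable_fun pos (fun t => (`|y j| * \1_(I j) t)%:E : \bar R).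
  by apply/measurable_EFinP; apply: measurable_funM => //.
rewrite (@ge0_integral_sum _ _ _ mu pos measurable_pos 'I_m (fun j t => (`|y j| * \1_(I j) t)%:E))//.
rewrite -sumEFin; apply: lee_sum => j _.
under eq_integral => t _ do rewrite EFinM.
have mi' : measurable_fun pos (fun t => (\1_(I j) t)%:E : \bar R).
  by apply/measurable_EFinP; exact: (mi0 j).
rewrite ge0_integralZl// integral_indic// mulrC EFinM; apply: lee_wpmul2l => //.
apply: (@le_trans _ _ (mu (`]j%:R / nu.+1%:R, j.+1%:R / nu.+1%:R[%classic))).
  rewrite lebesgue_measure_itv/= lte_fin ltr_pM2r ?invr_gt0// ltr_nat ltnSn -EFinB lee_fin.
  by rewrite -mulrBl -[j.+1%:R]natr1 addrAC subrr add0r mul1r.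
apply: le_measure; rewrite ?inE//; [exact: measurableI|].
move=> t /=; rewrite in_itv/= => /andP[t1 t2]; split.
  by rewrite /I/= in_itv/= t2 ltW.
by apply: le_lt_trans t1; rewrite divr_ge0.
Qed.

End blocks.

(** Cut off at a large time, approximate on a grid, and move the values into the
    dense set [D0]; the L^1 norm grows by at most the error. *)
Lemma step_density f c e : (forall tau, ap (oi tau) f) -> upper_le pos (fun t => `|f t|) c ->
  0 < e -> exists nu m (y : nat -> Y), [/\ forall j, D0 (y j),
    upper_le pos (fun t => `|f t - \sum_(j < m)
       block (y j) (j%:R / nu.+1%:R) (j.+1%:R / nu.+1%:R) t|) e &
    \sum_(j < m) (nu.+1%:R^-1 * `|y j|) <= c + e].
Proof.
move=> fa fc e0; have e30 : 0 < e / 3 by rewrite divr_gt0.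
have [T hT] := upper_le_tail fc e30.
have T0 : 0 < T.+1%:R :> R by [].
have [nu hnu] := grid_approximable_approximable T0 (fa T.+1%:R) e30.
have [z hz] := hnu nu (leqnn nu).
have e40 : 0 < e / 3 / T.+1%:R by rewrite divr_gt0.
have /choice[y hy] : forall j, exists y, D0 y /\ `|z j - y| <= e / 3 / T.+1%:R.
  by move=> j; have [y' ? ?] := D0_dense (z j) e40; exists y'.
pose m := (T.+1 * nu.+1)%N.
suff u : upper_le pos (fun t => `|f t - \sum_(j < m)
       block (y j) (j%:R / nu.+1%:R) (j.+1%:R / nu.+1%:R) t|) e.
  exists nu, m, y; split => //; first by move=> j; case: (hy j).
  apply: block_sum_cost; apply: upper_le_le (upper_leD measurable_pos fc u) => t _.
  set g := \sum_(j < m) _.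
  by have := ler_normB (f t) (f t - g); rewrite opprB addrC subrK.
have uc : upper_le (oi T.+1%:R) (fun=> e / 3 / T.+1%:R : R) (e / 3).
  have := upper_le_cst (measurable_oi (T.+1%:R : R)) (finite_oi _) (ltW e40).
  rewrite [X in fine X](measure_oi (ltW T0))/= => h; apply: upper_leW h; first exact: aeW.
  by rewrite -mulrA mulVf ?mulr1.
have u1 := upper_le_extend (upper_leD (measurable_oi _) hz uc).
have -> : e = (e / 3 + e / 3) + e / 3 by field.
apply: upper_le_le (upper_leD measurable_pos u1 hT) => t t0.
rewrite block_sumE// -(ltr_nat R).
have lt_iff : (Num.truncn (t * nu.+1%:R) < m)%N = (t < T.+1%:R).
  rewrite truncn_lt_nat; last by rewrite mulr_ge0// ltW.
  by rewrite /m natrM ltr_pM2r.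
rewrite ltr_nat lt_iff; case: ifPn => tT; last by rewrite subr0 add0r.
rewrite addr0; have -> : Num.truncn (t * nu.+1%:R) = grid T.+1%:R nu t.
  by rewrite /grid mem_set//; apply/andP.
apply: le_trans (ler_distD (z (grid T.+1%:R nu t)) _ _) _.
by apply: lerD => //; case: (hy (grid T.+1%:R nu t)).
Qed.

(* the factor 2: the approximating initial value and right-hand side have size at
   most [2 * c] *)
Let C1 := 2 * (M + K + (M * K + M + 1)).

Lemma C1_ge0 : 0 <= C1.
Proof. by rewrite mulr_ge0// !addr_ge0// mulr_ge0. Qed.

(** One step of the iteration: step functions with values in [D0] are solved
    explicitly by adding pulses to the homogeneous solution, and the bound on the
    data is halved for the error that is left. *)
Lemma mild_solution_approx x f c : `|x| <= c -> (forall tau, ap (oi tau) f) ->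
  upper_le pos (fun t => `|f t|) c ->
  exists x' f' u w, [/\ mild_solution F x' f' u w (C1 * c), `|x - x'| <= c / 2 &
    upper_le pos (fun t => `|f t - f' t|) (c / 2)].
Proof.
move=> xc fa fc; have c0 : 0 <= c := upper_le_ge0 fc.
have [c00|c00] := eqVneq c 0.
  have := orbit_mild_solution D0_0; rewrite normr0 mulr0 => s0.
  exists 0, (fun=> 0), (fun t => F t 0), (fun t => F t (G 0)); split.
  - by rewrite c00 mulr0.
  - by move: xc; rewrite c00 mul0r subr0.
  - by move: fc; rewrite c00 mul0r; apply: upper_le_le => t _; rewrite subr0.
have cp : 0 < c by rewrite lt_neqAle eq_sym c00.
have c20 : 0 < c / 2 by rewrite divr_gt0.
have [x' Dx' xx'] := D0_dense x c20.
have [nu [m [y [Dy fy cy]]]] := step_density fa fc c20.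
(* an infinite sequence of solutions that are 0 from some index on, the first
   one carrying the initial value *)
pose y' j := if (j < m)%N then y j else 0.
have Dy' j : D0 (y' j) by rewrite /y'; case: ifP.
pose a j : R := j%:R / nu.+1%:R.
pose fs k := if k is j.+1 then block (y' j) (a j) (a j.+1) else fun=> 0.
pose f' t := \sum_(j < m) block (y j) (a j) (a j.+1) t.
pose xs k := if k is j.+1 then 0 else x'.
pose us k := if k is j.+1 then block_solution F (y' j) (a j) (a j.+1) else fun t => F t x'.
pose ws k := if k is j.+1 then block_generator F (y' j) (a j) (a j.+1) else fun t => F t (G x').
pose cs k := if k is j.+1 then (M * K + M + 1) * ((a j.+1 - a j) * `|y' j|) else (M + K) * `|x'|.
have a0 j : 0 <= a j by rewrite divr_ge0.
have aa j : a j <= a j.+1 by rewrite ler_pM2r ?invr_gt0// ler_nat.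
have ad j : a j.+1 - a j = nu.+1%:R^-1.
  by rewrite /a -mulrBl -[j.+1%:R]natr1 addrAC subrr add0r mul1r.
have sk k : mild_solution F (xs k) (fs k) (us k) (ws k) (cs k).
  case: k => [|j]; first exact: orbit_mild_solution.
  apply: block_mild_solution => //; [exact: D0_dom|exact: D0_int].
have y'sum n : \sum_(j < n) (nu.+1%:R^-1 * `|y' j|) <= c + c / 2.
  apply: le_trans cy.
  have -> : \sum_(j < m) nu.+1%:R^-1 * `|y j| = \sum_(j < m + n) nu.+1%:R^-1 * `|y' j|.
    rewrite big_split_ord/= [X in _ = _ + X]big1 ?addr0.
      by apply: eq_bigr => j _; rewrite /y' ltn_ord.
    by move=> j _; rewrite /y' ltnNge leq_addr/= normr0 mulr0.
  rewrite addnC big_split_ord/= lerDl; apply: sumr_ge0 => j _.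
  by rewrite mulr_ge0.
have x'c : `|x'| <= 2 * c.
  have := ler_normB x (x - x'); rewrite opprB addrC subrK; lra.
have csum n : \sum_(k < n) cs k <= C1 * c.
  case: n => [|n]; first by rewrite big_ord0 mulr_ge0// C1_ge0.
  rewrite big_ord_recl/=.
  have -> : \sum_(i < n) (M * K + M + 1) * ((a (bump 0 i).-1.+1 - a (bump 0 i).-1) * `|y' (bump 0 i).-1|)
     = (M * K + M + 1) * \sum_(j < n) (nu.+1%:R^-1 * `|y' j|).
    by rewrite mulr_sumr; apply: eq_bigr => j _; rewrite ad.
  have h1 : (M + K) * `|x'| <= (M + K) * (2 * c) by apply: ler_wpM2l => //; exact: addr_ge0.
  have h2 : (M * K + M + 1) * \sum_(j < n) (nu.+1%:R^-1 * `|y' j|) <= (M * K + M + 1) * (2 * c).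
    apply: ler_wpM2l; first by rewrite !addr_ge0// mulr_ge0.
    by apply: le_trans (y'sum n) _; lra.
  apply: le_trans (lerD h1 h2) _.
  by rewrite /C1 le_eqVlt; apply/orP; left; apply/eqP; ring.
have fsum n t : (m < n)%N -> \sum_(k < n) fs k t = f' t.
  case: n => // n; rewrite ltnS => mn.
  rewrite big_ord_recl/= add0r /f' -(subnKC mn) big_split_ord/=.
  rewrite [X in _ + X = _]big1 ?addr0.
    by apply: eq_bigr => j _; rewrite /y' ltn_ord.
  move=> j _; rewrite /y' ltnNge leq_addr/= /block; by case: ifP.
have [u [w uw]] : exists u w, mild_solution F x' f' u w (C1 * c).
  apply: (mild_solution_series F_c0 F_bound M_ge0 sk csum).
    move=> tau; apply: (@approximable_sum R Y m (fun j => block (y j) (a j) (a j.+1)) (oi tau)) => // j.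
    exact: block_approximable.
  move=> e e0; exists m.+1 => n mn; split.
    case: n mn => // n _; rewrite big_ord_recl/= big1 ?addr0 ?subrr ?normr0 ?ltW//.
  exists (fun=> 0%E); split => //.
  - by apply: aeW => t _; rewrite fsum// subrr normr0.
  - by rewrite integral0 lee_fin ltW.
by exists x', f', u, w; split.
Qed.

(** Solve approximately, and apply the same to the error; the data sum up to
    [(x, f)] and the costs form a geometric series. *)
Theorem mild_solution_exists x f c : `|x| <= c -> (forall tau, ap (oi tau) f) ->
  upper_le pos (fun t => `|f t|) c ->
  exists u w, mild_solution F x f u w (2 * C1 * c).
Proof.
move=> xc fa fc.
pose data (p : Y * (R -> Y) * R) := [/\ `|p.1.1| <= p.2, forall tau, ap (oi tau) p.1.2 &
  upper_le pos (fun t => `|p.1.2 t|) p.2].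
have /choice[S hS] : forall p : Y * (R -> Y) * R, exists q : Y * (R -> Y) * (R -> Y) * (R -> Y),
    data p -> [/\ mild_solution F q.1.1.1 q.1.1.2 q.1.2 q.2 (C1 * p.2),
      `|p.1.1 - q.1.1.1| <= p.2 / 2 & upper_le pos (fun t => `|p.1.2 t - q.1.1.2 t|) (p.2 / 2)].
  move=> p; have [[h1 h2 h3]|nd] := pselect (data p); last by exists (0, fun=> 0, fun=> 0, fun=> 0).
  have [x' [f' [u [w h]]]] := mild_solution_approx h1 h2 h3.
  by exists (x', f', u, w).
(* the residual of the data after one approximate solution *)
pose next (p : Y * (R -> Y) * R) : Y * (R -> Y) * R :=
  (p.1.1 - (S p).1.1.1, fun t => p.1.2 t - (S p).1.1.2 t, p.2 / 2).
pose st n := iter n next (x, f, c).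
have dst n : data (st n).
  elim: n => [//|n IH]; have [[[_ fa' _] _ _ _ _] h2 h3] := hS _ IH.
  split => //= tau; have [_ fa2 _] := IH; exact: approximableB.
have cst_ n : (st n).2 = c * 2^-1 ^+ n.
  by elim: n => [|n IH]; rewrite ?expr0 ?mulr1//= IH exprSr mulrA.
have sol n := let: And3 h _ _ := hS _ (dst n) in h.
have xs n : \sum_(k < n) (S (st k)).1.1.1 = x - (st n).1.1.
  elim: n => [|n IH]; first by rewrite big_ord0 subrr.
  by rewrite big_ord_recr/= IH opprB addrA addrAC.
have fs n t : \sum_(k < n) (S (st k)).1.1.2 t = f t - (st n).1.2 t.
  elim: n => [|n IH]; first by rewrite big_ord0 subrr.
  by rewrite big_ord_recr/= IH opprB addrA addrAC.
have c0 : 0 <= c := upper_le_ge0 fc.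
have cpos : 0 <= C1 * c by rewrite mulr_ge0// C1_ge0.
apply: (mild_solution_series F_c0 F_bound M_ge0 sol) => //.
- move=> n; under eq_bigr do rewrite cst_ mulrA.
  rewrite -mulr_sumr (_ : 2 * C1 * c = C1 * c * 2); last by ring.
  apply: ler_wpM2l => //; case: n => [|n]; first by rewrite big_ord0.
  rewrite big_ord_recl/= expr0; have := @sum_half R n.
  have -> : \sum_(i < n) (2^-1 ^+ bump 0 i : R) = \sum_(i < n) 2^-1 ^+ i.+1 by [].
  lra.
- move=> e e0.
  have h0 : (c * 2^-1 ^+ n.+1 : R) @[n --> \oo] --> c * 0.
    apply: cvgMr; exact: (bounded_sum_cvg0 (fun n => ltW (half_gt0 n.+1)) (@sum_half R)).
  move: h0; rewrite mulr0 => /cvgrPdist_le/(_ _ e0)[N _ hN].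
  exists N.+1 => -[//|n] nN; have := hN n nN; rewrite /= sub0r normrN ger0_norm; last first.
    by rewrite mulr_ge0// exprn_ge0// invr_ge0.
  move=> hn; have [d1 _ d3] := dst n.+1; rewrite cst_ in d1 d3; split.
    by rewrite xs opprB addrC subrK; exact: le_trans hn.
  apply: upper_leW d3 => //; apply: aeW => t _.
  by rewrite fs opprB addrC subrK.
Qed.

End existence.

(** * Weak derivatives of primitives *)

Section test_functions.
Context {R : realType}.
Variables (tau : R) (phi : R -> R).
Hypothesis hphi : test_function tau phi.

Lemma test_is_derive t : is_derive t (1 : R) phi (derive1 phi t).
Proof.
have [h _] := hphi; split; first exact: (h 0%N).
by rewrite derive1E.
Qed.

Lemma test_derive_derivable t : derivable (derive1 phi) t (1 : R).
Proof. by have [h _] := hphi; exact: (h 1%N). Qed.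

Lemma test_continuous : continuous phi.
Proof. by move=> t; apply: differentiable_continuous; apply/derivable1_diffP; have [h _] := hphi; exact: (h 0%N). Qed.

Lemma test_derive_continuous : continuous (derive1 phi).
Proof. by move=> t; apply: differentiable_continuous; apply/derivable1_diffP; exact: test_derive_derivable. Qed.

Lemma test_support : exists a b, [/\ 0 < a, b < tau,
  forall t, ~ (a <= t <= b) -> phi t = 0 & forall t, ~ (a <= t <= b) -> derive1 phi t = 0].
Proof.
have [_ [a [b [a0 bt h]]]] := hphi; exists a, b; split => // t nt.
have z : \forall r \near t, phi r = 0.
  have [ta|ta] := ltP t a.
    apply/nbhs_ballP; exists (a - t); rewrite /= ?subr_gt0// => r.
    by rewrite /ball/= ltr_norml => tr; apply: h; lra.
  have tb : b < t by rewrite ltNge; apply/negP => tb; apply: nt; rewrite ta tb.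
  apply/nbhs_ballP; exists (t - b); rewrite /= ?subr_gt0// => r.
  by rewrite /ball/= ltr_norml => tr; apply: h; lra.
rewrite derive1E (@near_eq_derive _ _ _ _ (cst 0) _ _ z); exact: derive_cst.
Qed.

Lemma support_bounded (g : R -> R) (a b : R) : continuous g ->
  (forall t, ~ (a <= t <= b) -> g t = 0) -> exists B, 0 <= B /\ forall t, `|g t| <= B.
Proof.
move=> cg h; have [ab|ba] := leP a b; last first.
  by exists 0; split => // t; rewrite h ?normr0// => /andP[h1 h2]; have := le_trans h1 h2; rewrite leNgt ba.
have cn : {within `[a, b], continuous (fun t => `|g t|)}.
  by apply: continuous_subspaceT => t; apply: cvg_norm; exact: cg.
have [c cab hc] := EVT_max ab cn; exists `|g c|; split => // t.
have [tab|tab] := pselect (a <= t <= b); first by apply: hc; rewrite in_itv.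
by rewrite h// normr0.
Qed.

End test_functions.

Section weak_derivative_of_primitive.
Context {R : realType}.
Local Notation mu := (@lebesgue_measure R).
Local Notation TR := (measurableTypeR R).
Context {Y : completeNormedModType R}.
Local Notation ap := (@approximable R Y setT Num.norm).

Definition rcont (h : R -> R) t := forall e, 0 < e -> exists2 d, 0 < d &
    forall r, `|r - t| < d -> `|h r - h t| <= e.

Lemma continuous_rcont (h : R -> R) t : {for t, continuous h} -> rcont h t.
Proof.
move=> ch e e0; have /cvgrPdist_le/(_ _ e0)/nbhs_ballP[d /= d0 hd] := ch.
by exists d => // r rt; rewrite distrC; apply: hd; rewrite /ball/= distrC.
Qed.

Lemma tcont_mulr (D : set R) (h : R -> R) (u : R -> Y) t : rcont h t -> tcont D u t ->
  tcont D (fun r => h r *: u r) t.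
Proof.
move=> ch cu e e0.
set L := 1 + `|h t| + `|u t|.
have L0 : 0 < L by rewrite /L -addrA ltr_wpDr// addr_ge0.
have eL : 0 < Num.min 1 (e / L) by rewrite lt_min ltr01 divr_gt0.
have [d d0 hd] := ch _ eL; have [d' d'0 hd'] := cu _ eL.
exists (Num.min d d'); first by rewrite lt_min d0.
move=> r Dr; rewrite lt_min => /andP[/hd h1 /(hd' _ Dr) h2].
have -> : h r *: u r - h t *: u t = h r *: (u r - u t) + (h r - h t) *: u t.
  by rewrite scalerBr scalerBl addrA subrK.
apply: le_trans (ler_normD _ _) _; rewrite !normrZ.
move: h1 h2; rewrite !le_min => /andP[h1 h1'] /andP[_ h2].
have hr : `|h r| <= 1 + `|h t|.
  have := ler_normD (h r - h t) (h t); rewrite subrK; lra.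
apply: le_trans (lerD (ler_pM _ _ hr h2) (ler_wpM2r _ h1')) _ => //.
by rewrite (mulrC (e / L)) -mulrDl -/L mulrC divfK ?gt_eqF.
Qed.

Lemma tcont_cst (D : set R) (y : Y) t : tcont D (fun=> y) t.
Proof. by move=> e e0; exists 1 => // r _ _; rewrite subrr normr0 ltW. Qed.

Lemma tcontD (D : set R) (u v : R -> Y) t : tcont D u t -> tcont D v t ->
  tcont D (fun r => u r + v r) t.
Proof.
move=> hu hv e e0; have e20 : 0 < e / 2 by rewrite divr_gt0.
have [d d0 hd] := hu _ e20; have [d' d'0 hd'] := hv _ e20.
exists (Num.min d d'); first by rewrite lt_min d0.
move=> r Dr; rewrite lt_min => /andP[/(hd _ Dr) h1 /(hd' _ Dr) h2].
by rewrite opprD addrACA (splitr e); apply: le_trans (ler_normD _ _) _; exact: lerD.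
Qed.

(** The product of [phi] and [u] vanishes at both ends, so the fundamental theorem
    applied to it gives the formula.  The interval is enlarged to [tau + 1] because
    that theorem evaluates before the right endpoint only. *)
Lemma test_by_parts tau a phi (u v : R -> Y) B : test_function tau phi ->
  ap (oi (tau + 1)) v ->
  (forall t, 0 < t < tau + 1 -> t != a -> tcont (oi (tau + 1)) v t /\ tderive u t (v t)) ->
  (forall t, 0 < t < tau + 1 -> `|u t| <= B /\ `|v t| <= B) ->
  (forall t, 0 <= t < tau + 1 -> tcont [set r | 0 <= r < tau + 1] u t) -> 0 < tau ->
  bochner (oi tau) (fun t => derive1 phi t *: u t) = - bochner (oi tau) (fun t => phi t *: v t).
Proof.
move=> hphi va dv uB cu tau0.
have cp := test_continuous hphi; have cd := test_derive_continuous hphi.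
have [c [d [c0 dt z1 z2]]] := test_support hphi.
have [B1 [B10 hB1]] := support_bounded cp z1.
have [B2 [B20 hB2]] := support_bounded cd z2.
have B0 : 0 <= B.
  apply: le_trans (uB (tau / 2) _).1 => //.
  by rewrite divr_gt0//= ltr_pdivrMr// mulrDl mul1r ltr_wpDr// ltr_pMr// ltr1n.
have ua : ap (oi (tau + 1)) u.
  apply: (@tcont_approximable _ _ _ _ B) => t tt; last by case: (uB t tt).
  have /andP[t0 t1] := tt.
  by apply: tcontS (cu t _) => [r /andP[r0 r1]|]; apply/andP; split => //; exact: ltW.
have mp : measurable_fun [set: R] phi by exact: continuous_measurable_fun.
have md : measurable_fun [set: R] (derive1 phi) by exact: continuous_measurable_fun.
have pva t : ap (oi t) v -> ap (oi t) (fun r => phi r *: v r).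
  by move=> h; apply: (approximable_mulr _ _ mp hB1).
have dua t : ap (oi t) u -> ap (oi t) (fun r => derive1 phi r *: u r).
  by move=> h; apply: (approximable_mulr _ _ md hB2).
have ka := approximableD (measurable_oi _) (dua _ ua) (pva _ va).
have tt1 : tau <= tau + 1 by rewrite lerDl.
have := @ftc _ _ (tau + 1) a (fun r => derive1 phi r *: u r + phi r *: v r)
  (fun r => phi r *: u r) ka.
move=> /(_ _ _ _ tau) H.
have ptau : phi tau = 0 by apply: z1 => /andP[_]; rewrite leNgt dt.
have p0 : phi 0 = 0 by apply: z1 => /andP[]; rewrite leNgt c0.
rewrite ptau p0 !scale0r add0r in H.
apply/eqP; rewrite -subr_eq0 opprK -bochnerD//; last 2 first.
- by apply: dua; exact: approximable_oi ua.
- by apply: pva; exact: approximable_oi va.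
apply/eqP; apply/esym; apply: H.
- move=> t _; exists (B2 * B + B1 * B), 1; split => // r rr _.
  have [b1 b2] := uB r rr.
  by apply: le_trans (ler_normD _ _) _; rewrite !normrZ; apply: lerD; apply: ler_pM.
- move=> t tt ta; have [cv du] := dv t tt ta; have /andP[t0 t1] := tt; split.
    apply: tcontD; apply: tcont_mulr => //.
    + by apply: continuous_rcont; exact: cd.
    + exact: tderive_tcont du.
    + by apply: continuous_rcont; exact: cp.
  by apply: tderive_mul => //; exact: (test_is_derive hphi).
- move=> t tt; apply: tcont_mulr; last exact: cu.
  by apply: continuous_rcont; exact: cp.
- by rewrite ltW//= ltrDl.
Qed.

(** Blocks are differences of these; each has a single jump, which is what
    [test_by_parts] allows. *)
Definition step_up (y : Y) (a t : R) : Y := if a <= t then y else 0.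

Lemma finite_measurable_step_up y a : finite_measurable (step_up y a).
Proof.
have -> : step_up y a = fun t => if t \in (`[a, +oo[%classic : set TR) then y else 0.
  apply/funext => t; rewrite /step_up; case: ifPn => tab.
    by rewrite mem_set//= in_itv/= andbT.
  by rewrite memNset//= in_itv/= andbT; exact/negP.
by apply: (finite_measurable_patch _ _ (finite_measurable_cst y)); exact: measurable_itv.
Qed.

Lemma step_up_approximable A y a : ap A (step_up y a).
Proof. exact/simple_approximable/finite_measurable_simple/finite_measurable_step_up. Qed.

Lemma step_up_tcont D y a t : t != a -> tcont D (step_up y a) t.
Proof.
move=> ta e e0; exists `|t - a|; first by rewrite normr_gt0 subr_eq0.
move=> r _; rewrite /step_up; have [at_|ta'] := leP a t.
  rewrite (ger0_norm (_ : 0 <= t - a)) ?subr_ge0// ltr_norml => rt.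
  by rewrite (_ : a <= r) ?subrr ?normr0 ?ltW//; lra.
rewrite (distrC t a) (ger0_norm (_ : 0 <= a - t)) ?subr_ge0 ?(ltW ta')// ltr_norml => rt.
by rewrite (leNgt a r) (_ : r < a) /= ?subrr ?normr0 ?ltW//; lra.
Qed.

(** [v] is the weak derivative of [u] on (0, tau), together with the
    approximability that makes both integrals meaningful. *)
Definition weak_pair tau (u v : R -> Y) := [/\ ap (oi tau) u, ap (oi tau) v &
  forall phi, test_function tau phi ->
  bochner (oi tau) (fun t => derive1 phi t *: u t) = - bochner (oi tau) (fun t => phi t *: v t)].

Lemma weak_pair_cst tau (x : Y) : 0 < tau -> weak_pair tau (fun=> x) (fun=> 0).
Proof.
move=> tau0; split; [exact/simple_approximable/finite_measurable_simple/finite_measurable_cst|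
  exact/simple_approximable/finite_measurable_simple/finite_measurable_cst|] => phi hphi.
apply: (@test_by_parts tau (-1) phi (fun=> x) (fun=> 0) `|x|) => //.
- exact/simple_approximable/finite_measurable_simple/finite_measurable_cst.
- by move=> t _ _; split; [exact: tcont_cst|exact: tderive_cst].
- by move=> t _; rewrite normr0.
- by move=> t _; exact: tcont_cst.
Qed.

Lemma weak_pair_step_up tau y a : 0 < tau ->
  weak_pair tau (primitive (step_up y a)) (step_up y a).
Proof.
move=> tau0; pose B := `|y| * (tau + 2).
have sb t : `|step_up y a t| <= `|y| by rewrite /step_up; case: ifP => // _; rewrite normr0.
have lb t : 0 <= t -> `|primitive (step_up y a) t| <= `|y| * t.
  move=> t0; have := @primitive_increment _ _ (step_up y a) 0 t `|y| 0 (lexx 0) t0 (normr_ge0 y).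
  rewrite scaler0 primitive0 !subr0; apply; first exact: step_up_approximable.
  by move=> r _ _ _; rewrite subr0.
have cu t s : 0 <= t < s -> tcont [set r | 0 <= r < s] (primitive (step_up y a)) t.
  move=> tt; apply: tcont_primitive => //; first exact: step_up_approximable.
  by exists `|y|, 1; split => // r _ _.
have H phi : test_function tau phi -> 
  bochner (oi tau) (fun t => derive1 phi t *: primitive (step_up y a) t) =
  - bochner (oi tau) (fun t => phi t *: step_up y a t).
  move=> hphi; apply: (@test_by_parts tau a phi _ _ B) => //.
  - exact: step_up_approximable.
  - move=> t tt ta; split; first exact: step_up_tcont.
    by apply: (tderive_primitive tt); [exact: step_up_approximable|exact: step_up_tcont].
  - move=> t /andP[t0 t1]; split; rewrite /B.
      by apply: le_trans (lb t (ltW t0)) _; apply: ler_wpM2l => //; lra.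
    by apply: le_trans (sb t) _; rewrite ler_peMr//; lra.
  - by move=> t tt; exact: cu.
split => //; last exact: step_up_approximable.
apply: (@tcont_approximable _ _ _ _ (`|y| * tau)) => t /andP[t0 t1].
  by apply: tcontS (cu t tau _) => [r /andP[r0 r1]|]; apply/andP; split => //; exact: ltW.
by apply: le_trans (lb t (ltW t0)) _; apply: ler_wpM2l => //; exact: ltW.
Qed.

Lemma weak_pair_linear tau a u v u' v' : weak_pair tau u v -> weak_pair tau u' v' ->
  weak_pair tau (fun t => a *: u t + u' t) (fun t => a *: v t + v' t).
Proof.
move=> [ua va h] [ua' va' h']; split.
- by apply: approximableD => //; exact: approximableZ.
- by apply: approximableD => //; exact: approximableZ.
move=> phi hphi.
have cp := test_continuous hphi; have cd := test_derive_continuous hphi.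
have [c [d [c0 dt z1 z2]]] := test_support hphi.
have [B1 [B10 hB1]] := support_bounded cp z1.
have [B2 [B20 hB2]] := support_bounded cd z2.
have mp : measurable_fun [set: R] phi by exact: continuous_measurable_fun.
have md : measurable_fun [set: R] (derive1 phi) by exact: continuous_measurable_fun.
have pa (w : R -> Y) : ap (oi tau) w -> ap (oi tau) (fun r => phi r *: w r).
  by move=> hw; apply: (approximable_mulr _ _ mp hB1).
have da (w : R -> Y) : ap (oi tau) w -> ap (oi tau) (fun r => derive1 phi r *: w r).
  by move=> hw; apply: (approximable_mulr _ _ md hB2).
have E (g : R -> R) (w w' : R -> Y) : ap (oi tau) (fun t => g t *: w t) -> ap (oi tau) (fun t => g t *: w' t) ->
    bochner (oi tau) (fun t => g t *: (a *: w t + w' t)) =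
    a *: bochner (oi tau) (fun t => g t *: w t) + bochner (oi tau) (fun t => g t *: w' t).
  move=> h1 h2; rewrite -bochnerZ// -bochnerD//; last exact: approximableZ.
  by congr bochner; apply/funext => t; rewrite scalerDr !scalerA mulrC.
rewrite (E (derive1 phi) u u' (da _ ua) (da _ ua')) (E phi v v' (pa _ va) (pa _ va')).
by rewrite h// h'// opprD scalerN.
Qed.

Lemma weak_pair_sum tau n (u v : nat -> R -> Y) : 0 < tau ->
  (forall j, weak_pair tau (u j) (v j)) ->
  weak_pair tau (fun t => \sum_(j < n) u j t) (fun t => \sum_(j < n) v j t).
Proof.
move=> tau0 h; elim: n => [|n IH].
  have E (w : nat -> R -> Y) : (fun t => \sum_(j < 0) w j t) = (fun=> 0).
    by apply/funext => t; rewrite big_ord0.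
  by rewrite !E; exact: weak_pair_cst.
have := weak_pair_linear 1 IH (h n).
suff E (w : nat -> R -> Y) : (fun t => 1 *: (\sum_(j < n) w j t) + w n t) = (fun t => \sum_(j < n.+1) w j t).
  by rewrite !E.
by apply/funext => t; rewrite scale1r big_ord_recr.
Qed.

Lemma weak_pair_limit tau u v : 0 < tau -> ap (oi tau) u -> ap (oi tau) v ->
  (forall e, 0 < e -> exists u' v', [/\ weak_pair tau u' v',
     forall t, 0 < t < tau -> `|u t - u' t| <= e & upper_le (oi tau) (fun t => `|v t - v' t|) e]) ->
  weak_pair tau u v.
Proof.
move=> tau0 ua va H; split => // phi hphi.
have cp := test_continuous hphi; have cd := test_derive_continuous hphi.
have [c [d [c0 dt z1 z2]]] := test_support hphi.
have [B1 [B10 hB1]] := support_bounded cp z1.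
have [B2 [B20 hB2]] := support_bounded cd z2.
have mp : measurable_fun [set: R] phi by exact: continuous_measurable_fun.
have md : measurable_fun [set: R] (derive1 phi) by exact: continuous_measurable_fun.
have pa (w : R -> Y) : ap (oi tau) w -> ap (oi tau) (fun r => phi r *: w r).
  by move=> hw; apply: (approximable_mulr _ _ mp hB1).
have da (w : R -> Y) : ap (oi tau) w -> ap (oi tau) (fun r => derive1 phi r *: w r).
  by move=> hw; apply: (approximable_mulr _ _ md hB2).
apply: norm_small_eq => e e0; rewrite opprK.
have L0 : 0 < B2 * tau + B1 + 1 by rewrite ltr_wpDl// addr_ge0// mulr_ge0// ltW.
have eL : 0 < e / (B2 * tau + B1 + 1) by rewrite divr_gt0.
have [u' [v' [[ua' va' h'] uu vv]]] := H _ eL.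
have e1 : `|bochner (oi tau) (fun t => derive1 phi t *: u t) -
    bochner (oi tau) (fun t => derive1 phi t *: u' t)| <= B2 * (e / (B2 * tau + B1 + 1) * tau).
  apply: bochner_dist => //; [exact: da|exact: da|].
  have uc := upper_le_cst (measurable_oi tau) (finite_oi tau) (ltW eL).
  rewrite [X in fine X](measure_oi (ltW tau0))/= in uc.
  apply: upper_le_le (upper_leZ (measurable_oi tau) B20 uc) => t tt.
  by rewrite -scalerBr normrZ; apply: ler_pM => //; exact: uu.
have e2 : `|bochner (oi tau) (fun t => phi t *: v t) -
    bochner (oi tau) (fun t => phi t *: v' t)| <= B1 * (e / (B2 * tau + B1 + 1)).
  apply: bochner_dist => //; [exact: pa|exact: pa|].
  apply: upper_le_le (upper_leZ (measurable_oi tau) B10 vv) => t tt.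
  by rewrite -scalerBr normrZ; apply: ler_wpM2r.
have := h' phi hphi => /eqP; rewrite -subr_eq0 opprK => /eqP h0.
set a := bochner _ _ in e1 h0 *; set a' := bochner _ _ in e1 h0.
set b := bochner _ _ in e2 h0 *; set b' := bochner _ _ in e2 h0.
have -> : a + b = (a - a') + (b - b') by rewrite addrACA -opprD h0 subr0.
apply: le_trans (ler_normD _ _) _; apply: le_trans (lerD e1 e2) _.
have -> : B2 * (e / (B2 * tau + B1 + 1) * tau) + B1 * (e / (B2 * tau + B1 + 1)) =
  (B2 * tau + B1) * (e / (B2 * tau + B1 + 1)) by ring.
rewrite mulrA ler_pdivrMr// mulrC; apply: ler_wpM2l; first exact: ltW.
by rewrite lerDl.
Qed.

(** True for step functions by adding up the jumps one at a time, and passes to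
    the limit in L^1. *)
Theorem weak_pair_primitive tau x v u : 0 < tau -> ap (oi tau) v ->
  ap (oi tau) u ->
  (forall t, 0 < t < tau -> u t = x + primitive v t) -> weak_pair tau u v.
Proof.
move=> tau0 va ua uE; apply: weak_pair_limit => // e e0.
have [N hN] := grid_approximable_approximable tau0 va e0.
have [y hy] := hN N (leqnn N).
pose m := (Num.truncn (tau * N.+1%:R)).+1.
pose a j : R := j%:R / N.+1%:R.
pose v' t := \sum_(j < m) block (y j) (a j) (a j.+1) t.
have aa j : a j <= a j.+1 by rewrite ler_pM2r ?invr_gt0// ler_nat.
have blkE z b c t : b <= c -> block z b c t = step_up z b t - step_up z c t.
  move=> bc; rewrite /block /step_up; have [ct|tc] := leP c t.
    by rewrite (le_trans bc ct)/= subrr.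
  by rewrite andbT subr0.
have v'E t : 0 < t < tau -> v' t = y (grid tau N t).
  move=> /andP[t0 tt]; rewrite /v' block_sumE// /grid mem_set; last by apply/andP.
  rewrite (_ : (_ < m)%N)// ltnS; apply: le_truncn; apply: ler_wpM2r => //; exact: ltW.
have dist : upper_le (oi tau) (fun t => `|v t - v' t|) e.
  by apply: upper_le_le hy => t tt; rewrite v'E.
have v'a t : ap (oi t) v'.
  by apply: (@approximable_sum R Y m (fun j => block (y j) (a j) (a j.+1)) (oi t)) => // j; exact: block_approximable.
exists (fun t => x + primitive v' t), v'; split => //; last first.
  move=> t /[dup] tt /andP[t0 t1]; rewrite uE// opprD addrACA subrr add0r.
  apply: bochner_dist => //.
    by apply: approximable_oi va; exact: ltW.
  apply: upper_leS (dist) => //; apply: subset_oi; exact: ltW.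
have w1 : weak_pair tau (fun t => \sum_(j < m) (primitive (step_up (y j) (a j)) t - primitive (step_up (y j) (a j.+1)) t))
   (fun t => \sum_(j < m) (step_up (y j) (a j) t - step_up (y j) (a j.+1) t)).
  apply: (@weak_pair_sum tau m (fun j t => primitive (step_up (y j) (a j)) t - primitive (step_up (y j) (a j.+1)) t)
    (fun j t => step_up (y j) (a j) t - step_up (y j) (a j.+1) t)) => // j.
  have := weak_pair_linear (-1) (weak_pair_step_up (y j) (a j.+1) tau0) (weak_pair_step_up (y j) (a j) tau0).
  suff E (p q : R -> Y) : (fun t => -1 *: p t + q t) = (fun t => q t - p t) by rewrite !E.
  by apply/funext => t; rewrite scaleN1r addrC.
have := weak_pair_linear 1 (weak_pair_cst x tau0) w1.
have -> : (fun t => 1 *: 0 + \sum_(j < m) (step_up (y j) (a j) t - step_up (y j) (a j.+1) t)) = v'.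
  apply/funext => t; rewrite scaler0 add0r; apply: eq_bigr => j _; by rewrite blkE.
suff -> : (fun t => 1 *: x + \sum_(j < m) (primitive (step_up (y j) (a j)) t - primitive (step_up (y j) (a j.+1)) t)) =
   (fun t => x + primitive v' t) by [].
apply/funext => t; rewrite scale1r; congr (_ + _).
rewrite /v' (@primitive_sum R Y m (fun j => block (y j) (a j) (a j.+1))); last by move=> j; exact: block_approximable.
apply: eq_bigr => j _; rewrite /primitive -bochnerB//; try exact: step_up_approximable.
by congr bochner; apply/funext => r; rewrite blkE.
Qed.

End weak_derivative_of_primitive.

(** * Mild solutions with a cost are strong solutions *)

Section strong_solutions.
Context {R : realType}.
Local Notation mu := (@lebesgue_measure R).
Local Notation TR := (measurableTypeR R).
Context {Y : completeNormedModType R}.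
Local Notation ap := (@approximable R Y setT Num.norm).
Local Notation pos := (@pos R).
Variables (F : R -> Y -> Y) (M : R).
Hypothesis F_c0 : c0_semigroup F.
Hypothesis F_bound : forall t y, 0 <= t -> `|F t y| <= M * `|y|.
Hypothesis M_ge0 : 0 <= M.
Local Notation P := (orbit_integral F).
Local Notation G := (gen_op F).

(** The operators [P h / h] tend to the identity pointwise, hence uniformly on
    the finite range of a simple function. *)
Lemma mollifier_near (r : seq Y) d : 0 < d -> exists2 h0, 0 < h0 &
  forall h, 0 < h < h0 -> {in r, forall y, `|h^-1 *: P h y - y| <= d}.
Proof.
move=> d0; elim: r => [|y r [h0 h00 IH]]; first by exists 1.
have [h1 h10 hy] := orbit_integral_near0 F_c0 F_bound M_ge0 y d0.
exists (Num.min h0 h1); first by rewrite lt_min h00.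
move=> h /andP[hp]; rewrite lt_min => /andP[hh0 hh1] z; rewrite in_cons => /predU1P[->|zr].
  have -> : h^-1 *: P h y - y = h^-1 *: (P h y - h *: y).
    by rewrite scalerBr scalerA mulVf ?scale1r// gt_eqF.
  rewrite normrZ gtr0_norm ?invr_gt0// mulrC ler_pdivrMr//; apply: hy.
  by rewrite ltW.
by apply: IH => //; rewrite hp.
Qed.

(** Simple functions for the graph norm are obtained from simple functions [s2]
    near [u] by the smoothing operator [J = P h / h], which maps into the domain.
    First [h] is fixed so that [J] hardly moves the approximants of [u] and of
    [w = G u]; since [G J] has norm at most [(M + 1) / h], then [s2] is chosen so
    close to [u] that the generator cannot spoil it. *)
Lemma graph_approximable (A : set TR) u w : measurable A -> (mu A < +oo)%E ->
  ap A u -> ap A w -> {ae mu, forall t, A t -> gen_graph F (u t) (w t)} ->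
  approximable (gen_dom F) (graph_norm G) A u.
Proof.
move=> mA finA ua wa uw e e0.
pose m := fine (mu A); have m0 : 0 <= m by rewrite fine_ge0.
have L0 : 0 < 4 * (M + 1 + m) by rewrite mulr_gt0// -addrA ltr_wpDl// ltr_pwDl.
pose d := e / (4 * (M + 1 + m)); have d0 : 0 < d by rewrite divr_gt0.
have [s /simple_finite_measurable fs su] := ua _ d0.
have [s' /simple_finite_measurable fs' sw] := wa _ d0.
have /finite_seqP[r rE] := proj1 fs; have /finite_seqP[r' rE'] := proj1 fs'.
have [h0 h00 hh] := mollifier_near (r ++ r') d0.
pose h := h0 / 2; have hp : 0 < h by rewrite divr_gt0.
have hl : 0 < h < h0 by rewrite hp/= /h ltr_pdivrMr// ltr_pMr// ltr1n.
pose J y := h^-1 *: P h y.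
have Jb y : `|J y| <= M * `|y|.
  rewrite /J normrZ gtr0_norm ?invr_gt0// mulrC ler_pdivrMr// mulrAC.
  exact: (orbit_integral_bound F_c0 F_bound M_ge0 _ (ltW hp)).
have lP : linear (P h) by exact: (orbit_integral_linear F_c0 F_bound M_ge0).
have JB y z : J (y - z) = J y - J z by rewrite /J (linear_sub lP) scalerBr.
have Js t : `|J (s t) - s t| <= d.
  apply: (hh h hl); rewrite mem_cat; apply/orP; left.
  by have : range s (s t) by [exists t]; rewrite rE.
have Js' t : `|J (s' t) - s' t| <= d.
  apply: (hh h hl); rewrite mem_cat; apply/orP; right.
  by have : range s' (s' t) by [exists t]; rewrite rE'.
have D0 : 0 < 2 * (M + h^-1 * (M + 1)).
  by rewrite mulr_gt0// ltr_wpDl// mulr_gt0 ?invr_gt0// ltr_wpDl.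
pose d2 := e / (2 * (M + h^-1 * (M + 1))); have d20 : 0 < d2 by rewrite divr_gt0.
have [s2 /simple_finite_measurable fs2 su2] := ua _ d20.
have gJ y : gen_graph F (J y) (h^-1 *: (F h y - y)).
  have := gen_graph_linear F_c0 F_bound M_ge0 h^-1
    (gen_graph_orbit_integral F_c0 F_bound M_ge0 y (ltW hp)) (gen_graph0 F_c0 F_bound M_ge0).
  by rewrite !addr0.
exists (fun t => J (s2 t)).
  have [fr mr] := finite_measurable_comp J fs2; split => // _ [t _ <-].
  by have [] := (gen_graphP F (J (s2 t)) (h^-1 *: (F h (s2 t) - s2 t))).1 (gJ _).
have ud : upper_le A (fun=> d) (d * m) by exact: upper_le_cst (ltW d0).
have b1 := upper_leD mA (upper_leZ mA M_ge0 su2) (upper_leD mA (upper_leZ mA (addr_ge0 M_ge0 ler01) su) ud).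
have hM : 0 <= h^-1 * (M + 1) by rewrite mulr_ge0 ?invr_ge0 ?(ltW hp)// addr_ge0.
have b2 := upper_leD mA (upper_leZ mA hM su2) (upper_leD mA (upper_leZ mA (addr_ge0 M_ge0 ler01) sw) ud).
have Ee : M * d2 + ((M + 1) * d + d * m) + (h^-1 * (M + 1) * d2 + ((M + 1) * d + d * m)) = e.
  have E1 D : 0 < 2 * D -> D * (e / (2 * D)) = e / 2 by rewrite pmulr_rgt0// => /lt0r_neq0 ?; field.
  have E2 D : 0 < 4 * D -> 2 * D * (e / (4 * D)) = e / 2 by rewrite pmulr_rgt0// => /lt0r_neq0 ?; field.
  have -> : M * d2 + ((M + 1) * d + d * m) + (h^-1 * (M + 1) * d2 + ((M + 1) * d + d * m)) =
    (M + h^-1 * (M + 1)) * d2 + 2 * (M + 1 + m) * d by ring.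
  by rewrite /d2 /d E1// E2// -splitr.
have tele A1 U B C S : A1 - U = (A1 - B) + ((B - C + (S - U)) + (C - S)) :> Y.
  by rewrite (addrAC (B - C)) (addrA (B - C)) subrK (addrA (B - S)) subrK addrA subrK.
rewrite -Ee; apply: upper_leW (upper_leD mA b1 b2) => //.
apply: ae_imply uw => t {}uw At; have {}uw := uw At.
rewrite /graph_norm; apply: lerD.
  have -> : J (s2 t) - u t = J (s2 t - u t) + ((J (u t - s t) + (s t - u t)) + (J (s t) - s t)).
    by rewrite !JB; exact: tele.
  apply: le_trans (ler_normD _ _) _; apply: lerD; first exact: Jb.
  apply: le_trans (ler_normD _ _) _; apply: lerD; last exact: Js.
  apply: le_trans (ler_normD _ _) _; rewrite mulrDl mul1r; apply: lerD => //.
  by rewrite (distrC (s t)); exact: Jb.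
have gd : gen_graph F (J (s2 t) - u t) (h^-1 *: (F h (s2 t) - s2 t) - w t).
  have := gen_graph_linear F_c0 F_bound M_ge0 (-1) uw (gJ (s2 t)).
  by rewrite !scaleN1r addrC [X in gen_graph _ _ X]addrC.
have [_ ->] := (gen_graphP F _ _).1 gd.
have lF : linear (F h) by case: F_c0 => hF _ _ _; case: (hF h (ltW hp)).
have -> : h^-1 *: (F h (s2 t) - s2 t) - w t =
    h^-1 *: (F h (s2 t - u t) - (s2 t - u t)) + ((J (w t - s' t) + (s' t - w t)) + (J (s' t) - s' t)).
  have Jw : J (w t) = h^-1 *: (F h (u t) - u t).
    by rewrite /J (orbit_integral_gen F_c0 F_bound M_ge0 (ltW hp) uw).
  have -> : h^-1 *: (F h (s2 t - u t) - (s2 t - u t)) = h^-1 *: (F h (s2 t) - s2 t) - J (w t).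
    rewrite Jw -scalerBr (linear_sub lF) !opprB addrACA [in RHS]addrACA.
    by congr (_ *: (_ + _)); exact: addrC.
  by rewrite JB; exact: tele.
apply: le_trans (ler_normD _ _) _; apply: lerD.
  rewrite normrZ gtr0_norm ?invr_gt0// -mulrA; apply: ler_wpM2l; first by rewrite invr_ge0 ltW.
  apply: le_trans (ler_normB _ _) _; rewrite mulrDl mul1r; apply: lerD => //.
  exact: F_bound (ltW hp).
apply: le_trans (ler_normD _ _) _; apply: lerD; last exact: Js'.
apply: le_trans (ler_normD _ _) _; rewrite mulrDl mul1r; apply: lerD => //.
by rewrite (distrC (s' t)); exact: Jb.
Qed.

Lemma approximable_in_L1 tau f : ap (oi tau) f -> in_L1 setT Num.norm (oi tau) f.
Proof.
move=> fa; split; first by apply: approximable_strongly_measurable => //; exact: aeW.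
have [c hc] := approximable_upper_bound (measurable_oi tau) (finite_oi tau) fa.
by apply: le_lt_trans (ltry c); exact: integral_le_upper.
Qed.

Lemma measurable_time_interval (T : \bar R) : measurable (time_interval T : set TR).
Proof.
case: T => [r| |].
- rewrite (_ : time_interval r%:E = oi r)//.
  apply/seteqP; split => t; rewrite /time_interval /oi /= lte_fin; first by move=> [-> ->].
  by move=> /andP[-> ->].
- rewrite (_ : time_interval +oo%E = pos)//.
  by apply/seteqP; split => t; rewrite /time_interval /pos /= ltry; [case|].
- rewrite (_ : time_interval -oo%E = set0)//.
  by apply/seteqP; split => t //; rewrite /time_interval /= => -[_]; rewrite ltNge leNye.
Qed.

Lemma mild_strong_solution (T : \bar R) x f ft u w c : (0 < T)%E ->
  (forall t, time_interval T t -> ft t = f t) ->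
  mild_solution F x ft u w c ->
  strong_solution F T x f u (fun t => w t + ft t).
Proof.
move=> T0 ftE [[cu fa wa] uE uw uc wc]; split.
- apply/tcont_within => t [t0 tT].
  by apply: tcontS (cu t t0) => r [].
- move=> tau tau0 tauT.
  have ua : ap (oi tau) u.
    apply: (@tcont_approximable _ _ _ _ c) => t /andP[t0 tt]; last by apply: uc; exact: ltW.
    by apply: tcontS (cu t (ltW t0)) => r /andP[r0 _]; exact: ltW.
  have va : ap (oi tau) (fun t => w t + ft t) by exact: approximableD.
  split; first split.
  + exact: approximable_in_L1.
  + exact: approximable_in_L1.
  + have [_ _ h] : weak_pair tau u (fun t => w t + ft t).
      by apply: (weak_pair_primitive (x := x)) => // t /andP[t0 _]; apply: uE; exact: ltW.
    exact: h.
  + have uwo : {ae mu, forall t, oi tau t -> gen_graph F (u t) (w t)}.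
      by apply: ae_imply uw => t h /andP[t0 _]; exact: h.
    split.
      apply: (approximable_strongly_measurable (measurable_oi tau)).
      - by move=> y; apply: addr_ge0.
      - by apply: ae_imply uwo => t h /h /gen_graphP[].
      - exact: graph_approximable uwo.
    have [c1 hc1] := approximable_upper_bound (measurable_oi tau) (finite_oi tau) ua.
    have [c2 hc2] := approximable_upper_bound (measurable_oi tau) (finite_oi tau) (wa tau).
    apply: le_lt_trans (ltry (c1 + c2)); apply: (integral_le_upper (measurable_oi tau)).
      by move=> t _; apply: addr_ge0.
    apply: upper_leW (upper_leD (measurable_oi tau) hc1 hc2) => //.
    apply: ae_imply uwo => t h ot; rewrite /graph_norm.
    by have [_ ->] := (gen_graphP F _ _).1 (h ot).
- apply: ae_imply uw => t h [t0 tT]; have [d ->] := (gen_graphP F _ _).1 (h t0).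
  by split => //; rewrite addrAC subrr add0r ftE.
- by rewrite uE// primitive0 addr0.
Qed.

Lemma ess_sup_bound (T : \bar R) u c : 0 <= c -> (forall t, 0 <= t -> `|u t| <= c) ->
  (Linfty_norm (time_interval T) (u : R -> Y) <= c%:E)%E.
Proof.
move=> c0 uc; rewrite /Linfty_norm; apply/ess_supP; apply: aeW => t.
rewrite patchE; case: ifPn => [/set_mem[t0 _]|_]; last by rewrite lee_fin.
by rewrite lee_fin; apply: uc; exact: ltW.
Qed.

(** The weak derivative is [w + f], so [u'] costs at most [c + L]. *)
Lemma mild_solution_estimate (T : \bar R) x (f ft u w : R -> Y) c L :
  mild_solution F x ft u w c -> 0 <= c ->
  upper_le pos (fun t => `|ft t|) L ->
  L1norm Num.norm (time_interval T) f = L%:E ->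
  (Linfty_norm (time_interval T) u
   + L1norm Num.norm (time_interval T) (fun t => w t + ft t)%R
   + L1norm Num.norm (time_interval T) (fun t => gen_op F (u t))
   <= (3 * c + L)%:E)%E.
Proof.
move=> [_ uE uw uc wc] c0 fL fE.
have TS : time_interval T `<=` pos by move=> t [].
have mT := measurable_time_interval T.
have h1 := ess_sup_bound T c0 uc.
have h2 : (L1norm Num.norm (time_interval T) (fun t => w t + ft t)%R <= (c + L)%:E)%E.
  apply: integral_le_upper => //; apply: (upper_leS mT measurable_pos TS).
  by apply: upper_le_le (upper_leD measurable_pos wc fL) => t _; exact: ler_normD.
have h3 : (L1norm Num.norm (time_interval T) (fun t => gen_op F (u t)) <= c%:E)%E.
  apply: integral_le_upper => //; apply: (upper_leS mT measurable_pos TS).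
  apply: upper_leW wc => //; apply: ae_imply uw => t h t0.
  by have [_ ->] := (gen_graphP F _ _).1 (h t0).
apply: le_trans (leeD (leeD h1 h2) h3) _.
by rewrite -!EFinD lee_fin; lra.
Qed.

End strong_solutions.

(** * A smooth step function *)

Section smooth_step.
Context {R : realType}.

(** [x^-k * exp (- 1 / x)], extended by 0.  This family is closed under
    differentiation up to linear combinations, which is what makes
    [exp (- 1 / x)] smooth at 0. *)
Definition flat (k : nat) (x : R) : R := if 0 < x then x^-1 ^+ k * expR (- x^-1) else 0.

(** A syntax of smooth functions: derivatives of such functions are again of this
    form, so smoothness of all orders needs only one differentiation step. *)
Inductive smooth_expr : (R -> R) -> Prop :=
| smooth_cst c : smooth_expr (fun=> c)
| smooth_flat k : smooth_expr (flat k)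
| smooth_affine a b f : smooth_expr f -> smooth_expr (fun x => f (a * x + b))
| smooth_add f g : smooth_expr f -> smooth_expr g -> smooth_expr (fun x => f x + g x)
| smooth_mul f g : smooth_expr f -> smooth_expr g -> smooth_expr (fun x => f x * g x)
| smooth_inv f : (forall x, f x != 0) -> smooth_expr f -> smooth_expr (fun x => (f x)^-1).

(** From the power series of the exponential at [1 / x].  Applied to
    [flat k.+1] it gives the derivative of [flat k] at 0. *)
Lemma flat_bound k x : `|flat k x| <= (k.+1)`!%:R * `|x|.
Proof.
rewrite /flat; case: ifPn => [x0|_]; last by rewrite normr0 mulr_ge0.
have y0 : 0 < x^-1 by rewrite invr_gt0.
rewrite (gtr0_norm x0) ger0_norm ?mulr_ge0 ?exprn_ge0 ?expR_ge0 ?(ltW y0)//.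
rewrite expRN ler_pdivrMr ?expR_gt0//.
have h : x^-1 ^+ k.+1 / k.+1`!%:R <= expR x^-1.
  by apply: le_trans (expR_ge1Dxn k (ltW y0)); rewrite lerDr.
rewrite ler_pdivrMr ?ltr0n ?fact_gt0// exprSr in h.
rewrite -(ler_pM2r y0) (_ : _ * x * _ * _ = expR x^-1 * k.+1`!%:R)//.
by field; rewrite gt_eqF.
Qed.

Lemma flatS k x : x != 0 -> x^-1 * flat k x = flat k.+1 x.
Proof. by move=> x0; rewrite /flat; case: ifP => _; rewrite ?mulr0// mulrA -exprS. Qed.

Lemma flat_is_derive k (x : R) : is_derive x (1 : R) (flat k) (- k%:R * flat k.+1 x + flat k.+2 x).
Proof.
have [x0|x0|x0] := ltgtP x 0.
- have z : \forall y \near x, cst 0 y = flat k y.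
    apply/nbhs_ballP; exists (- x); rewrite /= ?oppr_gt0// => r.
    by rewrite /ball/= ltr_norml /flat /cst => h; rewrite ifF//; apply/negbTE; rewrite -leNgt; lra.
  apply: (near_eq_is_derive z).
  by apply: is_derive_eq; rewrite /flat !(ltNge 0) (ltW x0)/= mulr0 addr0.
- have z : \forall y \near x, y^-1 ^+ k * expR (- y^-1) = flat k y.
    apply/nbhs_ballP; exists x; rewrite //= => r.
    by rewrite /ball/= ltr_norml /flat => h; rewrite ifT//; lra.
  apply: (near_eq_is_derive z).
  have x0' : x != 0 by rewrite gt_eqF.
  have d1 : is_derive x 1 (fun y : R => y^-1) (- x ^- 2 *: (1 : R)).
    exact: is_deriveV.
  have d2 : is_derive x 1 (fun y : R => expR (- y^-1)) (expR (- x^-1) * (- (- x ^- 2 *: (1 : R)))).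
    exact: (@is_derive1_comp _ expR (fun y => - y^-1)).
  have dk : is_derive x 1 (fun y : R => y^-1 ^+ k) (k%:R * x^-1 ^+ k.-1 * (- x ^- 2)).
    have := is_deriveX k d1; rewrite exprfctE => dk; apply: (is_derive_eq dk).
    by rewrite /GRing.scale /= mulr1 mulr_natl.
  apply: (is_derive_eq (is_deriveM dk d2)).
  rewrite /flat x0 /GRing.scale /=.
  rewrite -exprVn; set y := x^-1; set ex := expR _.
  case: k z dk => [|k] _ _ /=; first by ring.
  by rewrite !(exprS _ k) !exprS; set p := y ^+ k; set c := k.+1%:R; ring.
(* at 0 the difference quotient of [flat k] is [flat k.+1] *)
- rewrite {}x0.
  have gl : (h^-1 *: ((flat k \o shift 0) (h *: (1 : R)) - flat k 0)) @[h --> 0^'] --> (0 : R).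
    apply/cvgrPdist_le => /= e e0.
    have C0 : 0 < (k.+2)`!%:R :> R by rewrite ltr0n fact_gt0.
    rewrite near_withinE; apply/nbhs_ballP; exists (e / k.+2`!%:R); first exact: divr_gt0.
    move=> h /=; rewrite /ball/= sub0r normrN ltr_pdivlMr// => he h0.
    rewrite {2}/flat ltxx subr0 sub0r normrN addr0 -[_ *: _]/(_ * _) -[h *: _]/(h * 1) mulr1 flatS//.
    by apply: le_trans (flat_bound _ _) _; rewrite mulrC ltW.
  have dd : derivable (flat k) (0 : R) 1 by apply/cvg_ex; exists 0.
  split => //; rewrite /flat ltxx mulr0 addr0; exact: cvg_lim.
Qed.

Lemma smooth_expr_derive f : smooth_expr f ->
  exists2 f', smooth_expr f' & forall x, is_derive x (1 : R) f (f' x).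
Proof.
elim => {f}.
- by move=> c; exists (fun=> 0); [exact: smooth_cst|move=> x; exact: is_derive_cst].
- move=> k; exists (fun x => - k%:R * flat k.+1 x + flat k.+2 x); last exact: flat_is_derive.
  apply: smooth_add; last exact: smooth_flat.
  by apply: smooth_mul; [exact: smooth_cst|exact: smooth_flat].
- move=> a b f _ [f' sf' hf]; exists (fun x => f' (a * x + b) * a).
    apply: smooth_mul; last exact: smooth_cst.
    exact: (smooth_affine a b sf').
  move=> x; have d : is_derive x (1 : R) (fun y => a * y + b) a.
    have d := is_deriveD (is_deriveZ a (is_derive_id x (1 : R))) (is_derive_cst b x (1 : R)).
    by apply: (is_derive_eq d); rewrite addr0 -[_ *: _]/(_ * _) mulr1.
  exact: (@is_derive1_comp _ f (fun y => a * y + b)).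
- move=> f g _ [f' sf hf] _ [g' sg hg]; exists (fun x => f' x + g' x); first exact: smooth_add.
  by move=> x; exact: is_deriveD.
- move=> f g sf0 [f' sf hf] sg0 [g' sg hg]; exists (fun x => f x * g' x + g x * f' x).
    by apply: smooth_add; exact: smooth_mul.
  by move=> x; exact: is_deriveM.
- move=> f f0 sf0 [f' sf hf]; exists (fun x => - 1 * ((f x)^-1 * (f x)^-1) * f' x).
    apply: smooth_mul => //; apply: smooth_mul; first exact: smooth_cst.
    by apply: smooth_mul; exact: smooth_inv.
  move=> x; have d := is_deriveV (f0 x) (hf x).
  apply: (is_derive_eq d); rewrite -[_ *: _]/(_ * _); congr (_ * _).
  by rewrite mulN1r expr2 invfM.
Qed.

Lemma smooth_expr_derive1n f n : smooth_expr f -> smooth_expr (derive1n n f).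
Proof.
move=> sf; elim: n => [//|n IH]; rewrite derive1nS.
have [f' sf' hf] := smooth_expr_derive IH.
suff -> : derive1 (derive1n n f) = f' by [].
by apply/funext => x; rewrite derive1E derive_val.
Qed.

Lemma smooth_expr_derivable f n t : smooth_expr f -> derivable (derive1n n f) t (1 : R).
Proof.
by move=> /(smooth_expr_derive1n n)/smooth_expr_derive[f' _ h]; have [] := h t.
Qed.

Definition smooth_step (x : R) : R := flat 0 x * (flat 0 x + flat 0 (-1 * x + 1))^-1.

Lemma smooth_step_smooth : smooth_expr smooth_step.
Proof.
apply: smooth_mul; first exact: smooth_flat.
apply: smooth_inv => [x|].
  rewrite gt_eqF// /flat !expr0 !mul1r; case: ifPn => x0.
    by rewrite ltr_pwDl ?expR_gt0//; case: ifP => // _; rewrite expR_ge0.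
  by rewrite add0r ifT ?expR_gt0//; move: x0; rewrite -leNgt; lra.
apply: smooth_add; first exact: smooth_flat.
exact: (smooth_affine (-1) 1 (smooth_flat 0)).
Qed.

Lemma smooth_step0 x : x <= 0 -> smooth_step x = 0.
Proof. by move=> x0; rewrite /smooth_step {1}/flat ltNge x0 /= mul0r. Qed.

Lemma smooth_step1 x : 1 <= x -> smooth_step x = 1.
Proof.
move=> x1; rewrite /smooth_step [flat 0 (_ + _)]/flat ifF ?addr0; last by apply/negbTE; rewrite -leNgt; lra.
have x0 : 0 < x by lra.
by rewrite divff// /flat x0 expr0 mul1r gt_eqF// expR_gt0.
Qed.

End smooth_step.

(** * The lemma of du Bois-Reymond *)

Section smooth_step_profile.
Context {R : realType}.

Lemma smooth_step_profile : exists p : R -> R, exists B : R,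
  [/\ forall x, is_derive x (1 : R) smooth_step (p x), continuous p, 
    forall x, ~ (0 <= x <= 1) -> p x = 0, 0 <= B & forall x, `|p x| <= B].
Proof.
have [p sp hp] := smooth_expr_derive (@smooth_step_smooth R).
have cp : continuous p.
  have [q _ hq] := smooth_expr_derive sp.
  by move=> t; apply: differentiable_continuous; apply/derivable1_diffP; have [] := hq t.
have zp x : ~ (0 <= x <= 1) -> p x = 0.
  move=> nx.
  have z : \forall r \near x, smooth_step r = smooth_step x.
    have [x0|x0] := ltP x 0.
      apply/nbhs_ballP; exists (- x); rewrite /= ?oppr_gt0// => r.
      by rewrite /ball/= ltr_norml => xr; rewrite !smooth_step0 ?(ltW x0)//; lra.
    have x1 : 1 < x by rewrite ltNge; apply/negP => x1; apply: nx; rewrite x0 x1.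
    apply/nbhs_ballP; exists (x - 1); rewrite /= ?subr_gt0// => r.
    by rewrite /ball/= ltr_norml => xr; rewrite !smooth_step1 ?(ltW x1)//; lra.
  rewrite -(@derive_val _ _ _ _ _ _ _ (hp x)).
  by rewrite (@near_eq_derive _ _ _ _ (cst (smooth_step x)) _ _ z); exact: derive_cst.
have [B [B0 hB]] := support_bounded cp zp.
by exists p, B.
Qed.

End smooth_step_profile.

Section du_bois_reymond.
Context {R : realType}.
Local Notation mu := (@lebesgue_measure R).
Local Notation TR := (measurableTypeR R).
Context {Y : completeNormedModType R}.
Local Notation ap := (@approximable R Y setT Num.norm).
Variables (p : R -> R) (B : R).
Hypothesis hp : forall x, is_derive x (1 : R) smooth_step (p x).
Hypothesis cp : continuous p.
Hypothesis p0 : forall x, ~ (0 <= x <= 1) -> p x = 0.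
Hypothesis B_ge0 : 0 <= B.
Hypothesis pB : forall x, `|p x| <= B.

(** A smooth function that climbs from 0 to 1 on [a, a + d]. *)
Definition ramp (a d t : R) : R := smooth_step (d^-1 * t - d^-1 * a).
(** The derivative of [ramp], an approximate identity at [a]. *)
Definition bump (a d t : R) : R := p (d^-1 * t - d^-1 * a) * d^-1.

Lemma ramp_is_derive a d t : is_derive t (1 : R) (ramp a d) (bump a d t).
Proof.
have h : is_derive t (1 : R) (fun y => d^-1 * y - d^-1 * a) (d^-1).
  have h := is_deriveD (is_deriveZ d^-1 (is_derive_id t (1 : R))) (is_derive_cst (- (d^-1 * a)) t (1 : R)).
  by apply: (is_derive_eq h); rewrite addr0 -[_ *: _]/(_ * _) mulr1.
exact: (@is_derive1_comp _ smooth_step (fun y => d^-1 * y - d^-1 * a)).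
Qed.

Lemma ramp0 a d t : 0 < d -> t <= a -> ramp a d t = 0.
Proof. by move=> d0 ta; apply: smooth_step0; rewrite -mulrBr pmulr_rle0 ?invr_gt0// subr_le0. Qed.

Lemma ramp1 a d t : 0 < d -> a + d <= t -> ramp a d t = 1.
Proof.
move=> d0 ta; apply: smooth_step1; rewrite -mulrBr mulrC ler_pdivlMr//; lra.
Qed.

Lemma bump0 a d t : 0 < d -> ~ (a <= t <= a + d) -> bump a d t = 0.
Proof.
move=> d0 h; rewrite /bump p0 ?mul0r// -mulrBr => /andP[h1 h2]; apply: h.
move: h1 h2; rewrite pmulr_rge0 ?invr_gt0// subr_ge0 mulrC ler_pdivrMr// mul1r => -> /=.
by lra.
Qed.

Lemma bump_bound a d t : 0 < d -> `|bump a d t| <= B / d.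
Proof.
by move=> d0; rewrite normrM ler_pM// ger0_norm// invr_ge0 ltW.
Qed.

Lemma bump_continuous a d : continuous (bump a d).
Proof.
move=> t; apply: cvgM; last exact: cvg_cst.
apply: (@continuous_comp _ _ _ (fun t => d^-1 * t - d^-1 * a) p); last exact: cp.
by apply: cvgB; [apply: cvgM; [exact: cvg_cst|exact: cvg_id]|exact: cvg_cst].
Qed.

Lemma bump_measurable a d : measurable_fun [set: R] (bump a d).
Proof. by apply: continuous_measurable_fun; exact: bump_continuous. Qed.

Lemma approximable_bump a d tau (r : R -> Y) : 0 < d -> ap (oi tau) r ->
  ap (oi tau) (fun t => bump a d t *: r t).
Proof.
move=> d0 ra; apply: (approximable_mulr _ _ (bump_measurable a d) (fun t => bump_bound a t d0)) => //.
Qed.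

(** The total mass of [bump] is the height of [ramp]. *)
Lemma bochner_bump a d tau (y : Y) : 0 < d -> 0 <= a -> a + d < tau ->
  bochner (oi tau) (fun t => bump a d t *: y) = y.
Proof.
move=> d0 a0 adt.
have ca A : ap A (fun=> y) by exact/simple_approximable/finite_measurable_simple/finite_measurable_cst.
have := @ftc _ _ (tau + 1) (-1) (fun t => bump a d t *: y) (fun t => ramp a d t *: y)
  (approximable_bump a d0 (ca _)).
move=> /(_ _ _ _ tau) H.
rewrite ramp1 ?(ltW adt)// scale1r ramp0// scale0r add0r in H.
apply/esym; apply: H.
- move=> t _; exists (B / d * `|y|), 1; split => // r _ _.
  by rewrite normrZ ler_wpM2r// bump_bound.
- move=> t tt _; split.
    by apply: tcont_mulr; [apply: continuous_rcont; exact: bump_continuous|exact: tcont_cst].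
  have := tderive_mul (ramp_is_derive a d t) (tderive_cst y t).
  by rewrite scaler0 addr0.
- move=> t tt; apply: tcont_mulr; last exact: tcont_cst.
  apply: continuous_rcont; apply: differentiable_continuous; apply/derivable1_diffP.
  by have [] := ramp_is_derive a d t.
- by apply/andP; split; lra.
Qed.

(** The height of [bump] is at most [B / d] and its support has length [d]. *)
Lemma bochner_bump_near a d tau (r : R -> Y) e : 0 < d -> 0 <= a -> a + d < tau -> 0 <= e ->
  ap (oi tau) r -> (forall t, a <= t <= a + d -> `|r t - r a| <= e) ->
  `|bochner (oi tau) (fun t => bump a d t *: r t) - r a| <= B * e.
Proof.
move=> d0 a0 adt e0 ra he.
have ca A y : ap A (fun=> y : Y) by exact/simple_approximable/finite_measurable_simple/finite_measurable_cst.
rewrite -[X in _ - X](bochner_bump (r a) d0 a0 adt).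
pose I : set TR := `[a, a + d]%classic.
have mI : measurable I by exact: measurable_itv.
apply: bochner_dist => //; try exact: approximable_bump.
have BE0 : 0 <= B / d * e by rewrite mulr_ge0// divr_ge0// ltW.
have ub : upper_le (oi tau) (fun t => B / d * e * (\1_I t : R)) (B * e).
  apply: upper_le_measurable => //.
  - by apply: measurable_funM => //; exact: measurable_indic.
  - by move=> t; rewrite mulr_ge0.
  under eq_integral do rewrite EFinM.
  rewrite ge0_integralZl//; last by exact/measurable_EFinP/measurable_indic.
  rewrite integral_indic//.
  have h : (mu (I `&` oi tau) <= d%:E)%E.
    apply: (@le_trans _ _ (mu I)).
      by apply: le_measure; rewrite ?inE//; exact: measurableI.
    by rewrite lebesgue_measure_itv/= lte_fin ltrDl d0 -EFinD lee_fin addrAC subrr add0r.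
  apply: le_trans (lee_wpmul2l _ h) _; first by rewrite lee_fin.
  by rewrite -EFinM lee_fin mulrAC divfK ?gt_eqF.
apply: upper_le_le ub => t _.
have [tI|tI] := pselect (a <= t <= a + d); last first.
  by rewrite bump0// !scale0r subrr normr0 mulr_ge0.
rewrite indicE mem_set ?mulr1; last by rewrite /I /= in_itv.
by rewrite -scalerBr normrZ; apply: ler_pM => //; [exact: bump_bound|exact: he].
Qed.

(** Test with the difference of the two ramps at [a] and [b], which has compact
    support; its derivative averages [r] near [a] minus [r] near [b]. *)
Theorem du_bois_reymond tau (r : R -> Y) : ap (oi tau) r ->
  (forall t, 0 < t < tau -> tcont (oi tau) r t) ->
  (forall phi, test_function tau phi -> bochner (oi tau) (fun t => derive1 phi t *: r t) = 0) ->
  forall a b, 0 < a -> a <= b -> b < tau -> r a = r b.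
Proof.
move=> ra cr h a b a0 ab bt.
suff : r a - r b = 0 by move/eqP; rewrite subr_eq0 => /eqP.
apply: norm_small_eq => e e0.
have B1 : 0 < 2 * (B + 1) by rewrite mulr_gt0// ltr_wpDl.
pose e1 := e / (2 * (B + 1)); have e10 : 0 < e1 by rewrite divr_gt0.
have ta : 0 < a < tau by rewrite a0 (le_lt_trans ab bt).
have tb : 0 < b < tau by rewrite bt (lt_le_trans a0 ab).
have [d1 d10 h1] := cr a ta _ e10; have [d2 d20 h2] := cr b tb _ e10.
pose m := Num.min (Num.min d1 d2) (tau - b).
have m0 : 0 < m by rewrite !lt_min d10 d20 subr_gt0.
pose d := m / 2; have d0 : 0 < d by rewrite divr_gt0.
have [dd1 dd2 dt] : [/\ d < d1, d < d2 & d < tau - b].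
  have : d < m by rewrite ltr_pdivrMr// ltr_pMr// ltr1n.
  by rewrite /m !lt_min => /andP[/andP[-> ->] ->].
have b0 : 0 < b by case/andP: tb.
have dta : a + d < tau by lra.
have dtb : b + d < tau by lra.
have na : forall t, a <= t <= a + d -> `|r t - r a| <= e1.
  by move=> t /andP[t1 t2]; apply: h1; rewrite /oi /= ?ltr_norml; lra.
have nb : forall t, b <= t <= b + d -> `|r t - r b| <= e1.
  by move=> t /andP[t1 t2]; apply: h2; rewrite /oi /= ?ltr_norml; lra.
pose phi t := ramp a d t + -1 * ramp b d t.
have dphi t : derive1 phi t = bump a d t - bump b d t.
  have hd := is_deriveD (ramp_is_derive a d t) (is_deriveZ (-1) (ramp_is_derive b d t)).
  rewrite derive1E (@derive_val _ _ _ _ _ _ _ hd) -[_ *: _]/(_ * _); by rewrite mulN1r.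
have tphi : test_function tau phi.
  split.
    move=> n t; apply: smooth_expr_derivable; apply: smooth_add.
      exact: (smooth_affine d^-1 (- (d^-1 * a)) smooth_step_smooth).
    apply: smooth_mul; first exact: smooth_cst.
    exact: (smooth_affine d^-1 (- (d^-1 * b)) smooth_step_smooth).
  exists a, (b + d); split => // t nt; rewrite /phi.
  have [tla|tla] := leP t a; first by rewrite !ramp0// ?mulr0 ?addr0//; lra.
  have tbd : b + d < t by rewrite ltNge; apply/negP => h'; apply: nt; rewrite h' ltW.
  by rewrite !ramp1// ?mulr1 ?subrr//; lra.
have := h phi tphi.
have -> : (fun t => derive1 phi t *: r t) = (fun t => bump a d t *: r t - bump b d t *: r t).
  by apply/funext => t; rewrite dphi scalerBl.
rewrite bochnerB//; try exact: approximable_bump.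
have := bochner_bump_near d0 (ltW a0) dta (ltW e10) ra na.
have := bochner_bump_near d0 (ltW b0) dtb (ltW e10) ra nb.
set Ib := bochner _ _; set Ia := bochner _ _ => nb' na' /eqP; rewrite subr_eq0 => /eqP II.
rewrite subr0 (_ : r a - r b = (Ib - r b) - (Ia - r a)); last first.
  by rewrite II opprB [RHS]addrC addrA subrK.
apply: le_trans (ler_normB _ _) _.
have : B * e1 <= e / 2.
  rewrite /e1 mulrA ler_pdivrMr//.
  have -> : e / 2 * (2 * (B + 1)) = B * e + e by field.
  by rewrite lerDl ltW.
move=> Be; apply: le_trans (lerD nb' na') _.
by rewrite [leRHS](splitr e) lerD.
Qed.

End du_bois_reymond.

(** * Uniqueness of strong solutions *)

Section uniqueness.
Context {R : realType}.
Local Notation mu := (@lebesgue_measure R).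
Local Notation TR := (measurableTypeR R).
Context {Y : completeNormedModType R}.
Local Notation ap := (@approximable R Y setT Num.norm).
Variables (F : R -> Y -> Y) (M : R).
Hypothesis F_c0 : c0_semigroup F.
Hypothesis F_bound : forall t y, 0 <= t -> `|F t y| <= M * `|y|.
Hypothesis M_ge0 : 0 <= M.
Local Notation P := (orbit_integral F).
Local Notation G := (gen_op F).

Lemma tcont_map (L : Y -> Y) N D (u : R -> Y) t : linear L -> 0 <= N ->
  (forall y, `|L y| <= N * `|y|) -> tcont D u t -> tcont D (L \o u) t.
Proof.
move=> lL N0 bL hu e e0; have eN : 0 < e / (N + 1) by rewrite divr_gt0// ltr_wpDl.
have Ne : N * (e / (N + 1)) <= e.
  rewrite mulrA ler_pdivrMr ?ltr_wpDl// mulrDr mulr1 mulrC lerDl; exact: ltW.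
have [d d0 hd] := hu _ eN; exists d => // r Dr /(hd _ Dr) h /=.
rewrite -(linear_sub lL); apply: le_trans (bL _) _.
by apply: le_trans (ler_wpM2l N0 h) Ne.
Qed.

Let Flin t : 0 <= t -> linear (F t).
Proof. by case: F_c0 => h _ _ _ /h[]. Qed.

(** If [Z' = G Z], then [F (t - r) (Z r)] has derivative 0 in [r]. *)
Lemma graph_flow_constant (Z z : R -> Y) t : 0 <= t ->
  (forall r, 0 <= r <= t -> tcont [set r | 0 <= r <= t] Z r) ->
  (forall r, 0 < r < t -> tderive Z r (z r)) ->
  (forall r, 0 < r < t -> gen_graph F (Z r) (z r)) ->
  Z t = F t (Z 0).
Proof.
move=> t0 cZ dZ gZ.
have := @zero_derive R Y (fun r => F (t - r) (Z r)) 0 t t0.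
rewrite subr0 subrr; have F0 y : F 0 y = y by case: F_c0.
rewrite F0 => H; apply/esym/H => {H}.
- move=> r /[dup] rt /andP[r0 rlt] e e0.
  have s0 : 0 < t - r by rewrite subr_gt0.
  have L0 : 0 < M + 2 by rewrite ltr_wpDl.
  have e1 : 0 < e / (M + 2) by rewrite divr_gt0.
  have [d d0 hd] := dZ r rt _ e1.
  have [d' d'0 hd'] := tderive_orbit_integral F_c0 F_bound M_ge0 (z r) s0 e1.
  have [d2 d20 hd2] := orbit_tcont F_c0 F_bound M_ge0 (z r) (ltW s0) e1.
  exists (Num.min (Num.min d d') (Num.min d2 (t - r))); first by rewrite !lt_min d0 d'0 d20.
  move=> x; rewrite !lt_min => /andP[/andP[xd xd'] /andP[xd2 xt]].
  have sx : 0 <= t - x by move: xt; rewrite ltr_norml; lra.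
  have dE : t - x - (t - r) = - (x - r) by ring.
  have nE : `|t - x - (t - r)| = `|x - r| by rewrite dE normrN.
  have h1 := hd x xd.
  have := hd' (t - x); rewrite nE => /(_ xd') h2.
  have := hd2 (t - x) sx; rewrite nE => /(_ xd2) h3.
  have g := gZ r rt.
  (* the last term is the variation of the operator at [Z r], which is an orbit
     integral of [z r] because [Z r] is in the domain *)
  have E1 : F (t - x) (Z x) - F (t - r) (Z r) =
    F (t - x) (Z x - Z r - (x - r) *: z r) + (x - r) *: (F (t - x) (z r) - F (t - r) (z r))
    + (P (t - x) (z r) - P (t - r) (z r) - (t - x - (t - r)) *: F (t - r) (z r)).
    rewrite (orbit_integral_gen F_c0 F_bound M_ge0 sx g) (orbit_integral_gen F_c0 F_bound M_ge0 (ltW s0) g).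
    rewrite !(linear_sub (Flin sx)) (linear_scale (Flin sx)) scalerBr dE scaleNr opprK.
    have H (A B C D E K : Y) : A - B = A - C - D + (D - E) + (C - K - (B - K) + E).
      have -> : A - C - D + (D - E) = A - C - E by rewrite addrA subrK.
      have -> : C - K - (B - K) = C - B by rewrite opprB addrA subrK.
      by rewrite addrACA addNr addr0 addrA subrK.
    exact: H.
  rewrite scaler0 subr0 E1.
  apply: le_trans (ler_normD _ _) _; apply: le_trans (lerD (ler_normD _ _) h2) _.
  have h1' : `|F (t - x) (Z x - Z r - (x - r) *: z r)| <= M * (e / (M + 2) * `|x - r|).
    by apply: le_trans (F_bound _ sx) _; exact: ler_wpM2l.
  have h3' : `|(x - r) *: (F (t - x) (z r) - F (t - r) (z r))| <= `|x - r| * (e / (M + 2)).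
    by rewrite normrZ ler_wpM2l.
  apply: le_trans (lerD (lerD h1' h3') (lexx _)) _.
  have -> : M * (e / (M + 2) * `|x - r|) + `|x - r| * (e / (M + 2)) + e / (M + 2) * `|x - r|
    = (M + 2) * (e / (M + 2)) * `|x - r| by ring.
  by rewrite mulrC (mulrC (M + 2)) divfK ?gt_eqF// mulrC.
- move=> r /[dup] rt /andP[r0 rlt] e e0.
  have s0 : 0 <= t - r by rewrite subr_ge0.
  have L0 : 0 < M + 1 by rewrite ltr_wpDl.
  have e1 : 0 < e / (M + 1) by rewrite divr_gt0.
  have [d d0 hd] := cZ r rt _ e1.
  have [d2 d20 hd2] := orbit_tcont F_c0 F_bound M_ge0 (Z r) s0 e1.
  exists (Num.min d d2); first by rewrite !lt_min d0 d20.
  move=> x /[dup] xx /andP[x0 xt]; rewrite lt_min => /andP[/(hd _ xx) h1 xd2].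
  have sx : 0 <= t - x by rewrite subr_ge0.
  have nE : `|t - x - (t - r)| = `|x - r|.
    by rewrite -normrN; congr `| _ |; ring.
  have := hd2 (t - x) sx; rewrite nE => /(_ xd2) h3.
  have -> : F (t - x) (Z x) - F (t - r) (Z r) = F (t - x) (Z x - Z r) + (F (t - x) (Z r) - F (t - r) (Z r)).
    by rewrite (linear_sub (Flin sx)) addrA subrK.
  apply: le_trans (ler_normD _ _) _.
  apply: le_trans (lerD (le_trans (F_bound _ sx) (ler_wpM2l M_ge0 h1)) h3) _.
  have -> : M * (e / (M + 1)) + e / (M + 1) = e / (M + 1) * (M + 1) by ring.
  by rewrite divfK ?gt_eqF.
Qed.

(** The operator [P h] turns the weak equation [z' = v = G z] into an equation
    with bounded operators: [P h z] has weak derivative [F h z - z], so it is the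
    primitive of that function by [du_bois_reymond].  In terms of
    [Z = primitive z] this says [F h Z - Z = P h z] for all [h], that is, [Z] is a
    classical solution of [Z' = G Z] with [Z 0 = 0], and [graph_flow_constant]
    applies. *)
Lemma weak_homogeneous_zero tau (z v : R -> Y) : weak_pair tau z v -> z 0 = 0 ->
  (forall t, 0 <= t < tau -> tcont [set r | 0 <= r < tau] z t) ->
  {ae mu, forall t, oi tau t -> gen_graph F (z t) (v t)} ->
  forall t, 0 < t < tau -> z t = 0.
Proof.
move=> [za va zv] z0 cz zg.
have oiS : oi tau `<=` [set r | 0 <= r < tau].
  by move=> r /andP[r0 rt]; apply/andP; split => //; exact: ltW.
have czo t : 0 < t < tau -> tcont (oi tau) z t.
  by move=> tt; apply: tcontS (cz t _) => //; exact: oiS.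
have key h t : 0 <= h -> 0 < t < tau ->
    F h (primitive z t) - primitive z t = P h (z t).
  move=> h0 /[dup] tt /andP[t0 ttau].
  have tau0 : 0 < tau by exact: lt_trans ttau.
  pose k r := F h (z r) - z r.
  have Fza : ap (oi tau) (F h \o z).
    by apply: (approximable_linear (measurable_oi tau) M_ge0 (Flin h0) _ za) => y; exact: F_bound.
  have ka : ap (oi tau) k by exact: approximableB.
  have kK : primitive k t = F h (primitive z t) - primitive z t.
    have za' : ap (oi t) z by apply: approximable_oi za; exact: ltW.
    have Fza' : ap (oi t) (F h \o z) by apply: approximable_oi Fza; exact: ltW.
    rewrite /primitive -(bochner_map _ _ M_ge0 (Flin h0))//; last by move=> y; exact: F_bound.
    by rewrite -bochnerB.
  rewrite -kK.
  pose q r := P h (z r).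
  have Plin : linear (P h) by exact: (orbit_integral_linear F_c0 F_bound M_ge0).
  have Pb y : `|P h y| <= M * h * `|y| by exact: (orbit_integral_bound F_c0 F_bound M_ge0).
  have Mh : 0 <= M * h by exact: mulr_ge0.
  have qa : ap (oi tau) q by exact: (approximable_linear (measurable_oi tau) Mh Plin Pb za).
  have cq r : 0 <= r < tau -> tcont [set r | 0 <= r < tau] q r.
    by move=> rr; apply: (tcont_map Plin Mh Pb); exact: cz.
  have cK r : 0 <= r < tau -> tcont [set r | 0 <= r < tau] (primitive k) r.
    move=> rr; apply: tcont_primitive => //.
    have ck : tcont [set r | 0 <= r < tau] k r.
      have -> : k = fun r => (F h \o z) r + (fun r => -1 *: z r) r.
        by apply/funext => x; rewrite /k /= scaleN1r.
      apply: tcontD; first by apply: (tcont_map (Flin h0) M_ge0) (cz r rr) => y; exact: F_bound.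
      apply: tcont_mulr; last exact: cz.
      by apply: continuous_rcont => ?; exact: cvg_cst.
    have [d d0 hd] := ck _ ltr01; exists (`|k r| + 1), d; split => // x xx xd.
    have := hd x (oiS _ xx) xd; have := ler_normD (k x - k r) (k r); rewrite subrK; lra.
  have Ka : ap (oi tau) (primitive k).
    have [c hc] := approximable_upper_bound (measurable_oi tau) (finite_oi tau) ka.
    apply: (@tcont_approximable _ _ _ _ c) => r /[dup] rr /andP[r0 rt].
      by apply: tcontS (cK r (oiS r rr)).
    have ka' : ap (oi r) k by apply: approximable_oi ka; exact: ltW.
    apply: (bochner_bound _ _ ka') => //.
    by apply: upper_leS hc => //; apply: subset_oi; exact: ltW.
  have [_ _ wK] : weak_pair tau (primitive k) k.
    by apply: (weak_pair_primitive (x := 0)) => // r _; rewrite add0r.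
  (* [q] and [primitive k] have the same weak derivative [k] *)
  pose w r := q r - primitive k r.
  have wa : ap (oi tau) w by exact: approximableB.
  have cw r : 0 <= r < tau -> tcont [set r | 0 <= r < tau] w r.
    move=> rr; have -> : w = fun r => q r + (fun r => -1 *: primitive k r) r.
      by apply/funext => x; rewrite /w /= scaleN1r.
    apply: tcontD; first exact: cq.
    apply: tcont_mulr; last exact: cK.
    by apply: continuous_rcont => ?; exact: cvg_cst.
  have [p [B [hp cp p0 B0 pB]]] := @smooth_step_profile R.
  have W a b : 0 < a -> a <= b -> b < tau -> w a = w b.
    apply: (du_bois_reymond hp cp p0 B0 pB wa).
      by move=> r rr; apply: tcontS (cw r (oiS r rr)).
    move=> phi hphi.
    have cphi := test_continuous hphi; have cdphi := test_derive_continuous hphi.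
    have [c [d [c0 dt z1 z2]]] := test_support hphi.
    have [B1 [B10 hB1]] := support_bounded cphi z1.
    have [B2 [B20 hB2]] := support_bounded cdphi z2.
    have mp : measurable_fun [set: R] phi by exact: continuous_measurable_fun.
    have md : measurable_fun [set: R] (derive1 phi) by exact: continuous_measurable_fun.
    have pa (g : R -> Y) : ap (oi tau) g -> ap (oi tau) (fun r => phi r *: g r).
      by move=> hw; apply: (approximable_mulr _ _ mp hB1).
    have da (g : R -> Y) : ap (oi tau) g -> ap (oi tau) (fun r => derive1 phi r *: g r).
      by move=> hw; apply: (approximable_mulr _ _ md hB2).
    have -> : (fun t => derive1 phi t *: w t) =
        (fun t => derive1 phi t *: q t - derive1 phi t *: primitive k t).
      by apply/funext => x; rewrite /w scalerBr.
    rewrite bochnerB//; [|exact: da|exact: da].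
    rewrite wK// opprK.
    have -> : (fun t => derive1 phi t *: q t) = P h \o (fun t => derive1 phi t *: z t).
      by apply/funext => x; rewrite /q /= (linear_scale Plin).
    rewrite (bochner_map _ _ Mh Plin Pb)//; last exact: da.
    rewrite zv// (_ : - _ = -1 *: bochner (oi tau) (fun t => phi t *: v t)); last by rewrite scaleN1r.
    rewrite (linear_scale Plin) scaleN1r -(bochner_map _ _ Mh Plin Pb)//; last exact: pa.
    rewrite addrC; apply/eqP; rewrite subr_eq0; apply/eqP.
    apply: bochner_ae => //; last exact: pa.
    apply: ae_imply zg => r hr rr /=; rewrite (linear_scale Plin); congr (_ *: _).
    by rewrite /k (orbit_integral_gen F_c0 F_bound M_ge0 h0 (hr rr)).
  have w0 : w 0 = 0 by rewrite /w /q z0 primitive0 (linear_zero Plin) subr0.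
  suff : w t = 0 by move/eqP; rewrite subr_eq0 => /eqP <-.
  apply: norm_small_eq => e e0; rewrite -w0.
  have [d d0 hd] := cw 0 (introT andP (conj (lexx 0) tau0)) _ e0.
  pose a := Num.min t (d / 2).
  have a0 : 0 < a by rewrite lt_min t0 divr_gt0.
  have at_ : a <= t by rewrite ge_min lexx.
  have ad : a < d by apply: (@le_lt_trans _ _ (d / 2)); [rewrite ge_min lexx orbT|rewrite ltr_pdivrMr// ltr_pMr// ltr1n].
  rewrite -(W a t a0 at_ ttau); apply: hd.
    by rewrite /= (ltW a0) (le_lt_trans at_ ttau).
  by rewrite subr0 gtr0_norm.
have gZ t : 0 < t < tau -> gen_graph F (primitive z t) (z t).
  by move=> tt; apply: (gen_graph_integral F_c0 F_bound M_ge0) => h h0; exact: key.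
have cZ r : 0 <= r < tau -> tcont [set r | 0 <= r < tau] (primitive z) r.
  move=> rr; apply: tcont_primitive => //.
  have [d d0 hd] := cz r rr _ ltr01; exists (`|z r| + 1), d; split => // x xx xd.
  have := hd x (oiS _ xx) xd; have := ler_normD (z x - z r) (z r); rewrite subrK; lra.
move=> t /[dup] tt /andP[t0 ttau].
have Zt : primitive z t = 0.
  rewrite (@graph_flow_constant (primitive z) z t (ltW t0)) ?primitive0 ?(linear_zero (Flin (ltW t0)))//.
  - move=> r /andP[r0 rt]; apply: tcontS (cZ r _).
      by move=> x /andP[x0 xt]; rewrite /= x0 (le_lt_trans xt).
    by rewrite r0 (le_lt_trans rt).
  - move=> r /andP[r0 rt]; have rr : 0 < r < tau by rewrite r0 (lt_trans rt).
    by apply: (tderive_primitive rr) => //; exact: czo.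
  - by move=> r /andP[r0 rt]; apply: gZ; rewrite r0 (lt_trans rt).
have := gZ t tt; rewrite Zt => /gen_graphP[_ <-].
by have [_ ->] := (gen_graphP F _ _).1 (gen_graph0 F_c0 F_bound M_ge0).
Qed.

Theorem strong_solution_unique (T : \bar R) x f u u' w w' :
  strong_solution F T x f u u' -> strong_solution F T x f w w' ->
  forall t, 0 <= t -> (t%:E < T)%E -> w t = u t.
Proof.
move=> [cu hu eu u0] [cw hw ew w0] t t0 tT.
move: t0; rewrite le_eqVlt => /predU1P[<-|t0]; first by rewrite u0 w0.
have [tau [tau0 tautT ttau]] : exists tau : R, [/\ 0 < tau, (tau%:E <= T)%E & t < tau].
  case: T tT {cu hu eu cw hw ew} => [T|_|//]; first by rewrite lte_fin => tT; exists T; split => //; exact: lt_trans tT.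
  by exists (t + 1); split; rewrite ?leey ?ltrDl// addr_gt0.
have [[[u1 m1] [v1 n1] wu] _] := hu tau tau0 tautT.
have [[[u2 m2] [v2 n2] ww] _] := hw tau tau0 tautT.
have inap (g : R -> Y) : strongly_measurable setT Num.norm (oi tau) g ->
    (L1norm Num.norm (oi tau) g < +oo)%E -> ap (oi tau) g.
  by move=> *; apply: in_L1_approximable.
have wpu : weak_pair tau u u' by split; [exact: inap|exact: inap|exact: wu].
have wpw : weak_pair tau w w' by split; [exact: inap|exact: inap|exact: ww].
have wz := weak_pair_linear (-1) wpu wpw.
have intT r : r < tau -> (r%:E < T)%E.
  by move=> rt; apply: lt_le_trans tautT; rewrite lte_fin.
have := weak_homogeneous_zero wz.
rewrite u0 w0 scaleN1r addNr => /(_ erefl) H.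
have : -1 *: u t + w t = 0; last first.
  by rewrite scaleN1r addrC => /eqP; rewrite subr_eq0 => /eqP.
apply: H; last by rewrite t0.
- move=> r rr; apply: tcontD.
    apply: tcont_mulr; first by apply: continuous_rcont => ?; exact: cvg_cst.
    move/tcont_within : cu => cu; apply: tcontS (cu r _).
      by move=> y /andP[y0 yt]; split => //; exact: intT.
    by case/andP: rr => r0 rt; split => //; exact: intT.
  move/tcont_within : cw => cw; apply: tcontS (cw r _).
    by move=> y /andP[y0 yt]; split => //; exact: intT.
  by case/andP: rr => r0 rt; split => //; exact: intT.
- apply: (ae_imply2 _ eu ew) => r h1 h2 /andP[r0 rt].
  have rT : time_interval T r by split => //; exact: intT.
  have [d1 e1] := h1 rT; have [d2 e2] := h2 rT.
  have g1 := gen_graph_op d1; have g2 := gen_graph_op d2.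
  have := gen_graph_linear F_c0 F_bound M_ge0 (-1) g1 g2.
  suff -> : -1 *: G (u r) + G (w r) = -1 *: u' r + w' r by [].
  have E1 : u' r = f r + G (u r) by rewrite -e1 subrK.
  have E2 : w' r = f r + G (w r) by rewrite -e2 subrK.
  by rewrite E1 E2 !scaleN1r opprD addrACA addNr add0r.
Qed.

End uniqueness.

(** * Maximal regularity from integrability of orbits *)

Section maximal_regularity.
Context {R : realType}.
Local Notation mu := (@lebesgue_measure R).
Local Notation TR := (measurableTypeR R).
Context {Y : completeNormedModType R}.
Local Notation ap := (@approximable R Y setT Num.norm).
Local Notation pos := (@pos R).

Lemma upper_le_zero_extension (A : set TR) (f : R -> Y) c : measurable A -> A `<=` pos ->
  upper_le A (fun t => `|f t|) c -> upper_le pos (fun t => `|if t \in A then f t else 0|) c.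
Proof.
move=> mA Ap [k [mk k0 fk kc]]; exists (k \_ A); split.
- by apply/(measurable_restrictT _ _).1 => //; exact: measurable_funTS.
- by apply: erestrict_ge0 => t _; exact: k0.
- apply: ae_imply fk => t h _; rewrite patchE; case: ifPn => tA; last by rewrite normr0.
  exact/h/set_mem.
- by rewrite -integral_mkcondr (_ : pos `&` A = A)//; exact: setIidr.
Qed.

Variables (F : R -> Y -> Y) (M K : R) (D0 : set Y).
Hypothesis F_c0 : c0_semigroup F.
Hypothesis F_bound : forall t y, 0 <= t -> `|F t y| <= M * `|y|.
Hypothesis M_ge0 : 0 <= M.
Hypothesis K_ge0 : 0 <= K.
Hypothesis D0_dense : forall y e, 0 < e -> exists2 y', D0 y' & `|y - y'| <= e.
Hypothesis D0_0 : D0 0.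
Hypothesis D0_dom : D0 `<=` gen_dom F.
Hypothesis D0_int : forall y, D0 y ->
  (\int[mu]_(t in pos) (`|F t (gen_op F y)|)%:E <= (K * `|y|)%:E)%E.

Let C1 := 2 * (M + K + (M * K + M + 1)).

(** The abstract principle: integrability of [F t (G y)] with a bound by [`|y|],
    for [y] in a dense part of the domain, is all that L^1 maximal regularity
    needs.  The data are extended by zero beyond [T], so the constant does not
    depend on [T]. *)
Theorem maximal_regularity : exists2 C, 0 <= C & forall C', C <= C' ->
  forall (T : \bar R) x f, (0 < T)%E -> in_L1 [set: Y] Num.norm (time_interval T) f ->
  uniquely_solvable_with_bound F T C' x f.
Proof.
have C10 : 0 <= C1 := C1_ge0 M_ge0 K_ge0.
exists (6 * C1 + 1); first by rewrite addr_ge0// mulr_ge0.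
move=> C' CC' T x f T0 [fm fL].
have mT := @measurable_time_interval R T.
have Tp : time_interval T `<=` pos by move=> t [].
have fa := in_L1_approximable mT (conj fm fL).
pose ft t := if t \in (time_interval T : set TR) then f t else 0.
have ftE t : time_interval T t -> ft t = f t by move=> tT; rewrite /ft mem_set.
have fta tau : ap (oi tau) ft.
  by apply: (@approximable_patch _ _ (oi tau) (time_interval T) (time_interval T) f) => //; exact: measurable_oi.
pose L := fine (L1norm Num.norm (time_interval T) f).
have LE : L1norm Num.norm (time_interval T) f = L%:E.
  by rewrite fineK// ge0_fin_numE// integral_ge0.
have fu := strongly_measurable_upper mT fm fL.
have L0 : 0 <= L := upper_le_ge0 fu.
have ftu : upper_le pos (fun t => `|ft t|) L by exact: upper_le_zero_extension.
pose c := `|x| + L.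
have xc : `|x| <= c by rewrite lerDl.
have ftc : upper_le pos (fun t => `|ft t|) c.
  by apply: upper_leW ftu => //; [exact: aeW|rewrite lerDr].
have [u [w sol]] := mild_solution_exists F_c0 F_bound M_ge0 K_ge0 D0_dense D0_0 D0_dom D0_int xc fta ftc.
have su := mild_strong_solution F_c0 F_bound M_ge0 T0 ftE sol.
exists u, (fun t => w t + ft t); split.
- exact: su.
- have c0 : 0 <= 2 * C1 * c by apply: mulr_ge0; [exact: mulr_ge0|exact: addr_ge0].
  apply: le_trans (mild_solution_estimate sol c0 ftu LE) _.
  rewrite LE -!EFinM -EFinD lee_fin -mulrDr.
  apply: le_trans (ler_wpM2r _ CC'); last by rewrite addr_ge0.
  rewrite -/c.
  have -> : 3 * (2 * C1 * c) + L = 6 * C1 * c + L by ring.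
  by rewrite [leRHS]mulrDl mul1r lerD// lerDr.
- by move=> v v' sv; exact: (strong_solution_unique F_c0 F_bound M_ge0 su sv).
Qed.

End maximal_regularity.

(** * A weighted Hardy inequality *)

Section weighted_hardy.
Context {R : realType}.
Local Notation mu := (@lebesgue_measure R).
Local Notation TR := (measurableTypeR R).
Local Notation pos := (@pos R).
Variable a : R.
Hypothesis a_gtN1 : -1 < a.
Hypothesis a_lt0 : a < 0.

Let a1 : 0 < a + 1. Proof. by rewrite -ltrBlDr sub0r. Qed.

Lemma powR_lt0_mono (x y : R) : 0 < x -> x <= y -> y `^ a <= x `^ a.
Proof.
move=> x0 xy; have y0 : 0 < y by exact: lt_le_trans xy.
rewrite -(opprK a) !(powRN _ (- a)) lef_pV2 ?posrE ?powR_gt0//.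
by apply: (ge0_ler_powR (r := - a)) => //; rewrite ?nnegrE ?oppr_ge0; exact: ltW.
Qed.

(** The shift by [d] keeps the integrand away from its singularity, where the
    fundamental theorem is not applicable. *)
Lemma shifted_power_integral (tau d : R) : 0 < tau -> 0 < d ->
  (\int[mu]_(t in oi tau) ((tau + d - t) `^ a)%:E <= ((tau + d) `^ (a + 1) / (a + 1))%:E)%E.
Proof.
move=> tau0 d0.
pose F (t : R) := - ((a + 1)^-1 * (tau + d - t) `^ (a + 1)).
have dF (t : R) : t <= tau -> is_derive t (1 : R) F ((tau + d - t) `^ a).
  move=> tt; have td0 : 0 < tau + d - t by lra.
  have h1 : is_derive t (1 : R) (fun t => tau + d - t) (-1).
    have h := is_deriveB (is_derive_cst (tau + d) t (1 : R)) (is_derive_id t (1 : R)).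
    by apply: (is_derive_eq h); rewrite sub0r.
  have h2 := @is_derive1_comp _ (@powR R ^~ (a + 1)) (fun t => tau + d - t) t _ _ (is_derive1_powR (a + 1) td0) h1.
  have h3 := is_deriveN (is_deriveZ (a + 1)^-1 h2).
  apply: (is_derive_eq h3).
  rewrite -[_ *: _]/(_ * _) addrK mulrN1 mulrN opprK mulrA mulVf ?mul1r//.
  exact: lt0r_neq0.
have cF (t : R) : t <= tau -> {for t, continuous F}.
  move=> tt; apply: differentiable_continuous; apply/derivable1_diffP.
  by have [] := dF t tt.
have cf (t : R) : t <= tau -> {for t, continuous (fun t => (tau + d - t) `^ a)}.
  move=> tt; have td0 : 0 < tau + d - t by lra.
  apply: (@continuous_comp _ _ _ (fun t => tau + d - t) (@powR R ^~ a)).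
    by apply: cvgB; [exact: cvg_cst|exact: cvg_id].
  apply: differentiable_continuous; apply/derivable1_diffP.
  by have [] := is_derive1_powR a td0.
have FTC : (\int[mu]_(t in `[0%R, tau]) ((tau + d - t) `^ a)%:E = (F tau)%:E - (F 0)%:E)%E.
  apply: continuous_FTC2 => //.
  - apply/subspace_continuousP => t /=; rewrite in_itv/= => /andP[t0 tt].
    exact: cvg_within_filter (cf t tt).
  - split.
    + by move=> t; rewrite in_itv/= => /andP[t0 tt]; have [] := dF t (ltW tt).
    + exact: cvg_at_right_filter (cF 0 (ltW tau0)).
    + exact: cvg_at_left_filter (cF tau (lexx _)).
  - move=> t; rewrite in_itv/= => /andP[t0 tt].
    by rewrite derive1E (@derive_val _ _ _ _ _ _ _ (dF t (ltW tt))).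
apply: (@le_trans _ _ (\int[mu]_(t in `[0%R, tau]) ((tau + d - t) `^ a)%:E)%E).
  apply: (@ge0_subset_integral _ _ _ mu (oi tau) `[0%R, tau]%classic) => //.

  - apply/measurable_EFinP; apply: measurable_funTS.
    apply: (measurableT_comp (measurable_powR a)).
    by apply: measurable_funB.
  - by move=> t _; rewrite lee_fin powR_ge0.
  - by move=> t /andP[t0 tt]; rewrite /= in_itv/= !ltW.
rewrite FTC -EFinD lee_fin /F opprK subr0 addrC mulrC gerDl oppr_le0.
by rewrite mulr_ge0 ?invr_ge0 ?powR_ge0// ltW.
Qed.

Lemma power_integral (tau : R) : 0 < tau ->
  (\int[mu]_(t in oi tau) ((tau - t) `^ a)%:E <= (2 / (a + 1) * tau `^ (a + 1))%:E)%E.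
Proof.
move=> tau0.
pose f (n : nat) t : \bar R := ((tau + tau / n.+1%:R - t) `^ a)%:E.
have mf n : measurable_fun (oi tau) (f n).
  apply/measurable_EFinP; apply: measurable_funTS.
  by apply: (measurableT_comp (measurable_powR a)); exact: measurable_funB.
have f0 n t : (0 <= f n t)%E by rewrite lee_fin powR_ge0.
(* as [a < 0], the shifted integrands increase to the singular one *)
have nd t : oi tau t -> {homo f^~ t : n m / (n <= m)%N >-> (n <= m)%E}.
  move=> /andP[t0 tt] n m nm; rewrite lee_fin; apply: powR_lt0_mono.
    by rewrite subr_gt0 (lt_le_trans tt)// lerDl divr_ge0// ltW.
  by rewrite lerD2r lerD2l ler_pM2l// lef_pV2 ?posrE// ler_nat ltnS.
have lim t : oi tau t -> f n t @[n --> \oo] --> ((tau - t) `^ a)%:E.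
  move=> /andP[t0 tt]; apply/fine_cvgP; split; first exact: nearW.
  have c : {for tau - t, continuous (@powR R ^~ a)}.
    apply: differentiable_continuous; apply/derivable1_diffP.
    have p0 : 0 < tau - t by rewrite subr_gt0.
    by have [] := is_derive1_powR a p0.
  have b : tau + tau / n.+1%:R - t @[n --> \oo] --> tau + tau * 0 - t.
    apply: cvgB; last exact: cvg_cst.
    apply: cvgD; first exact: cvg_cst.
    by apply: cvgM; [exact: cvg_cst|exact: cvg_harmonic].
  rewrite mulr0 addr0 in b.
  exact: (@cvg_comp _ _ _ (fun n : nat => tau + tau / n.+1%:R - t) (@powR R ^~ a) _ (nbhs (tau - t))).
have cv : (\int[mu]_(t in oi tau) f n t @[n --> \oo] --> \int[mu]_(t in oi tau) ((tau - t) `^ a)%:E)%E.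
  have -> : (\int[mu]_(t in oi tau) ((tau - t) `^ a)%:E = \int[mu]_(x in oi tau) limn (f^~ x))%E.
    by apply: eq_integral => t /set_mem ot; apply/esym/cvg_lim => //; exact: lim.
  by apply: cvg_monotone_convergence => //; exact: measurable_oi.
have <- := cvg_lim (@ereal_hausdorff R) cv.
apply: lime_le; first by apply/cvg_ex; eexists; exact: cv.
apply: nearW => n.
have d0 : 0 < tau / n.+1%:R by rewrite divr_gt0.
apply: le_trans (shifted_power_integral tau0 d0) _; rewrite lee_fin.
rewrite mulrAC ler_pM2r ?invr_gt0//.
have -> : tau + tau / n.+1%:R = (1 + n.+1%:R^-1) * tau by rewrite mulrDl mul1r mulrC.
rewrite powRM ?addr_ge0 ?(ltW tau0)//; apply: ler_wpM2r; first exact: powR_ge0.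
have n1 : n.+1%:R^-1 <= 1 :> R by rewrite invf_le1// ler1n.
have n0 : 0 < n.+1%:R^-1 :> R by rewrite invr_gt0.
set q : R := n.+1%:R^-1 in n1 n0 *.
apply: (@le_trans _ _ (1 + q)); last by lra.
rewrite -[leRHS]powRr1; last by lra.
by apply: ler_powR; [rewrite lerDl ltW|rewrite gerDr ltW].
Qed.

(** With [y = r + t], exchange the integrals: the inner one becomes the integral
    of [(y - t)^a] over (0, y), which is of order [y^(a + 1)], and the decay of [g]
    by the factor [1 / y] restores the weight [y^a]. *)
Lemma weighted_hardy (g h : R -> R) C : 0 <= C ->
  measurable_fun [set: R] g -> measurable_fun [set: R] h ->
  (forall t, 0 <= g t) -> (forall t, 0 <= h t) ->
  (forall t, 0 < t -> g t <= C / t * h (t / 2)) ->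
  (\int[mu]_(t in pos) \int[mu]_(r in pos) (r `^ a * g (r + t))%:E
   <= (4 / (a + 1) * C)%:E * \int[mu]_(r in pos) (r `^ a * h r)%:E)%E.
Proof.
move=> C0 mg mh g0 h0 gh.
pose k (p : R * R) : R := if (0 < p.1) && (p.1 < p.2) then (p.2 - p.1) `^ a * g p.2 else 0.
have mk : measurable_fun [set: TR * TR] k.
  apply: (@measurable_fun_ifT _ _ _ _ (fun p : TR * TR => (p.2 - p.1) `^ a * g p.2 : TR) (fun=> 0 : TR)
    (fun p : TR * TR => (0 < p.1) && (p.1 < p.2))) => //.
    by apply: measurable_and; apply: measurable_fun_ltr.
  apply: measurable_funM.
    apply: (measurableT_comp (measurable_powR a)).
    by apply: measurable_funB.
  exact: (measurableT_comp mg).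
have k0 p : 0 <= k p by rewrite /k; case: ifP => // _; rewrite mulr_ge0 ?powR_ge0.
have mpg t : measurable_fun [set: R] (fun r => r `^ a * g (r + t)).
  apply: measurable_funM; first exact: measurable_powR.
  apply: (measurableT_comp mg); exact: measurable_funD.
have E1 t : pos t -> (\int[mu]_(r in pos) (r `^ a * g (r + t))%:E = \int[mu]_y (k (t, y))%:E)%E.
  move=> t0; have mE : measurable_fun pos (fun r => (r `^ a * g (r + t))%:E).
    by apply/measurable_EFinP; apply: measurable_funTS; have := mpg t.
  rewrite (@ge0_integral_affine R 1 (- t) ltr01 pos _ (@measurable_pos R) mE); last first.
    by move=> r _; rewrite lee_fin mulr_ge0 ?powR_ge0.
  rewrite mul1e [LHS]integral_mkcond; apply: eq_integral => y _.
  rewrite patchE /k /= t0 /=; case: ifPn => [/set_mem|].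
    by rewrite /pos /= mul1r subr_gt0 subrK => ->.
  by rewrite notin_setE /pos /= mul1r subr_gt0 => /negP/negbTE ->.
have pI : 0 <= 2 / (a + 1) by rewrite divr_ge0// ltW.
have E2 y : (\int[mu]_t (k (t, y))%:E <= ((fun y => (2 / (a + 1) * C * (y `^ a * h (y / 2)))%:E) \_ pos) y)%E.
  rewrite patchE; have [y0|y0] := ltP 0 y; last first.
    rewrite memNset; last by rewrite /pos /= ltNge y0.
    rewrite integral0_eq// => t _; rewrite /k /= ifF//.
    by apply/negbTE; rewrite negb_and -!leNgt; case: (leP t 0) => //= t0; rewrite (le_trans y0)// ltW.
  rewrite mem_set//.
  have -> : (\int[mu]_t (k (t, y))%:E = \int[mu]_(t in oi y) ((g y)%:E * ((y - t) `^ a)%:E))%E.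
    rewrite [RHS]integral_mkcond; apply: eq_integral => t _.
    rewrite patchE /k /=; case: ifPn => [ty|]; first by rewrite mem_set// -EFinM mulrC.
    by move=> ty; rewrite memNset//; exact/negP.
  have moi := @measurable_oi R y.
  have mpo : measurable_fun (oi y) (fun t => ((y - t) `^ a)%:E).
    apply/measurable_EFinP; apply: measurable_funTS.
    by apply: (measurableT_comp (measurable_powR a)); exact: measurable_funB.
  rewrite ge0_integralZl_EFin//; last by move=> t _; rewrite lee_fin powR_ge0.
  apply: le_trans (lee_wpmul2l _ (power_integral y0)) _; first by rewrite lee_fin.
  rewrite -EFinM lee_fin mulrC.
  have pp : 0 <= 2 / (a + 1) * y `^ (a + 1) by rewrite mulr_ge0// powR_ge0.
  apply: le_trans (ler_wpM2l pp (gh y y0)) _.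
  rewrite powRD; last by apply/implyP => _; exact: lt0r_neq0.
  rewrite powRr1 ?(ltW y0)//.
  have -> // : 2 / (a + 1) * (y `^ a * y) * (C / y * h (y / 2)) = 2 / (a + 1) * C * (y `^ a * h (y / 2)).
  by field; rewrite !lt0r_neq0.
have mph : measurable_fun [set: R] (fun r => r `^ a * h r).
  by apply: measurable_funM; [exact: measurable_powR|].
have mph2 : measurable_fun [set: R] (fun r => r `^ a * h (r / 2)).
  apply: measurable_funM; first exact: measurable_powR.
  by apply: (measurableT_comp mh); exact: measurable_funM.
apply: (@le_trans _ _ (\int[mu]_t \int[mu]_y (k (t, y))%:E)%E).
  rewrite [leLHS]integral_mkcond le_eqVlt; apply/predU1P; left; apply: eq_integral => t _; rewrite patchE.
  case: ifPn => [/set_mem/E1 -> //|]; rewrite notin_setE => nt.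
  by rewrite integral0_eq// => y _; rewrite /k /= ifF//; apply/negbTE/negP => /andP[/nt].
have mkE : measurable_fun [set: TR * TR] (EFin \o k) by exact/measurable_EFinP.
have kE0 p : (0 <= (EFin \o k) p)%E by rewrite lee_fin.
have FT := @fubini_tonelli _ _ TR TR R mu mu (EFin \o k) mkE kE0.
apply: (@le_trans _ _ (\int[mu]_y \int[mu]_t (k (t, y))%:E)%E).
  by rewrite le_eqVlt; apply/predU1P; left; exact: FT.
apply: le_trans (le_integral_nonmeasurable _ (fun y _ => E2 y)) _.
  by move=> y _; apply: integral_ge0 => t _; rewrite lee_fin.
rewrite -integral_mkcond; under eq_integral do rewrite EFinM.
have aC : 0 <= 2 / (a + 1) * C by exact: mulr_ge0.
have mph2E : measurable_fun pos (fun r => (r `^ a * h (r / 2))%:E).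
  by apply/measurable_EFinP; apply: measurable_funTS; have := mph2.
have mphE : measurable_fun pos (fun r => (r `^ a * h r)%:E).
  by apply/measurable_EFinP; apply: measurable_funTS; have := mph.
have mpos := @measurable_pos R.
rewrite ge0_integralZl_EFin//; last by move=> y _; rewrite lee_fin mulr_ge0 ?powR_ge0.
have b : (\int[mu]_(r in pos) (r `^ a * h (r / 2))%:E <= 2%:E * \int[mu]_(r in pos) (r `^ a * h r)%:E)%E.
  rewrite (@ge0_integral_affine R 2 0 (ltr0n _ 2) pos _ (@measurable_pos R) mph2E); last first.
    by move=> r _; rewrite lee_fin mulr_ge0 ?powR_ge0.
  apply: lee_wpmul2l => //.
  have -> : [set t : R | pos (2 * t + 0)] = pos.
    by apply/seteqP; split => t; rewrite /pos /= addr0 pmulr_rgt0.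
  apply: le_integral_nonmeasurable => r r0.
    by rewrite lee_fin mulr_ge0 ?powR_ge0.
  rewrite lee_fin addr0 (mulrC 2 r) mulfK//; apply: ler_wpM2r => //.
  by apply: powR_lt0_mono => //; rewrite ler_peMr ?ler1n//; exact: ltW.
apply: le_trans (lee_wpmul2l _ b) _; first by rewrite lee_fin.
by rewrite muleA -EFinM (_ : 2 / (a + 1) * C * 2 = 4 / (a + 1) * C)//; field; exact: lt0r_neq0.
Qed.

End weighted_hardy.

(** * Weighted norms of paths *)

Section weighted_integral.
Context {R : realType}.
Local Notation mu := (@lebesgue_measure R).
Local Notation TR := (measurableTypeR R).
Local Notation pos := (@pos R).
Context {X : completeNormedModType R}.
Variable a : R.

(** Both homogeneous Besov norms are of this form. *)
Definition weighted_norm (u : R -> X) : \bar R := \int[mu]_(r in pos) (r `^ a * `|u r|)%:E.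

Definition path_norm (u : R -> X) (r : R) : R := if 0 < r then `|u r| else 0.

Lemma path_norm_measurable (u : R -> X) : (forall t, 0 < t -> tcont pos u t) ->
  measurable_fun [set: R] (path_norm u).
Proof.
move=> cu.
have c : measurable_fun pos (fun r => `|u r|).
  apply: open_continuous_measurable_fun.
    exact: (@open_gt R 0).
  move=> t /set_mem t0; apply/cvgrPdist_le => /= e e0; have [d d0 hd] := cu t t0 _ e0.
  apply/nbhs_ballP; exists (Num.min d t); first by rewrite /= lt_min d0.
  move=> r; rewrite /ball/= lt_min => /andP[rd rt].
  apply: le_trans (ler_dist_dist _ _) _; rewrite distrC; apply: hd; last by rewrite distrC.
  by rewrite /pos/=; move: rt; rewrite ltr_norml; lra.
have -> : path_norm u = ((fun r => `|u r|) \_ pos).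
  apply/funext => r; rewrite /path_norm patchE; have [r0|r0] := ltP 0 r.
    by rewrite mem_set.
  by rewrite memNset// /pos /= ltNge r0.
by apply/(measurable_restrictT _ _).1 => //; exact: measurable_pos.
Qed.

Lemma weighted_measurable (u : R -> X) : (forall t, 0 < t -> tcont pos u t) ->
  measurable_fun pos (fun r => (r `^ a * `|u r|)%:E).
Proof.
move=> cu.
have m : measurable_fun [set: R] (fun r => (r `^ a * path_norm u r)%:E).
  apply/measurable_EFinP; apply: measurable_funM; first exact: measurable_powR.
  exact: path_norm_measurable.
apply: (eq_measurable_fun (fun r => (r `^ a * path_norm u r)%:E)).
  by move=> r /set_mem r0; rewrite /path_norm ifT.
by have := m; exact: measurable_funTS.
Qed.

Lemma weighted_norm_le (u v : R -> X) C : 0 <= C -> (forall t, 0 < t -> tcont pos v t) ->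
  (forall t, 0 < t -> `|u t| <= C * `|v t|) -> (weighted_norm u <= C%:E * weighted_norm v)%E.
Proof.
move=> C0 cv uv; have mv := weighted_measurable cv; have mpos := @measurable_pos R.
rewrite /weighted_norm -ge0_integralZl_EFin//; last by move=> t _; rewrite lee_fin mulr_ge0 ?powR_ge0.
apply: le_integral_nonmeasurable => t t0; first by rewrite lee_fin mulr_ge0 ?powR_ge0.
by rewrite -EFinM lee_fin mulrCA; apply: ler_wpM2l; [exact: powR_ge0|exact: uv].
Qed.

(** Dominated convergence, for a family of operators [d h] that is bounded and
    tends to 0 pointwise as [h] tends to 0. *)
Lemma weighted_norm_small (d : R -> X -> X) C (u : R -> X) : (forall t, 0 < t -> tcont pos u t) ->
  (weighted_norm u < +oo)%E -> 0 <= C ->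
  (forall h, 0 < h -> linear (d h)) ->
  (forall h y, 0 < h -> `|d h y| <= C * `|y|) ->
  (forall y e, 0 < e -> exists2 b, 0 < b & forall h, 0 < h < b -> `|d h y| <= e) ->
  forall e, 0 < e -> exists2 b, 0 < b & forall h, 0 < h < b -> (weighted_norm (d h \o u) <= e%:E)%E.
Proof.
move=> cu fu C0 dlin dC d0 e e0; apply: contrapT => nH.
have /choice[h hh] n : exists h : R, 0 < h < n.+1%:R^-1 /\ ~ (weighted_norm (d h \o u) <= e%:E)%E.
  apply: contrapT => nh; apply: nH; exists n.+1%:R^-1; first by rewrite invr_gt0.
  by move=> h hn; apply: contrapT => nle; apply: nh; exists h.
have h0 n : 0 < h n by have [/andP[]] := hh n.
pose f n r : \bar R := (r `^ a * `|d (h n) (u r)|)%:E.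
have mf n : measurable_fun pos (f n).
  apply: weighted_measurable => t t0; apply: (@tcont_map _ _ (d (h n)) C) => //; [exact: dlin| |exact: cu].
  by move=> y; exact: dC.
pose g r : \bar R := (C%:E * (r `^ a * `|u r|)%:E)%E.
have mpos := @measurable_pos R; have mu_ := weighted_measurable cu.
have ig : mu.-integrable pos g.
  apply: integrableZl => //; apply/integrableP; split => //.
  under eq_integral => t _ do rewrite gee0_abs ?lee_fin ?mulr_ge0 ?powR_ge0//.
  exact: fu.
have [] := dominated_convergence mpos mf (measurable_cst 0%E) _ ig _.
- apply: aeW => r r0; apply: cvg_EFin; first exact: nearW.
  rewrite /f /=; have : r `^ a * `|d (h n) (u r)| @[n --> \oo] --> r `^ a * 0.
    apply: cvgM; first exact: cvg_cst.
    apply/cvgrPdist_le => /= e1 e10; have [b b0 hb] := d0 (u r) _ e10.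
    near=> n; rewrite sub0r normrN normr_id; apply: hb; rewrite h0/=.
    have [/andP[_ hn] _] := hh n; apply: lt_trans hn _.
    by near: n; exact: (near_infty_natSinv_lt (PosNum b0)).
  by rewrite mulr0.
- apply: aeW => r n r0; rewrite gee0_abs ?lee_fin ?mulr_ge0 ?powR_ge0//.
  by rewrite mulrCA; apply: ler_wpM2l; [exact: powR_ge0|exact: dC].
move=> _ _; rewrite integral0 => /fine_cvgP[[N1 _ hN1] /cvgrPdist_le/(_ _ e0)[N2 _ hN2]].
pose n := maxn N1 N2.
have f1 := hN1 n (leq_maxl _ _); have f2 := hN2 n (leq_maxr _ _).
have [_] := hh n; apply.
rewrite /weighted_norm -[leLHS](fineK f1) lee_fin.
by move: f2; rewrite sub0r normrN; apply: le_trans; exact: ler_norm.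
Unshelve. all: by end_near. Qed.

End weighted_integral.

(** * Semigroups extended to completions for weighted norms *)

Section extended_semigroup.
Context {R : realType}.
Local Notation mu := (@lebesgue_measure R).
Local Notation TR := (measurableTypeR R).
Local Notation pos := (@pos R).
Context {X B : completeNormedModType R}.
Variables (E : R -> X -> X) (M M1 : R) (L : R -> X -> X) (a : R) (D : set X)
  (iota : X -> B) (F : R -> B -> B).
Hypothesis E_c0 : c0_semigroup E.
Hypothesis E_bound : forall t x, 0 <= t -> `|E t x| <= M * `|x|.
Hypothesis M_ge0 : 0 <= M.
Hypothesis E_dom : forall t x, 0 < t -> gen_dom E (E t x).
Hypothesis E_gen : forall t x, 0 < t -> `|t *: gen_op E (E t x)| <= M1 * `|x|.
Hypothesis M1_ge0 : 0 <= M1.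
Hypothesis a_gtN1 : -1 < a.
Hypothesis a_lt0 : a < 0.
Hypothesis L_lin : forall r, 0 < r -> linear (L r).
Hypothesis L_bdd : forall r, 0 < r -> exists2 b, 0 <= b & forall x, `|L r x| <= b * `|x|.
Hypothesis L_add : forall r t x, 0 < r -> 0 <= t -> L (r + t) x = E t (L r x).
Hypothesis L_comm : forall r t x, 0 < r -> 0 <= t -> L r (E t x) = E t (L r x).
Hypothesis D_lin : forall c x y, D x -> D y -> D (c *: x + y).
Hypothesis D_0 : D 0.
Hypothesis D_E : forall t x, 0 <= t -> D x -> D (E t x).
Hypothesis D_G : forall t x, 0 < t -> D x -> D (gen_op E (E t x)).
Hypothesis iota_completion : is_completion D (fun x => weighted_norm a (L ^~ x)) iota.
Hypothesis F_ext : extends_by_continuity D iota E F.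
Local Notation G := (gen_op E).
Local Notation P := (orbit_integral E).

Let iota_lin c x y : D x -> D y -> iota (c *: x + y) = c *: iota x + iota y.
Proof. by have [h _ _] := iota_completion; exact: h. Qed.

Let iota_norm x : D x -> (`|iota x|)%:E = weighted_norm a (L ^~ x).
Proof. by have [_ h _] := iota_completion; exact: h. Qed.

Let F_iota t x : 0 <= t -> D x -> F t (iota x) = iota (E t x).
Proof. by move=> t0 Dx; have [_ ->] := F_ext t0. Qed.

Let E_lin t : 0 <= t -> linear (E t).
Proof. by case: E_c0 => h _ _ _ /h[]. Qed.

Lemma completion0 : iota 0 = 0.
Proof.
have := iota_lin 1 D_0 D_0; rewrite !scale1r addr0 => h.
by apply: (addrI (iota 0)); rewrite addr0 -h.
Qed.

Lemma completionB x y : D x -> D y -> D (x - y) /\ iota (x - y) = iota x - iota y.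
Proof.
move=> Dx Dy; have := D_lin (-1) Dy Dx; have := iota_lin (-1) Dy Dx.
by rewrite !scaleN1r addrC (addrC (- iota y)) => -> ?.
Qed.

Lemma completionZ c x : D x -> D (c *: x) /\ iota (c *: x) = c *: iota x.
Proof.
move=> Dx; have := D_lin c Dx D_0; have := iota_lin c Dx D_0.
by rewrite !addr0 completion0 addr0.
Qed.

Lemma completion_near y e : 0 < e -> exists2 x, D x & `|y - iota x| <= e.
Proof.
move=> e0; have [_ _ dn] := iota_completion.
have [] := dn (interior (ball y e)).
- exists y; exact: nbhsx_ballx.
- exact: open_interior.
- move=> z [/interior_subset zy [x Dx xz]]; exists x => //.
  by rewrite xz; apply: ltW; move: zy; rewrite -ball_normE.
Qed.

Lemma transform_tcont x t : 0 < t -> tcont pos (L ^~ x) t.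
Proof.
move=> t0 e e0; have s0 : 0 < t / 2 by rewrite divr_gt0.
have st : t - t / 2 = t / 2 by rewrite [X in X - _](splitr t) addrK.
have [d d0 hd] := orbit_tcont E_c0 E_bound M_ge0 (L (t / 2) x) (ltW s0) e0.
exists (Num.min d (t / 2)); first by rewrite lt_min d0.
move=> r r0; rewrite lt_min => /andP[rd rt].
have rs : 0 <= r - t / 2 by move: rt; rewrite ltr_norml => /andP[h _]; rewrite -[X in X <= _](subrr (t / 2)) lerD2r; move: h st; lra.
have E1 : L r x = E (r - t / 2) (L (t / 2) x) by rewrite -L_add// addrC subrK.
have E2 : L t x = E (t / 2) (L (t / 2) x) by rewrite -L_add// ?(ltW s0)// -splitr.
rewrite E1 E2; apply: hd => //.
by rewrite -addrA -opprD -splitr.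
Qed.

Lemma completion_bound t x : 0 <= t -> D x -> `|iota (E t x)| <= M * `|iota x|.
Proof.
move=> t0 Dx; rewrite -lee_fin EFinM !iota_norm//; last exact: D_E.
apply: weighted_norm_le => //; first by move=> r r0; exact: transform_tcont.
by move=> r r0; rewrite L_comm//; exact: E_bound.
Qed.

Lemma extension_near t y e : 0 <= t -> 0 < e -> exists2 d, 0 < d &
  forall y', `|y - y'| <= d -> `|F t y - F t y'| <= e.
Proof.
move=> t0 e0; have [c _] := F_ext t0; have /cvgrPdist_le/(_ _ e0) := c y.
move=> /nbhs_ballP[d /= d0 hd]; exists (d / 2); first by rewrite divr_gt0.
move=> y' yy; apply: hd; rewrite -ball_normE /ball_ /=; apply: le_lt_trans yy _.
by rewrite ltr_pdivrMr// ltr_pMr// ltr1n.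
Qed.

Lemma extension_bound t y : 0 <= t -> `|F t y| <= M * `|y|.
Proof.
move=> t0; apply/ler_addgt0Pr => e e0.
have e1 : 0 < e / (M + 1) by rewrite divr_gt0// ltr_wpDl.
have [d d0 hd] := extension_near y t0 e1.
have dm : 0 < Num.min d (e / (M + 1)) by rewrite lt_min d0.
have [x Dx] := completion_near y dm; rewrite le_min => /andP[/hd h1 h2].
have h3 := completion_bound t0 Dx; rewrite -F_iota// in h3.
have h4 : `|iota x| <= `|y| + e / (M + 1).
  by have := ler_normB y (y - iota x); rewrite opprB addrC subrK; lra.
have := ler_normD (F t y - F t (iota x)) (F t (iota x)); rewrite subrK => h5.
apply: le_trans h5 _; apply: le_trans (lerD h1 (le_trans h3 (ler_wpM2l M_ge0 h4))) _.
have -> : e / (M + 1) + M * (`|y| + e / (M + 1)) = M * `|y| + e / (M + 1) * (M + 1) by ring.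
by rewrite divfK ?gt_eqF// ltr_wpDl.
Qed.

Lemma extension_linear t : 0 <= t -> linear (F t).
Proof.
move=> t0 c y z; apply: norm_small_eq => e e0.
have K0 : 0 < `|c| + 2 by rewrite ltr_wpDl.
have e1 : 0 < e / (`|c| + 2) by rewrite divr_gt0.
have [d d0 hd] := extension_near (c *: y + z) t0 e1.
have [d1 d10 hd1] := extension_near y t0 e1.
have [d2 d20 hd2] := extension_near z t0 e1.
pose m := Num.min (d / (`|c| + 1)) (Num.min d1 d2).
have m0 : 0 < m by rewrite !lt_min d10 d20 divr_gt0// ltr_wpDl.
have [x Dx] := completion_near y m0; rewrite !le_min => /and3P[x1 /hd1 x2 _].
have [x' Dx'] := completion_near z m0; rewrite !le_min => /and3P[x1' _ /hd2 x2'].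
have h1 : `|F t (c *: y + z) - F t (iota (c *: x + x'))| <= e / (`|c| + 2).
  apply: hd; rewrite iota_lin// opprD addrACA -scalerBr.
  apply: le_trans (ler_normD _ _) _; rewrite normrZ.
  apply: le_trans (lerD (ler_wpM2l (normr_ge0 c) x1) x1') _.
  have -> : `|c| * (d / (`|c| + 1)) + d / (`|c| + 1) = d / (`|c| + 1) * (`|c| + 1) by ring.
  by rewrite divfK// gt_eqF// ltr_wpDl.
have h2 : F t (iota (c *: x + x')) = c *: F t (iota x) + F t (iota x').
  rewrite !F_iota//; last exact: D_lin.
  by rewrite (E_lin t0) iota_lin//; exact: D_E.
rewrite h2 in h1.
have -> : F t (c *: y + z) - (c *: F t y + F t z) =
  (F t (c *: y + z) - (c *: F t (iota x) + F t (iota x'))) - (c *: (F t y - F t (iota x)) + (F t z - F t (iota x'))).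
  have H (U V V' : B) : U - V = (U - V') - (V - V') by rewrite opprB addrA subrK.
  by rewrite scalerBr addrACA -opprD; exact: H.
apply: le_trans (ler_normB _ _) _; apply: le_trans (lerD h1 (ler_normD _ _)) _.
rewrite normrZ; apply: le_trans (lerD (lexx _) (lerD (ler_wpM2l (normr_ge0 c) x2) x2')) _.
have -> : e / (`|c| + 2) + (`|c| * (e / (`|c| + 2)) + e / (`|c| + 2)) = e / (`|c| + 2) * (`|c| + 2) by ring.
by rewrite divfK ?gt_eqF.
Qed.

Let F_dist t y y' : 0 <= t -> `|F t y - F t y'| <= M * `|y - y'|.
Proof.
by move=> t0; rewrite -(linear_sub (extension_linear t0)); exact: extension_bound.
Qed.

Lemma extension_unique (f g : B -> B) N : 0 <= N ->
  (forall y y', `|f y - f y'| <= N * `|y - y'|) -> (forall y y', `|g y - g y'| <= N * `|y - y'|) ->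
  (forall x, D x -> f (iota x) = g (iota x)) -> f =1 g.
Proof.
move=> N0 hf hg fg y; apply: norm_small_eq => e e0.
have e1 : 0 < e / (2 * N + 1) by rewrite divr_gt0// ltr_wpDl// mulr_ge0.
have [x Dx yx] := completion_near y e1.
have := ler_distD (f (iota x)) (f y) (g y); rewrite {2}fg// (distrC (g (iota x))) => h.
apply: le_trans h _; apply: le_trans (lerD (hf _ _) (hg _ _)) _.
apply: le_trans (lerD (ler_wpM2l N0 yx) (ler_wpM2l N0 yx)) _.
have -> : N * (e / (2 * N + 1)) + N * (e / (2 * N + 1)) = 2 * N * (e / (2 * N + 1)) by ring.
rewrite mulrA ler_pdivrMr ?ltr_wpDl ?mulr_ge0// mulrC; apply: ler_wpM2l; first exact: ltW.
by rewrite lerDl.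
Qed.

(** All limits in the completion reduce to this one: [L r] carries the vectors
    [v h] to [d h (L r u)], and [weighted_norm_small] applies to the path
    [r |-> L r u]. *)
Lemma completion_small (d : R -> X -> X) C u : 0 <= C -> D u ->
  (forall h, 0 < h -> linear (d h)) ->
  (forall h y, 0 < h -> `|d h y| <= C * `|y|) ->
  (forall y e, 0 < e -> exists2 b, 0 < b & forall h, 0 < h < b -> `|d h y| <= e) ->
  forall v : R -> X, (forall h, 0 < h -> D (v h)) ->
  (forall h r, 0 < h -> 0 < r -> L r (v h) = d h (L r u)) ->
  forall e, 0 < e -> exists2 b, 0 < b & forall h, 0 < h < b -> `|iota (v h)| <= e.
Proof.
move=> C0 Du dlin dC d0 v Dv vE e e0.
have fin : (weighted_norm a (L ^~ u) < +oo)%E by rewrite -iota_norm// ltry.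
have [b b0 hb] := weighted_norm_small (fun t t0 => transform_tcont u t0) fin C0 dlin dC d0 e0.
exists b => // h /[dup] hh /andP[h0 _]; rewrite -lee_fin iota_norm; last exact: Dv.
apply: le_trans (hb h hh); rewrite le_eqVlt; apply/predU1P; left.
by apply: eq_integral => r /set_mem r0 /=; rewrite vE.
Qed.

Lemma completion_semigroup_near x e : D x -> 0 < e -> exists2 b, 0 < b &
  forall h, 0 < h < b -> `|iota (E h x) - iota x| <= e.
Proof.
move=> Dx e0.
have [|h h0|h y h0|y e1 e10|h h0|h r h0 r0|b b0 hb] :=
  @completion_small (fun h y => E h y - y) (M + 1) x _ Dx _ _ _ (fun h => E h x - x) _ _ e e0.
- exact: addr_ge0.
- by move=> c y z; rewrite (E_lin (ltW h0)) scalerBr opprD addrACA.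
- apply: le_trans (ler_normB _ _) _; rewrite mulrDl mul1r lerD2r; exact: E_bound _ (ltW h0).
- have [d d0 hd] := semigroup_cvg0 E_c0 y e10.
  by exists d => // h /andP[h0 hd']; apply: hd; rewrite ltW.
- by have [] := completionB (D_E (ltW h0) Dx) Dx.
- by rewrite (linear_sub (L_lin r0)) L_comm ?(ltW h0).
exists b => // h /[dup] hh /andP[h0 _].
by have [_ <-] := completionB (D_E (ltW h0) Dx) Dx; exact: hb.
Qed.

Theorem extension_c0 : c0_semigroup F.
Proof.
have [_ E0 EA _] := E_c0.
split.
- by move=> t t0; split; [exact: extension_linear|have [] := F_ext t0].
- apply: (@extension_unique _ _ (M + 1)); first exact: addr_ge0.
  + move=> y y'; apply: le_trans (F_dist _ _ (lexx 0)) _.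
    by rewrite mulrDl mul1r lerDl.
  + by move=> y y'; rewrite mulrDl mul1r lerDr mulr_ge0.
  + by move=> x Dx; rewrite F_iota// E0.
- move=> t r y t0 r0; move: y.
  apply: (@extension_unique _ _ (M + M * M)); first by rewrite addr_ge0 ?mulr_ge0.
  + move=> y y'; apply: le_trans (F_dist _ _ (addr_ge0 t0 r0)) _.
    by rewrite mulrDl lerDl !mulr_ge0.
  + move=> y y'; apply: le_trans (F_dist _ _ t0) _.
    apply: le_trans (ler_wpM2l M_ge0 (F_dist _ _ r0)) _.
    by rewrite mulrDl mulrA lerDr mulr_ge0.
  + move=> x Dx; rewrite !F_iota ?addr_ge0// ?EA//; exact: D_E.
- move=> y; apply/cvgrPdist_le => /= e e0.
  have K0 : 0 < M + 2 by rewrite ltr_wpDl.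
  have e1 : 0 < e / (M + 2) by rewrite divr_gt0.
  have [x Dx yx] := completion_near y e1.
  have [b b0 hb] := completion_semigroup_near Dx e1.
  rewrite near_withinE; apply/nbhs_ballP; exists b => //= h.
  rewrite /ball/= sub0r normrN => hb' h0; rewrite gtr0_norm// in hb'.
  have h1 := hb h (introT andP (conj h0 hb')); rewrite -F_iota// ?(ltW h0)// in h1.
  have h2 := F_dist y (iota x) (ltW h0).
  have h3 := ler_distD (iota x) y (F h y).
  have h4 := ler_distD (F h (iota x)) (iota x) (F h y).
  rewrite (distrC (iota x) (F h (iota x))) (distrC (F h (iota x)) (F h y)) in h4.
  have h5 := le_trans h2 (ler_wpM2l M_ge0 yx).
  have : e / (M + 2) + (e / (M + 2) + M * (e / (M + 2))) = e.
    by field; exact: lt0r_neq0.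
  move: (e / (M + 2)) h1 h5 yx => q h1 h5 yx qe.
  rewrite -qe; apply: le_trans h3 (lerD yx _); apply: le_trans h4 (lerD h1 h5).
Qed.

(** The dense set on which the orbits of the generator are integrable.  Smoothing
    by [E e] puts the vectors in the domain of every power of the generator, so
    that [G] can be applied without leaving [D]. *)
Definition smoothed : set B := [set y | exists x e, [/\ D x, 0 < e & y = iota (E e x)]].

Lemma smoothed_dense y e : 0 < e -> exists2 y', smoothed y' & `|y - y'| <= e.
Proof.
move=> e0; have e20 : 0 < e / 2 by rewrite divr_gt0.
have [x Dx yx] := completion_near y e20.
have [b b0 hb] := completion_semigroup_near Dx e20.
have h0 : 0 < b / 2 by rewrite divr_gt0.
have hlt : b / 2 < b by rewrite ltr_pdivrMr// ltr_pMr// ltr1n.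
exists (iota (E (b / 2) x)); first by exists x, (b / 2).
apply: le_trans (ler_distD (iota x) _ _) _; rewrite [leRHS](splitr e); apply: lerD => //.
by rewrite distrC; apply: hb; rewrite h0.
Qed.

Lemma smoothed_0 : smoothed 0.
Proof.
by exists 0, 1; split => //; rewrite (linear_zero (E_lin ler01)) completion0.
Qed.

Lemma transform_gen_graph r z w : 0 < r -> gen_graph E z w -> gen_graph E (L r z) (L r w).
Proof.
move=> r0 zw e e0; have [b b0 bL] := L_bdd r0.
have e1 : 0 < e / (b + 1) by rewrite divr_gt0// ltr_wpDl.
have [d d0 hd] := zw _ e1; exists d => // h /[dup] hh /andP[h0 _].
rewrite -(L_comm _ r0 (ltW h0)) -(linear_scale (L_lin r0)) -!(linear_sub (L_lin r0)).
apply: le_trans (bL _) _; apply: le_trans (ler_wpM2l b0 (hd h hh)) _.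
rewrite mulrA; apply: ler_wpM2r; first exact: ltW.
by rewrite mulrA ler_pdivrMr ?ltr_wpDl// mulrC; apply: ler_wpM2l; [exact: ltW|rewrite lerDl].
Qed.

(** The difference quotient minus [G z] is carried by [L r] to
    [P h / h - 1] applied to [L r (G z)], which is small in the weighted norm. *)
Lemma smoothed_gen x e : D x -> 0 < e ->
  gen_graph F (iota (E e x)) (iota (G (E e x))).
Proof.
move=> Dx e0 k k0; set z := E e x.
have Dz : D z by apply: D_E => //; exact: ltW.
have Dw : D (G z) by exact: D_G.
have gz := gen_graph_op (@E_dom e x e0).
pose v h := h^-1 *: (E h z - z) - G z.
have DEz h : 0 < h -> D (E h z - z) /\ iota (E h z - z) = iota (E h z) - iota z.
  by move=> h0; apply: completionB => //; apply: D_E => //; exact: ltW.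
have Dv h : 0 < h -> D (v h) /\ iota (v h) = h^-1 *: (iota (E h z) - iota z) - iota (G z).
  move=> h0; have [d1 e1] := DEz h h0; have [d2 e2] := completionZ h^-1 d1.
  by have [d3 ->] := completionB d2 Dw; rewrite e2 e1.
have [|h h0|h y h0|y e1 e10|h h0|h r h0 r0|b b0 hb] :=
  @completion_small (fun h y => h^-1 *: P h y - y) (M + 1) (G z) _ Dw _ _ _ v _ _ k k0.
- exact: addr_ge0.
- move=> c y y'; rewrite (orbit_integral_linear E_c0 E_bound M_ge0) scalerDr !scalerA (mulrC _ c) -!scalerA.
  by rewrite scalerBr opprD addrACA.
- apply: le_trans (ler_normB _ _) _; rewrite mulrDl mul1r lerD2r.
  rewrite normrZ gtr0_norm ?invr_gt0// mulrC ler_pdivrMr// mulrAC.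
  exact: (orbit_integral_bound E_c0 E_bound M_ge0 _ (ltW h0)).
- have [d d0 hd] := orbit_integral_near0 E_c0 E_bound M_ge0 y e10.
  exists d => // h /andP[h0 hd'].
  have -> : h^-1 *: P h y - y = h^-1 *: (P h y - h *: y).
    by rewrite scalerBr scalerA mulVf ?scale1r// gt_eqF.
  by rewrite normrZ gtr0_norm ?invr_gt0// mulrC ler_pdivrMr//; apply: hd; rewrite (ltW h0).
- by have [] := Dv h h0.
- rewrite /v (linear_sub (L_lin r0)) (linear_scale (L_lin r0)) (linear_sub (L_lin r0)).
  rewrite (orbit_integral_gen E_c0 E_bound M_ge0 (ltW h0) (transform_gen_graph r0 gz)).
  by rewrite L_comm// ltW.
exists b => // h /[dup] hh /andP[h0 _]; have := hb h hh.
have [_ ->] := Dv h h0 => hv.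
have -> : F h (iota z) - iota z - h *: iota (G z) = h *: (h^-1 *: (iota (E h z) - iota z) - iota (G z)).
  by rewrite F_iota ?(ltW h0)// scalerBr scalerA mulfV ?scale1r// gt_eqF.
by rewrite normrZ gtr0_norm// mulrC; apply: ler_wpM2r => //; exact: ltW.
Qed.

Lemma smoothed_dom : smoothed `<=` gen_dom F.
Proof.
by move=> _ [x [e [Dx e0 ->]]]; have /gen_graphP[] := smoothed_gen Dx e0.
Qed.

(** The heart of the matter.  As [L r (E t w) = L (r + t) w], the left-hand side
    is the double integral of [r^a * `|L (r + t) (G z)|], and analyticity bounds
    [`|L t (G z)| = `|G (E (t / 2) (L (t / 2) z))|] by
    [(2 * M1 / t) * `|L (t / 2) z|]: this is [weighted_hardy]. *)
Lemma smoothed_integral y : smoothed y ->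
  (\int[mu]_(t in pos) (`|F t (gen_op F y)|)%:E <= (4 / (a + 1) * (2 * M1) * `|y|)%:E)%E.
Proof.
move=> [x [e [Dx e0 ->]]]; set z := E e x.
have Dz : D z by apply: D_E => //; exact: ltW.
have Dw : D (G z) by exact: D_G.
have gz := gen_graph_op (@E_dom e x e0).
have /gen_graphP[_ ->] := smoothed_gen Dx e0.
pose g := path_norm (L ^~ (G z)); pose h := path_norm (L ^~ z).
have g0 u t : 0 <= path_norm (u : R -> X) t by rewrite /path_norm; case: ifP.
have gh t : 0 < t -> g t <= 2 * M1 / t * h (t / 2).
  move=> t0; have s0 : 0 < t / 2 by rewrite divr_gt0.
  rewrite /g /h /path_norm t0 s0.
  have /gen_graphP[_ E1] := gen_graph_semigroup E_c0 E_bound M_ge0 (ltW s0) (transform_gen_graph s0 gz).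
  have E2 : L t (G z) = E (t / 2) (L (t / 2) (G z)) by rewrite -L_add// ?(ltW s0)// -splitr.
  have := @E_gen (t / 2) (L (t / 2) z) s0; rewrite E1 -E2 normrZ gtr0_norm// => b.
  rewrite -(ler_pM2l s0); apply: le_trans b _.
  by rewrite le_eqVlt; apply/orP; left; apply/eqP; field; exact: lt0r_neq0.
have C0 : 0 <= 2 * M1 by exact: mulr_ge0.
have wh := @weighted_hardy R a a_gtN1 a_lt0 g h (2 * M1) C0
  (path_norm_measurable (fun t t0 => transform_tcont (G z) t0))
  (path_norm_measurable (fun t t0 => transform_tcont z t0)) (g0 _) (g0 _) gh.
rewrite EFinM iota_norm//.
move: wh; have -> : (\int[mu]_(r in pos) (r `^ a * h r)%:E = weighted_norm a (L ^~ z))%E.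
  by apply: eq_integral => r /set_mem r0; rewrite /h /path_norm ifT.
apply: le_trans; rewrite le_eqVlt; apply/predU1P; left.
apply: eq_integral => t /set_mem t0; rewrite F_iota ?ltW// iota_norm; last by apply: D_E => //; exact: ltW.
apply: eq_integral => r /set_mem r0; rewrite /g /path_norm ifT ?addr_gt0//.
by rewrite L_add ?(ltW t0)// L_comm ?(ltW t0).
Qed.

Theorem completion_maximal_regularity : exists2 C, 0 <= C & forall C', C <= C' ->
  forall (T : \bar R) x f, (0 < T)%E -> in_L1 [set: B] Num.norm (time_interval T) f ->
  uniquely_solvable_with_bound F T C' x f.
Proof.
have K0 : 0 <= 4 / (a + 1) * (2 * M1).
  by rewrite !mulr_ge0// invr_ge0 -lerBlDr sub0r ltW.
exact: (maximal_regularity extension_c0 extension_bound M_ge0 K0 smoothed_dense smoothed_0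
  smoothed_dom smoothed_integral).
Qed.

End extended_semigroup.

(** * The two homogeneous Besov scales *)

Section analytic_semigroup.
Context {R : realType} {X : completeNormedModType R}.
Local Notation mu := (@lebesgue_measure R).
Variables (DS : set X) (S : X -> X) (E : R -> X -> X) (M M1 : R).
Hypothesis E_c0 : c0_semigroup E.
Hypothesis DSE : DS = gen_dom E.
Hypothesis SE : forall x, DS x -> S x = gen_op E x.
Hypothesis E_bound : forall t x, 0 <= t -> `|E t x| <= M * `|x|.
Hypothesis M_ge0 : 0 <= M.
Hypothesis E_dom : forall t x, 0 < t -> gen_dom E (E t x).
Hypothesis E_gen : forall t x, 0 < t -> `|t *: gen_op E (E t x)| <= M1 * `|x|.
Hypothesis M1_ge0 : 0 <= M1.
Variables (s : R).
Hypothesis hs : 0 < s < 2.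
Local Notation G := (gen_op E).

Let E_lin t : 0 <= t -> linear (E t).
Proof. by case: E_c0 => h _ _ _ /h[]. Qed.

Let E_add t r x : 0 <= t -> 0 <= r -> E (t + r) x = E t (E r x).
Proof. by case: E_c0 => _ _ h _; exact: h. Qed.

Let graphS x : DS x -> gen_graph E x (S x).
Proof. by move=> Dx; rewrite SE//; apply: gen_graph_op; rewrite -DSE. Qed.

Let graphE t x : 0 < t -> gen_graph E (E t x) (G (E t x)).
Proof. by move=> t0; apply: gen_graph_op; exact: E_dom. Qed.

Let graph_dom x y : gen_graph E x y -> DS x /\ S x = y.
Proof. by move=> /gen_graphP[dx <-]; rewrite DSE; split => //; rewrite SE// DSE. Qed.

Lemma generator_semigroup t r x : 0 < t -> 0 <= r -> G (E (t + r) x) = E r (G (E t x)).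
Proof.
move=> t0 r0; have /gen_graphP[_ <-] := gen_graph_semigroup E_c0 E_bound M_ge0 r0 (graphE x t0).
by rewrite -E_add// ?(ltW t0)// addrC.
Qed.

(** The norm is the weighted norm with [L r = G (E r)] and exponent [- s / 2],
    since [`|t *: y| / t = `|y|]. *)
Lemma besov_pos_regularity (B : completeNormedModType R) (iota : X -> B) (F : R -> B -> B) :
  is_completion DS (besov_norm_pos S E s) iota -> extends_by_continuity DS iota E F ->
  exists2 C, 0 <= C & forall C', C <= C' ->
  forall (T : \bar R) x f, (0 < T)%E -> in_L1 [set: B] Num.norm (time_interval T) f ->
  uniquely_solvable_with_bound F T C' x f.
Proof.
move=> hB hF.
apply: (@completion_maximal_regularity R X B E M M1 (fun r x => G (E r x)) (- (s / 2)) DS iota F) => //.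
- by move: hs; lra.
- by move: hs; lra.
- move=> r r0 c x y; rewrite (E_lin (ltW r0)).
  have := gen_graph_linear E_c0 E_bound M_ge0 c (graphE x r0) (graphE y r0).
  by case/gen_graphP.
- move=> r r0; exists (M1 / r); first by rewrite divr_ge0// ltW.
  move=> x; have := E_gen x r0; rewrite normrZ gtr0_norm// mulrAC ler_pdivlMr// mulrC.
  by [].
- by move=> r t x r0 t0; exact: generator_semigroup.
- by move=> r t x r0 t0; rewrite -E_add ?(ltW r0)//; exact: generator_semigroup.
- move=> c x y Dx Dy; have [] // := graph_dom (gen_graph_linear E_c0 E_bound M_ge0 c (graphS Dx) (graphS Dy)).
- by have [] := graph_dom (gen_graph0 E_c0 E_bound M_ge0).
- by move=> t x t0 Dx; have [] := graph_dom (gen_graph_semigroup E_c0 E_bound M_ge0 t0 (graphS Dx)).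
- move=> t x t0 Dx; have t2 : 0 < t / 2 by rewrite divr_gt0.
  rewrite (splitr t) generator_semigroup ?(ltW t2)// DSE; exact: E_dom.
suff <- : besov_norm_pos S E s = fun x => weighted_norm (- (s / 2)) (fun r => G (E r x)) by [].
apply/funext => x; apply: eq_integral => t /set_mem t0; rewrite SE; last by rewrite DSE; exact: E_dom.
by rewrite normrZ gtr0_norm// -mulrA (mulrC t) mulfK// gt_eqF.
Qed.

(** The norm is the weighted norm with [L r = E r] and exponent [s / 2 - 1].
    On the range of [S], [G (E t x) = S (E t x)] shows that [D] is stable. *)
Lemma besov_neg_regularity (B : completeNormedModType R) (iota : X -> B) (F : R -> B -> B) :
  is_completion (S @` DS) (besov_norm_neg E s) iota -> extends_by_continuity (S @` DS) iota E F ->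
  exists2 C, 0 <= C & forall C', C <= C' ->
  forall (T : \bar R) x f, (0 < T)%E -> in_L1 [set: B] Num.norm (time_interval T) f ->
  uniquely_solvable_with_bound F T C' x f.
Proof.
move=> hB hF.
apply: (@completion_maximal_regularity R X B E M M1 E (s / 2 - 1) (S @` DS) iota F) => //.
- by move: hs; lra.
- by move: hs; lra.
- by move=> r r0; exact: E_lin (ltW r0).
- by move=> r r0; exists M => // x; exact: E_bound (ltW r0).
- by move=> r t x r0 t0; rewrite addrC E_add// ltW.
- by move=> r t x r0 t0; rewrite -!E_add ?(ltW r0)// addrC.
- move=> c _ _ [x Dx <-] [y Dy <-].
  have [Dz <-] := graph_dom (gen_graph_linear E_c0 E_bound M_ge0 c (graphS Dx) (graphS Dy)).
  by exists (c *: x + y).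
- by have [D0 <-] := graph_dom (gen_graph0 E_c0 E_bound M_ge0); exists 0.
- move=> t _ t0 [x Dx <-].
  have [Dz <-] := graph_dom (gen_graph_semigroup E_c0 E_bound M_ge0 t0 (graphS Dx)).
  by exists (E t x).
- move=> t x t0 _; have DE : DS (E t x) by rewrite DSE; exact: E_dom.
  by exists (E t x) => //; rewrite SE.
suff <- : besov_norm_neg E s = fun x => weighted_norm (s / 2 - 1) (E ^~ x) by [].
apply/funext => x; apply: eq_integral => t /set_mem t0.
rewrite powRD; last by apply/implyP => _; exact: lt0r_neq0.
by rewrite powRN powRr1 ?(ltW t0)// mulrAC.
Qed.

End analytic_semigroup.

Theorem theorem4p5 (R : realType) (X : completeNormedModType R)
    (* S : DS -> X is one-to-one and generates the semigroup E t = e^{tS} *)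
    (DS : set X) (S : X -> X) (E : R -> X -> X)
    (hgen : generates DS S E)
    (hana : bounded_analytic_semigroup E)
    (hinj : set_inj DS S)
    (s : R) (hs : 0 < s < 2)
    (* the completion of D(S) and the semigroup T_s on it *)
    (Bp : completeNormedModType R) (iotap : X -> Bp)
    (hBp : is_completion DS (besov_norm_pos S E s) iotap)
    (Tp : R -> Bp -> Bp)
    (hTp : extends_by_continuity DS iotap E Tp)
    (* the completion of R(S) and the semigroup T_{-s} on it *)
    (Bm : completeNormedModType R) (iotam : X -> Bm)
    (hBm : is_completion (S @` DS) (besov_norm_neg E s) iotam)
    (Tm : R -> Bm -> Bm)
    (hTm : extends_by_continuity (S @` DS) iotam E Tm) :
  exists C : R, forall T : \bar R, (0 < T)%E ->
    (forall (x : Bp) (f : R -> Bp),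
       in_L1 [set: Bp] Num.norm (time_interval T) f ->
       uniquely_solvable_with_bound Tp T C x f) /\
    (forall (x : Bm) (f : R -> Bm),
       in_L1 [set: Bm] Num.norm (time_interval T) f ->
       uniquely_solvable_with_bound Tm T C x f).
Proof.
have [E_c0 DSE SE] := hgen; have [_ [M0 hM0] E_dom [M1 hM1]] := hana.
have bound t x : 0 <= t -> `|E t x| <= `|M0| * `|x|.
  by move=> t0; apply: le_trans (hM0 t x t0) _; apply: ler_wpM2r => //; exact: ler_norm.
have gen t x : 0 < t -> `|t *: gen_op E (E t x)| <= `|M1| * `|x|.
  by move=> t0; apply: le_trans (hM1 t x t0) _; apply: ler_wpM2r => //; exact: ler_norm.
have [Cp _ hp] := besov_pos_regularity E_c0 DSE SE bound (normr_ge0 _) E_dom gen (normr_ge0 _) hs hBp hTp.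
have [Cm _ hm] := besov_neg_regularity E_c0 DSE SE bound (normr_ge0 _) E_dom gen (normr_ge0 _) hs hBm hTm.
exists (Num.max Cp Cm) => T T0; split=> x f hf.
- by apply: hp => //; rewrite le_max lexx.
- by apply: hm => //; rewrite le_max lexx orbT.
Qed.
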